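(* Let $I$ be an interval in $(0,+\infty)$, $\varphi$ a non-negative measurable function defined on $\mathbb{R}^n \times I$, $\psi$ a non-negative measurable function defined on $\mathbb{R}^n$, $\alpha \in \mathbb{R}$, $p \in \mathbb{R}$, and $q \in \mathbb{R} \cup \{+\infty\}$; when $\alpha = 0$, let $I \subset (1,+\infty)$. Let $\ell = \ell(p,q)$ be the exponent defined in the context. Assume that the following conditions are satisfied: (i) $\varphi$ is almost-strictly $\alpha$-parabolically $p$-concave on $\mathbb{R}^n \times I$. (ii) $\psi$ is $q$-concave on $\mathbb{R}^n$. (iii) $\mathbb{R}^n \setminus \psi^{-1}(0)$ is bounded, and its interior is not empty. (iv) $p+q \geq 0$ and $\ell \geq -1/n$. Then the function $$\Gamma(x,t) = \int_{\mathbb{R}^n} \varphi(x-y,t)\,\psi(y)\,\mathrm{d}y, \quad (x,t) \in \mathbb{R}^n \times I,$$ is strictly $\alpha$-parabolically $\ell/(1+n\ell)$-concave on $\mathbb{R}^n \times I$.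
   Context: Means. For $a,b \in [0,+\infty)$, $\lambda \in [0,1]$ and $p \in \mathbb{R} \cup \{\pm\infty\}$, put $M_p(a,b;\lambda) = 0$ if $ab=0$; and, if $ab>0$, $M_p(a,b;\lambda) = ((1-\lambda)a^p + \lambda b^p)^{1/p}$ for $p \in \mathbb{R}\setminus\{0\}$, $M_0(a,b;\lambda) = a^{1-\lambda}b^\lambda$, $M_{+\infty}(a,b;\lambda) = \max\{a,b\}$, $M_{-\infty}(a,b;\lambda) = \min\{a,b\}$. For two points (or numbers) $x_0,x_1$ write $x_\lambda = (1-\lambda)x_0 + \lambda x_1$. Power concavity. A non-negative function $f$ on a convex set $A \subset \mathbb{R}^n$ is $p$-concave on $A$ if $f(x_\lambda) \geq M_p(f(x_0),f(x_1);\lambda)$ for all $x_0,x_1 \in A$ and $\lambda \in [0,1]$. Parabolic convexity. For $\alpha\in\mathbb{R}$, a set $E \subset \mathbb{R}^n \times (0,+\infty)$ is $\alpha$-parabolically convex if $(x_\lambda, M_\alpha(t_0,t_1;\lambda)) \in E$ for all $(x_0,t_0),(x_1,t_1) \in E$ and $\lambda \in [0,1]$. (The set $\mathbb{R}^n\times I$ is $\alpha$-parabolically convex for every $\alpha$.) Parabolic power concavity. Let $E$ be $\alpha$-parabolically convex and $\varphi$ a non-negative function on $E$. $\varphi$ is $\alpha$-parabolically $p$-concave on $E$ if for all $(x_0,t_0),(x_1,t_1)\in E$ and $\lambda \in [0,1]$, $$( * )\quad \varphi(x_\lambda, M_\alpha(t_0,t_1;\lambda)) \geq M_p(\varphi(x_0,t_0),\varphi(x_1,t_1);\lambda).$$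 It is strictly $\alpha$-parabolically $p$-concave if moreover equality in $( * )$ holds if and only if $(x_0,t_0)=(x_1,t_1)$ or $\lambda=0$ or $\lambda=1$. For $\alpha \neq 0$, it is almost-strictly $\alpha$-parabolically $p$-concave if it is $\alpha$-parabolically $p$-concave and equality in $( * )$ holds if and only if $x_0/t_0^\alpha = x_1/t_1^\alpha$ or $\lambda=0$ or $\lambda=1$. For $\alpha=0$ and $E \subset \mathbb{R}^n\times(1,+\infty)$, it is almost-strictly $0$-parabolically $p$-concave if it is $0$-parabolically $p$-concave and equality in $( * )$ (with $\alpha=0$) holds if and only if $x_0/\log t_0 = x_1/\log t_1$ or $\lambda=0$ or $\lambda=1$. Exponent. $\ell = \frac{pq}{p+q}$ if $p+q\neq 0$; $\ell=-\infty$ if $p+q=0$ and $(p,q)\neq(0,0)$; $\ell=0$ if $(p,q)=(0,0)$. For $q=+\infty$ and $p\in\mathbb{R}$, $\frac{pq}{p+q}$ is understood as $p$. The exponent $\ell/(1+n\ell)$ is understood as $-\infty$ when $\ell=-1/n$.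
   Formalization: When ℓ = -1/n the exponent of Γ is -∞ and the mean is the minimum even at λ = 0 and λ = 1, so equality there fails in general; in that case the equality clause of strict concavity is stated only for 0 < λ < 1. *)

(* Defs.v *)
From HB Require Import structures.
From mathcomp Require Import all_boot all_order all_algebra.
From mathcomp Require Import all_classical all_reals all_analysis.

Set Implicit Arguments.
Unset Strict Implicit.
Unset Printing Implicit Defensive.

Import Order.TTheory GRing.Theory Num.Theory.
Import numFieldNormedType.Exports.

Local Open Scope classical_set_scope.
Local Open Scope ring_scope.

(* Cylinders over one coordinate; they generate the Borel sigma-algebra. *)
Definition cylinders (R : realType) (n : nat) : set (set 'rV[R]_n) :=
  [set A | exists i : 'I_n, exists2 Y : set R,
     measurable Y & A = [set x : 'rV[R]_n | Y (x ord0 i)]].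

Definition borel_rV (R : realType) (n : nat) :=
  g_sigma_algebraType (@cylinders R n).

HB.instance Definition _ (R : realType) (n : nat) :=
  Measurable.on (borel_rV R n).

(* R^n * R is identified with R^(n+1) with the time coordinate first, because
   1 + n, unlike n + 1, is convertible to n.+1. *)
Definition join_rV (R : realType) (n : nat) (z : 'rV[R]_n * R) : 'rV[R]_n.+1 :=
  row_mx (z.2)%:M z.1.

(* The inverse of [join_rV]. *)
Definition split_rV (R : realType) (n : nat) (w : 'rV[R]_n.+1) : 'rV[R]_n * R :=
  (rsubmx (w : 'rV[R]_(1 + n)), w ord0 ord0).

Lemma measurable_join_rV (R : realType) (n : nat) :
  measurable_fun [set: borel_rV R n * measurableTypeR R]
    (@join_rV R n : borel_rV R n * measurableTypeR R -> borel_rV R n.+1).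
Proof.
apply: (measurability (@cylinders R n.+1 : set (set (borel_rV R n.+1)))) => //.
move=> _ [_ [i [Y mY ->]] <-]; rewrite setTI.
case: (split_ordP (i : 'I_(1 + n))) => [j ->|j ->].
  have -> : (@join_rV R n) @^-1` [set x | Y (x ord0 (lshift n j))] =
      (snd : borel_rV R n * measurableTypeR R -> measurableTypeR R) @^-1` Y.
    apply/seteqP; split=> -[x t] /=;
    by rewrite (row_mxEl (t%:M : 'M[R]_1) x) (ord1 j) mxE mulr1n.
  rewrite -[X in measurable X]setTI.
  exact: (@measurable_snd _ _ (borel_rV R n) (measurableTypeR R)).
have -> : (@join_rV R n) @^-1` [set x | Y (x ord0 (rshift 1 j))] =
    (fst : borel_rV R n * measurableTypeR R -> borel_rV R n) @^-1`
      [set x | Y (x ord0 j)].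
  by apply/seteqP; split=> -[x t] /=; rewrite (row_mxEr (t%:M : 'M[R]_1) x).
rewrite -[X in measurable X]setTI.
apply: (@measurable_fst _ _ (borel_rV R n) (measurableTypeR R)) => //.
by apply: sub_sigma_algebra; exists j, Y.
Qed.

Section add_coordinate.
Context (R : realType) (n : nat) (mu : {measure set (borel_rV R n) -> \bar R}).

Definition add_coordinate : set (borel_rV R n.+1) -> \bar R :=
  pushforward (mu \x @lebesgue_measure R)%E
    (@join_rV R n : borel_rV R n * measurableTypeR R -> borel_rV R n.+1).

HB.instance Definition _ := Measure.copy add_coordinate
  (measure_function_pushforward__canonical__measure_function_Measure
     (mu \x @lebesgue_measure R)%E (@measurable_join_rV R n)).

End add_coordinate.

(* The n-fold product of the one-dimensional Lebesgue measure. *)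
Fixpoint borel_lebesgue (R : realType) (n : nat) :
    {measure set (borel_rV R n) -> \bar R} :=
  match n with
  | 0 => \d_(0 : borel_rV R 0)
  | m.+1 => add_coordinate (borel_lebesgue R m)
  end.

(* R^n with the Lebesgue sigma-algebra, and its Lebesgue measure: the
   completion of the product measure. *)
Definition lebesgue_rV (R : realType) (n : nat) :=
  caratheodory_type ((borel_lebesgue R n)^*)%mu.

HB.instance Definition _ (R : realType) (n : nat) :=
  Measurable.on (lebesgue_rV R n).

Definition lebesgue_measure_rV (R : realType) (n : nat) :
    {measure set (lebesgue_rV R n) -> \bar R} :=
  @completed_measure_extension _ _ _ (borel_lebesgue R n).

Definition power_mean (R : realType) (p : \bar R) (a b lam : R) : R :=
  if a * b == 0 then 0 else
  match p with
  | r%:E => if r == 0 then a `^ (1 - lam) * b `^ lam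
            else ((1 - lam) * a `^ r + lam * b `^ r) `^ r^-1
  | +oo%E => Num.max a b
  | -oo%E => Num.min a b
  end.

Definition segment_point (R : realType) (n : nat) (x0 x1 : 'rV[R]_n) (lam : R) :
    'rV[R]_n :=
  (1 - lam) *: x0 + lam *: x1.

Definition power_concave (R : realType) (n : nat) (p : \bar R)
    (A : set 'rV[R]_n) (f : 'rV[R]_n -> R) : Prop :=
  forall (x0 x1 : 'rV[R]_n) (lam : R), A x0 -> A x1 -> 0 <= lam <= 1 ->
    power_mean p (f x0) (f x1) lam <= f (segment_point x0 x1 lam).

Definition parabolic_point (R : realType) (n : nat) (alpha : R)
    (z0 z1 : 'rV[R]_n * R) (lam : R) : 'rV[R]_n * R :=
  (segment_point z0.1 z1.1 lam, power_mean alpha%:E z0.2 z1.2 lam).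

Definition parabolically_convex (R : realType) (n : nat) (alpha : R)
    (E : set ('rV[R]_n * R)) : Prop :=
  forall (z0 z1 : 'rV[R]_n * R) (lam : R), E z0 -> E z1 -> 0 <= lam <= 1 ->
    E (parabolic_point alpha z0 z1 lam).

Definition parabolically_concave (R : realType) (n : nat) (alpha : R)
    (p : \bar R) (E : set ('rV[R]_n * R)) (f : 'rV[R]_n * R -> R) : Prop :=
  parabolically_convex alpha E /\
  forall (z0 z1 : 'rV[R]_n * R) (lam : R), E z0 -> E z1 -> 0 <= lam <= 1 ->
    power_mean p (f z0) (f z1) lam <= f (parabolic_point alpha z0 z1 lam).

(* Equality in the concavity inequality holds iff [same z0 z1], lam = 0 or
   lam = 1.  The guard only bites for p = +oo and p = -oo, where the mean is
   max or min for every lam: at lam = 0 and lam = 1 it is then not f z0,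
   resp. f z1, so that equality at the endpoints cannot be asked for. *)
Definition equality_iff_same (R : realType) (n : nat) (alpha : R)
    (p : \bar R) (E : set ('rV[R]_n * R)) (f : 'rV[R]_n * R -> R)
    (same : 'rV[R]_n * R -> 'rV[R]_n * R -> Prop) : Prop :=
  forall (z0 z1 : 'rV[R]_n * R) (lam : R), E z0 -> E z1 -> 0 <= lam <= 1 ->
    p \is a fin_num \/ 0 < lam < 1 ->
    (f (parabolic_point alpha z0 z1 lam) = power_mean p (f z0) (f z1) lam <->
     [\/ same z0 z1, lam = 0 | lam = 1]).

Definition strictly_parabolically_concave (R : realType) (n : nat) (alpha : R)
    (p : \bar R) (E : set ('rV[R]_n * R)) (f : 'rV[R]_n * R -> R) : Prop :=
  parabolically_concave alpha p E f /\
  equality_iff_same alpha p E f (fun z0 z1 => z0 = z1).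

(* For alpha = 0 this is meant for times t > 1 only, where ln t > 0. *)
Definition same_parabolic_ray (R : realType) (n : nat) (alpha : R)
    (z0 z1 : 'rV[R]_n * R) : Prop :=
  if alpha == 0 then (ln z0.2)^-1 *: z0.1 = (ln z1.2)^-1 *: z1.1
  else (z0.2 `^ alpha)^-1 *: z0.1 = (z1.2 `^ alpha)^-1 *: z1.1.

Definition almost_strictly_parabolically_concave (R : realType) (n : nat)
    (alpha : R) (p : \bar R) (E : set ('rV[R]_n * R))
    (f : 'rV[R]_n * R -> R) : Prop :=
  parabolically_concave alpha p E f /\
  equality_iff_same alpha p E f (@same_parabolic_ray R n alpha).

(* The value at q = -oo is junk. *)
Definition ell (R : realType) (p : R) (q : \bar R) : \bar R :=
  match q with
  | r%:E => if p + r != 0 then (p * r / (p + r))%:E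
            else if (p == 0) && (r == 0) then 0%E else -oo%E
  | +oo%E => p%:E
  | -oo%E => -oo%E
  end.

(* l / (1 + n l); the values at l = +oo and l = -oo are never used. *)
Definition convolution_exponent (R : realType) (n : nat) (l : \bar R) :
    \bar R :=
  match l with
  | r%:E => if r == - n%:R^-1 then -oo%E else (r / (1 + n%:R * r))%:E
  | _ => (n%:R^-1)%:E
  end.

Definition convolution (R : realType) (n : nat) (phi : 'rV[R]_n * R -> R)
    (psi : 'rV[R]_n -> R) (z : 'rV[R]_n * R) : \bar R :=
  (\int[lebesgue_measure_rV R n]_(y in setT)
     (phi (z.1 - (y : 'rV[R]_n), z.2) * psi y)%:E)%E.

(* Main.v *)
(* Hölder's inequality for means turns the hypotheses into
     h ((1 - lam) y0 + lam y1) >= M_l (f0 y0) (f1 y1),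
   where f_k y = phi (x_k - y, t_k) psi y and h is the analogous integrand at
   the parabolic point, so that concavity is the Borell-Brascamp-Lieb
   inequality.  That inequality is proved on the line by comparing superlevel
   sets after normalising suprema, in R^n by Fubini, and for Lebesgue
   measurable functions by Borel minorants and majorants.

   For strictness, cut R^n into three slabs orthogonal to a coordinate axis, in
   such a way that f0 and f1 give the same fractions of their masses to
   corresponding slabs.  The pointwise inequality is strict unless y1 is the
   image of y0 under the homothety given by the ray condition.  If its
   i-th coordinate map does not transport the i-th marginal of f0 to that of
   f1, the middle slabs can be chosen so that it never matches them, and
   compactness gains a factor c > 1 there.  Otherwise it fixes both ends of the
   projection of the bounded support of psi, hence is the identity; if this
   holds for all i, then t0 = t1 and x0 = x1. *)

From HB Require Import structures.
Require Import Defs.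
From mathcomp Require Import all_boot all_order all_algebra.
From mathcomp Require Import all_classical all_reals all_analysis.
From mathcomp Require Import measurable_realfun ring lra.

Set Implicit Arguments.
Unset Strict Implicit.
Unset Printing Implicit Defensive.

Import Order.TTheory GRing.Theory Num.Theory.
Import numFieldNormedType.Exports.

Local Open Scope classical_set_scope.
Local Open Scope ring_scope.

(** * Power means *)

(** Strictness at one fixed time settles all signs. Two distinct points with the same t never lie on
    one ray; hence [phi] is positive, and p > 0 is impossible, since a positive p-concave function
    on all of R^n would then be constant. So, unless I is empty, p <= 0 <= q and -1/n <= l <= 0.
    Hölder is therefore needed only for such signs, and the exponents l / (1 + k l) met while
    integrating out k coordinates stay finite for k < n; -oo can occur only at k = n.

    A strict pointwise inequality does not suffice by itself: each y0 has a partner y1 for which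
    equality may hold. Slabs remove the partners. Because the mean is homogeneous and the mass
    fractions are equal, the three lower bounds add up to the mean of the total masses, so any
    factor on the middle slab is pure gain.

    The partner map is y -> a y + (x1 - a x0), where a = s1 / s0 and s_k is t_k^alpha or log t_k. It
    fixes the ends of the projected support because f0 and f1 are comparable, both being [psi] times
    a positive continuous function; continuity of [phi] in x comes from its concavity. *)

Section power_means.
Context {R : realType}.
Implicit Types (a b c d s r p lam : R) (e q : \bar R).

Lemma powR_neg_le r a b : r <= 0 -> 0 < a -> a <= b -> b `^ r <= a `^ r.
Proof.
move=> r0 a0 ab; rewrite -(opprK r) (powRN a) (powRN b).
rewrite lef_pV2 ?posrE ?powR_gt0// ?(lt_le_trans a0)//.
by rewrite ge0_ler_powR ?nnegrE ?oppr_ge0// ?(ltW a0) ?(le_trans (ltW a0)).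
Qed.

Lemma powRVK r a : r != 0 -> 0 <= a -> (a `^ r) `^ r^-1 = a.
Proof. by move=> r0 a0; rewrite -powRrM divff// powRr1. Qed.

Lemma powRKV r a : r != 0 -> 0 <= a -> (a `^ r^-1) `^ r = a.
Proof. by move=> r0 a0; rewrite -powRrM mulVf// powRr1. Qed.

Lemma conv_gt0 lam a b : 0 <= lam <= 1 -> 0 < a -> 0 < b ->
  0 < (1 - lam) * a + lam * b.
Proof.
move=> /andP[l0 l1] a0 b0; move: l0; rewrite le_eqVlt => /predU1P[<-|l0].
  by rewrite subr0 mul1r mul0r addr0.
by rewrite ltr_wpDl ?mulr_gt0// mulr_ge0 ?subr_ge0// ltW.
Qed.

Lemma power_mean_fin r lam a b : r != 0 -> 0 < a -> 0 < b ->
  power_mean r%:E a b lam = ((1 - lam) * a `^ r + lam * b `^ r) `^ r^-1.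
Proof.
by move=> r0 a0 b0; rewrite /power_mean mulf_eq0 (negPf r0) !gt_eqF.
Qed.

Lemma power_mean0 lam a b : 0 < a -> 0 < b ->
  power_mean 0%:E a b lam = a `^ (1 - lam) * b `^ lam.
Proof. by move=> a0 b0; rewrite /power_mean mulf_eq0 eqxx !gt_eqF. Qed.

Lemma power_mean_pinfty lam a b : 0 < a -> 0 < b ->
  power_mean +oo a b lam = Num.max a b.
Proof. by move=> a0 b0; rewrite /power_mean mulf_eq0 !gt_eqF. Qed.

Lemma power_mean_ninfty lam a b : 0 < a -> 0 < b ->
  power_mean -oo a b lam = Num.min a b.
Proof. by move=> a0 b0; rewrite /power_mean mulf_eq0 !gt_eqF. Qed.

Lemma power_mean_eq0 e lam a b : a * b = 0 -> power_mean e a b lam = 0.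
Proof. by move=> ab0; rewrite /power_mean ab0 eqxx. Qed.

Lemma power_mean_1 lam a b : 0 <= lam <= 1 -> 0 < a -> 0 < b ->
  power_mean 1%:E a b lam = (1 - lam) * a + lam * b.
Proof.
move=> l01 a0 b0; rewrite power_mean_fin ?oner_eq0// invr1.
by rewrite (powRr1 (ltW a0)) (powRr1 (ltW b0)) powRr1// ltW// conv_gt0.
Qed.

Lemma power_mean_ge0 e lam a b : 0 <= a -> 0 <= b -> 0 <= power_mean e a b lam.
Proof.
move=> a0 b0; rewrite /power_mean; case: ifP => // _.
case: e => [r| |]; last 2 first.
- by rewrite le_max a0.
- by rewrite le_min a0.
by case: ifP => _; rewrite ?mulr_ge0 ?powR_ge0.
Qed.

Lemma power_mean_gt0 e lam a b : 0 <= lam <= 1 -> 0 < a -> 0 < b ->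
  0 < power_mean e a b lam.
Proof.
move=> l01 a0 b0; case: e => [r| |]; last 2 first.
- by rewrite power_mean_pinfty// lt_max a0.
- by rewrite power_mean_ninfty// lt_min a0.
have [->|r0] := eqVneq r 0; first by rewrite power_mean0// mulr_gt0 ?powR_gt0.
by rewrite power_mean_fin// powR_gt0// conv_gt0// powR_gt0.
Qed.

Lemma power_meanZ e lam s a b : 0 <= lam <= 1 -> 0 <= s -> 0 <= a -> 0 <= b ->
  power_mean e (s * a) (s * b) lam = s * power_mean e a b lam.
Proof.
move=> l01; rewrite le_eqVlt => /predU1P[<-|s0].
  by rewrite !mul0r power_mean_eq0// mul0r.
rewrite le_eqVlt => /predU1P[<-|a0].
  by rewrite mulr0 !power_mean_eq0 ?mul0r// mulr0.
rewrite le_eqVlt => /predU1P[<-|b0].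
  by rewrite mulr0 !power_mean_eq0 ?mulr0.
have sa : 0 < s * a by rewrite mulr_gt0.
have sb : 0 < s * b by rewrite mulr_gt0.
have s0' := ltW s0; have a0' := ltW a0; have b0' := ltW b0.
case: e => [r| |]; last 2 first.
- by rewrite !power_mean_pinfty// maxr_pMr.
- by rewrite !power_mean_ninfty// minr_pMr.
have [->|r0] := eqVneq r 0.
  rewrite !power_mean0// !powRM// mulrACA -powRD ?subrK ?powRr1//.
  by rewrite (gt_eqF s0) implybT.
rewrite !power_mean_fin// !powRM// !(mulrCA _ (s `^ r)) -mulrDr powRM ?powR_ge0//.
  by rewrite powRVK.
by apply/ltW/conv_gt0; rewrite ?powR_gt0.
Qed.

Lemma le_power_mean e lam a b c d : 0 <= lam <= 1 ->
  0 <= a -> 0 <= b -> a <= c -> b <= d ->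
  power_mean e a b lam <= power_mean e c d lam.
Proof.
move=> l01 a0 b0 ac bd; have c0 := le_trans a0 ac; have d0 := le_trans b0 bd.
move: a0; rewrite le_eqVlt => /predU1P[<-|a0].
  by rewrite power_mean_eq0 ?mul0r// power_mean_ge0.
move: b0; rewrite le_eqVlt => /predU1P[<-|b0].
  by rewrite power_mean_eq0 ?mulr0// power_mean_ge0.
have {}c0 := lt_le_trans a0 ac; have {}d0 := lt_le_trans b0 bd.
have /andP[l0 l1] := l01; have l1' : 0 <= 1 - lam by rewrite subr_ge0.
case: e => [r| |]; last 2 first.
- by rewrite !power_mean_pinfty// ge_max !le_max ac bd orbT.
- by rewrite !power_mean_ninfty// le_min !ge_min ac bd orbT.
have [->|r0] := eqVneq r 0.
  rewrite !power_mean0//; apply: ler_pM; rewrite ?powR_ge0//;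
  by rewrite ge0_ler_powR// nnegrE ltW.
have pos x y : 0 < x -> 0 < y -> 0 < (1 - lam) * x `^ r + lam * y `^ r.
  by move=> x0 y0; rewrite conv_gt0 ?powR_gt0.
have posab := pos a b a0 b0; have poscd := pos c d c0 d0.
rewrite (power_mean_fin _ r0 a0 b0) (power_mean_fin _ r0 c0 d0).
have [r_lt0|r_gt0|r_eq0] := ltgtP r 0; last by rewrite r_eq0 eqxx in r0.
- apply: powR_neg_le => //; first by rewrite invr_le0 ltW.
  by rewrite lerD// ler_wpM2l// powR_neg_le// ltW.
- have r_ge0 := ltW r_gt0.
  apply: ge0_ler_powR; rewrite ?invr_ge0//; [exact/ltW..|].
  apply: lerD; apply: ler_wpM2l => //.
    by apply: ge0_ler_powR => //; exact/ltW.
  by apply: ge0_ler_powR => //; exact/ltW.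
Qed.

Lemma power_meanxx e lam a : 0 <= a -> power_mean e a a lam = a.
Proof.
rewrite le_eqVlt => /predU1P[<-|a0]; first by rewrite power_mean_eq0 ?mulr0.
case: e => [r| |]; last 2 first.
- by rewrite power_mean_pinfty// maxxx.
- by rewrite power_mean_ninfty// minxx.
have [->|r0] := eqVneq r 0.
  rewrite power_mean0// -powRD ?subrK ?powRr1 ?ltW//.
  by rewrite (gt_eqF a0) implybT.
by rewrite power_mean_fin// -mulrDl subrK mul1r powRVK// ltW.
Qed.

Lemma power_mean_lam0 r a b : 0 < a -> 0 < b -> power_mean r%:E a b 0 = a.
Proof.
move=> a0 b0; have [->|r0] := eqVneq r 0.
  by rewrite power_mean0// subr0 powRr1 ?powRr0 ?mulr1// ltW.
by rewrite power_mean_fin// subr0 mul1r mul0r addr0 powRVK// ltW.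
Qed.

Lemma power_mean_lam1 r a b : 0 < a -> 0 < b -> power_mean r%:E a b 1 = b.
Proof.
move=> a0 b0; have [->|r0] := eqVneq r 0.
  by rewrite power_mean0// subrr powRr1 ?powRr0 ?mul1r// ltW.
by rewrite power_mean_fin// subrr mul0r mul1r add0r powRVK// ltW.
Qed.

Lemma weighted_amgm lam a b : 0 <= lam <= 1 -> 0 < a -> 0 < b ->
  a `^ (1 - lam) * b `^ lam <= (1 - lam) * a + lam * b.
Proof.
move=> /andP[l0 l1] a0 b0.
(* Young's inequality is used with exponents 1 / (1 - lam) and 1 / lam, which requires 0 < lam <
   1. *)
have [->|lN0] := eqVneq lam 0.
  by rewrite subr0 powRr1 ?(ltW a0)// powRr0 mulr1 mul1r mul0r addr0.
have [->|lN1] := eqVneq lam 1.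
  by rewrite subrr powRr1 ?(ltW b0)// powRr0 mul0r !mul1r add0r.
have lp : 0 < lam by rewrite lt0r lN0.
have lq : 0 < 1 - lam by rewrite subr_gt0 lt_neqAle lN1.
have := @conjugate_powR _ (a `^ (1 - lam)) (b `^ lam) (1 - lam)^-1 lam^-1
  (powR_ge0 _ _) (powR_ge0 _ _).
rewrite !invr_gt0 => /(_ lq lp); rewrite !invrK subrK => /(_ erefl).
have lpN := lt0r_neq0 lp; have lqN := lt0r_neq0 lq.
by rewrite !powRVK ?(ltW a0) ?(ltW b0)// (mulrC a) (mulrC b).
Qed.

End power_means.

(** * Hölder's inequality for power means *)

Section holder_means.
Context {R : realType}.
Implicit Types (a b c d s r p q lam : R) (e : \bar R).

(** Young's inequality for the factorisation a^p = c^(-p) (a c)^p, with conjugate exponents q / (-p)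
    and q / (p + q). The bound is linear in c^q and (a c)^l, so it can be averaged over two pairs
    (a, c) and (b, d). *)
Lemma young_ell p q a c : p < 0 -> 0 < p + q -> 0 < a -> 0 < c ->
  a `^ p <= (- p / q) * c `^ q
    + (1 + p / q) * (a * c) `^ (p * q / (p + q)).
Proof.
move=> p0 pq a0 c0.
have q0 : 0 < q by lra.
have p0' : p != 0 by rewrite lt_eqF.
have pq' : p + q != 0 by rewrite gt_eqF.
have q0' : q != 0 by rewrite gt_eqF.
have ac0 : 0 < a * c by rewrite mulr_gt0.
have := @conjugate_powR _ (c `^ (- p)) ((a * c) `^ p) (q / - p) (q / (p + q))
  (powR_ge0 _ _) (powR_ge0 _ _).
have -> : (q / - p)^-1 + (q / (p + q))^-1 = 1 by field; rewrite ?oppr_eq0 ?p0' ?q0' ?pq'.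
rewrite !divr_gt0 ?oppr_gt0// => /(_ isT isT erefl).
have -> : c `^ (- p) * (a * c) `^ p = a `^ p.
  rewrite powRM ?ltW// mulrCA -powRD ?addNr ?powRr0 ?mulr1//.
  by rewrite (gt_eqF c0) implybT.
rewrite -!powRrM.
have -> : - p * (q / - p) = q by field; rewrite ?oppr_eq0.
have -> : p * (q / (p + q)) = p * q / (p + q) by rewrite mulrA.
move=> /le_trans; apply; rewrite le_eqVlt; apply/orP; left; apply/eqP.
by congr (_ + _); field; rewrite ?oppr_eq0 ?p0' ?q0' ?pq'.
Qed.

(** For p < 0 < p + q with q finite, [young_ell] is averaged after a normalisation. In the boundary
    cases p + q = 0, p = 0 and q = +oo the Young exponents degenerate, and a direct comparison
    replaces it. *)
Lemma power_mean_holder lam p e a b c d : 0 <= lam <= 1 ->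
  p <= 0 -> (0 <= e)%E -> (0 <= p%:E + e)%E ->
  0 <= a -> 0 <= b -> 0 <= c -> 0 <= d ->
  power_mean (ell p e) (a * c) (b * d) lam <=
  power_mean p%:E a b lam * power_mean e c d lam.
Proof.
move=> l01 p0 e0 pe.
have rhs0 x y z t : 0 <= x -> 0 <= y -> 0 <= z -> 0 <= t ->
    0 <= power_mean p%:E x y lam * power_mean e z t lam.
  by move=> *; rewrite mulr_ge0 ?power_mean_ge0.
rewrite le_eqVlt => /predU1P[<-|a0] b0 c0 d0.
  by rewrite mul0r power_mean_eq0 ?mul0r// rhs0.
move: b0 c0 d0; rewrite le_eqVlt => /predU1P[<-|b0] c0 d0.
  by rewrite mul0r power_mean_eq0 ?mulr0// rhs0// ltW.
move: c0 d0; rewrite le_eqVlt => /predU1P[<-|c0] d0.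
  by rewrite mulr0 power_mean_eq0 ?mul0r// rhs0// ltW.
move: d0; rewrite le_eqVlt => /predU1P[<-|d0].
  by rewrite mulr0 power_mean_eq0 ?mulr0// rhs0// ltW.
have ac0 : 0 < a * c by rewrite mulr_gt0.
have bd0 : 0 < b * d by rewrite mulr_gt0.
have a0' := ltW a0; have b0' := ltW b0; have c0' := ltW c0; have d0' := ltW d0.
move: {rhs0} e0 pe; case: e => [q| |]; last by rewrite leeNy_eq.
  rewrite !lee_fin => q0 pq0.
  have mean0M : power_mean 0%:E (a * c) (b * d) lam =
      power_mean 0%:E a b lam * power_mean 0%:E c d lam.
    by rewrite !power_mean0// !powRM// mulrACA.
  rewrite /ell; have [pqE|pqN0] := eqVneq (p + q) 0.
    have [pE|p0'] := eqVneq p 0.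
      have -> : q = 0 by move: pqE; rewrite pE add0r.
      by rewrite eqxx pE mean0M.
    have qE : q = - p by apply/eqP; rewrite -addr_eq0 addrC pqE.
    have p_lt0 : p < 0 by rewrite lt_neqAle p0'.
    rewrite /= qE power_mean_ninfty//; set m := Num.min _ _.
    have m0 : 0 < m by rewrite lt_min ac0.
    (* The p-mean of the reciprocals is the reciprocal of the (-p)-mean, so inserting both changes
       nothing. It then remains to compare the p-means, using m / c <= a and m / d <= b. *)
    have -> : m = m * power_mean p%:E c^-1 d^-1 lam * power_mean (- p)%:E c d lam.
      suff E : power_mean p%:E c^-1 d^-1 lam * power_mean (- p)%:E c d lam = 1.
        by rewrite -mulrA E mulr1.
      have cd0 : 0 < (1 - lam) * c `^ (- p) + lam * d `^ (- p).
        by rewrite conv_gt0 ?powR_gt0.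
      have inv x : 0 < x -> x^-1 `^ p = x `^ (- p).
        by move=> x0; rewrite -(powR_inv1 (ltW x0)) -powRrM mulN1r.
      have ci0 : 0 < c^-1 by rewrite invr_gt0.
      have di0 : 0 < d^-1 by rewrite invr_gt0.
      have Np0 : - p != 0 by rewrite oppr_eq0.
      rewrite (power_mean_fin _ p0' ci0 di0) (power_mean_fin _ Np0 c0 d0).
      rewrite (inv _ c0) (inv _ d0).
      rewrite -powRD ?invrN ?subrr ?powRr0//.
      by rewrite (gt_eqF cd0) implybT.
    have ci0 : 0 <= c^-1 by rewrite invr_ge0.
    have di0 : 0 <= d^-1 by rewrite invr_ge0.
    apply: ler_wpM2r; first exact: power_mean_ge0.
    rewrite -(power_meanZ _ l01 (ltW m0) ci0 di0).
    apply: le_power_mean => //; first exact/mulr_ge0/ci0/ltW.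
      exact/mulr_ge0/di0/ltW.
      by rewrite ler_pdivrMr// ge_min lexx.
    by rewrite ler_pdivrMr// ge_min lexx orbT.
  rewrite /=; have pq : 0 < p + q by rewrite lt0r pqN0.
  have [pE|p0'] := eqVneq p 0.
    have q_gt0 : 0 < q by rewrite pE add0r in pq.
    (* The geometric mean is multiplicative, so its factor in a, b cancels; what is left is the
       weighted arithmetic-geometric inequality for c^q and d^q. *)
    rewrite pE !mul0r mean0M; apply: ler_wpM2l; first exact: power_mean_ge0.
    rewrite power_mean0// power_mean_fin ?gt_eqF//.
    rewrite -[leLHS](@powRVK _ q) ?gt_eqF ?mulr_ge0 ?powR_ge0//.
    rewrite ge0_ler_powR ?nnegrE ?invr_ge0// ?powR_ge0//.
      by apply/ltW/conv_gt0; rewrite ?powR_gt0.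
    rewrite powRM ?powR_ge0// !(powRAC _ _ q).
    by rewrite weighted_amgm ?powR_gt0.
  have p_lt0 : p < 0 by rewrite lt_neqAle p0'.
  have q_gt0 : 0 < q by rewrite (lt_le_trans pq)// gerDr.
  set l := p * q / (p + q).
  have l_lt0 : l < 0 by rewrite pmulr_llt0 ?invr_gt0// nmulr_rlt0.
  have := power_mean_gt0 q%:E l01 c0 d0.
  move UE : (power_mean q%:E c d lam) => U U0.
  have := power_mean_gt0 l%:E l01 ac0 bd0.
  move VE : (power_mean l%:E (a * c) (b * d) lam) => V V0.
  (* By homogeneity the q-mean of c', d' and the l-mean of a' c', b' d' both become 1. As p < 0, the
     claim then reads (1 - lam) a'^p + lam b'^p <= 1, and the weights [X] and [Y] of [young_ell] add
     up to 1. *)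
  suff key : 1 <= power_mean p%:E (U / V * a) (U / V * b) lam.
    have UV0 : 0 <= U / V := divr_ge0 (ltW U0) (ltW V0).
    rewrite (power_meanZ _ l01 UV0 a0' b0') in key.
    have := ler_wpM2l (ltW V0) key; rewrite mulr1 mulrA (mulrCA V).
    by rewrite (divff (lt0r_neq0 V0)) mulr1 mulrC.
  set a' := U / V * a; set b' := U / V * b.
  have a'0 : 0 < a' by rewrite mulr_gt0 ?divr_gt0.
  have b'0 : 0 < b' by rewrite mulr_gt0 ?divr_gt0.
  set c' := U^-1 * c; set d' := U^-1 * d.
  have c'0 : 0 < c' by rewrite mulr_gt0 ?invr_gt0.
  have d'0 : 0 < d' by rewrite mulr_gt0 ?invr_gt0.
  have conv1 r x y : r != 0 -> 0 < x -> 0 < y -> power_mean r%:E x y lam = 1 ->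
      (1 - lam) * x `^ r + lam * y `^ r = 1.
    move=> r0 x0 y0 /(congr1 (fun z => z `^ r)).
    rewrite (power_mean_fin _ r0 x0 y0) (powRKV r0) ?powR1//.
    exact/ltW/conv_gt0/powR_gt0/y0/powR_gt0/x0.
  have Eq : (1 - lam) * c' `^ q + lam * d' `^ q = 1.
    apply: conv1 => //; first by rewrite gt_eqF.
    have Ui0 : 0 <= U^-1 by rewrite invr_ge0 ltW.
    rewrite (power_meanZ _ l01 Ui0 c0' d0').
    by rewrite UE mulVf// gt_eqF.
  have El : (1 - lam) * (a' * c') `^ l + lam * (b' * d') `^ l = 1.
    apply: conv1; [by rewrite lt_eqF|exact: mulr_gt0|exact: mulr_gt0|].
    have sc x y : U / V * x * (U^-1 * y) = V^-1 * (x * y).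
      by field; rewrite !gt_eqF.
    have Vi0 : 0 <= V^-1 by rewrite invr_ge0 ltW.
    rewrite /a' /b' /c' /d' !sc (power_meanZ _ l01 Vi0 (ltW ac0) (ltW bd0)).
    by rewrite VE mulVf// gt_eqF.
  rewrite (power_mean_fin _ p0' a'0 b'0).
  have le1_powR x : 0 < x -> x <= 1 -> 1 <= x `^ p^-1.
    move=> x0 x1; have <- : 1 `^ p^-1 = 1 :> R by rewrite powR1.
    by apply: powR_neg_le; rewrite // invr_le0.
  apply: le1_powR; first exact/conv_gt0/powR_gt0/b'0/powR_gt0/a'0.
  have /andP[l0 l1] := l01; have l1' : 0 <= 1 - lam by rewrite subr_ge0.
  have := lerD (ler_wpM2l l1' (young_ell p_lt0 pq a'0 c'0))
    (ler_wpM2l l0 (young_ell p_lt0 pq b'0 d'0)).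
  move=> /le_trans; apply; rewrite -/l.
  set X := - p / q; set Y := 1 + p / q.
  have XY : X + Y = 1 by rewrite /X /Y; field; rewrite gt_eqF.
  rewrite [leLHS](_ : _ = X * ((1 - lam) * c' `^ q + lam * d' `^ q) +
    Y * ((1 - lam) * (a' * c') `^ l + lam * (b' * d') `^ l)); last by ring.
  by rewrite Eq El !mulr1 XY.
move=> _ _ /=; set M := power_mean +oo%E c d lam.
have cM : c <= M by rewrite /M power_mean_pinfty// le_max lexx.
have dM : d <= M by rewrite /M power_mean_pinfty// le_max lexx orbT.
rewrite [leRHS]mulrC -(power_meanZ _ l01 (le_trans c0' cM) a0' b0').
apply: le_power_mean; rewrite ?(ltW ac0) ?(ltW bd0)//;
by rewrite mulrC ler_wpM2r.
Qed.

End holder_means.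

(** * The Borell-Brascamp-Lieb inequality on the line *)

Section brunn_minkowski_line.
Context {R : realType}.
Notation mu := (@lebesgue_measure R).
Implicit Types (A B C K : set R) (a b lam : R).

(** The scaled pushforward agrees with Lebesgue measure on half-open intervals, which determine
    it. *)
Lemma lebesgue_measure_affine_preimage a b A : 0 < a -> measurable A ->
  mu A = (a%:E * mu ((fun x => a * x + b)%R @^-1` A))%E.
Proof.
move=> a0 mA; pose f (x : measurableTypeR R) : measurableTypeR R := a * x + b.
have mf : measurable_fun setT f.
  by apply: measurable_funD => //; exact: measurable_funM.
pose aN : {nonneg R} := NngNum (ltW a0).
pose fP := isMeasurableFun.Build _ _ _ _ f mf.
pose F : {mfun measurableTypeR R >-> measurableTypeR R} := HB.pack f fP.
rewrite [LHS](@lebesgue_measure_unique _ (mscale aN (pushforward mu F)))//.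
move=> X /ocitvP[->|[[x y] /= xy ->]]; first by rewrite !measure0.
have E : f @^-1` `]x, y]%classic = `](x - b) / a, (y - b) / a]%classic.
  apply/seteqP; split=> t /=; rewrite !in_itv/= /f.
    by move=> /andP[h1 h2]; rewrite ltr_pdivrMr// ler_pdivlMr// mulrC; lra.
  by rewrite ltr_pdivrMr// ler_pdivlMr// (mulrC t); lra.
change (mu `]x, y]%classic = (a%:E * mu (f @^-1` `]x, y]%classic))%E).
rewrite E !lebesgue_measure_itv /= !lte_fin xy.
rewrite ltr_pM2r ?invr_gt0// ltrD2r xy -!EFinB -EFinM; congr EFin.
by field; rewrite gt_eqF.
Qed.

Lemma compact_affine_image a b K : compact K ->
  compact ((fun x => a * x + b) @` K).
Proof.
move=> cK; apply: continuous_compact => //; apply: continuous_subspaceT => x.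
by apply: cvgD; [apply: cvgMr|exact: cvg_cst].
Qed.

Lemma compact_measurable K : compact K -> measurable K.
Proof. by move=> cK; apply: closed_measurable; apply: compact_closed cK; exact: Rhausdorff. Qed.

Lemma lebesgue_measure_affine_image a b K : 0 < a -> compact K ->
  mu ((fun x => a * x + b) @` K) = (a%:E * mu K)%E.
Proof.
move=> a0 cK; rewrite (@lebesgue_measure_affine_preimage a b)//; last first.
  by apply: compact_measurable; exact: compact_affine_image.
congr (_ * mu _)%E; apply/seteqP; split=> x /=; last by exists x.
by move=> [y Ky] /addIr /(mulfI (lt0r_neq0 a0)) <-.
Qed.

(** The copies (1 - lam) A + lam min B and lam B + (1 - lam) max A both lie in C and meet only in
    the point [p], so their measures add. C is any measurable set containing the combination,
    because a combination of Borel sets need not be Borel. *)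
Lemma brunn_minkowski_compact lam A B C : 0 < lam < 1 ->
  compact A -> compact B -> A !=set0 -> B !=set0 -> measurable C ->
  (forall x y, A x -> B y -> C ((1 - lam) * x + lam * y)) ->
  ((1 - lam)%:E * mu A + lam%:E * mu B <= mu C)%E.
Proof.
move=> /andP[l0 l1] cA cB A0 B0 mC ABC; have l1' : 0 < 1 - lam by lra.
have id_cont K : {within K, continuous (fun x : R => x)}.
  by apply: continuous_subspaceT => x; exact: cvg_id.
have [m /[!inE] Am mMax] := compact_EVT_max A0 cA (id_cont A).
have [k /[!inE] Bk kMin] := compact_EVT_min B0 cB (id_cont B).
pose S := (fun x => (1 - lam) * x + lam * k) @` A.
pose T := (fun y => lam * y + (1 - lam) * m) @` B.
pose p := (1 - lam) * m + lam * k.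
have mS : measurable S by apply: compact_measurable; exact: compact_affine_image.
have mT : measurable T by apply: compact_measurable; exact: compact_affine_image.
have mp : measurable [set p] by [].
rewrite -(lebesgue_measure_affine_image (lam * k) l1' cA) -/S.
rewrite -(lebesgue_measure_affine_image ((1 - lam) * m) l0 cB) -/T.
have -> : mu S = mu (S `\ p).
  apply/eqP; rewrite eq_le; apply/andP; split; last first.
    by apply: le_measure; rewrite ?inE//; exact: measurableD.
  rewrite -[leRHS]adde0 -(lebesgue_measure_set1 p) -measureU//.
  - apply: le_measure; rewrite ?inE//.
      by apply: measurableU => //; exact: measurableD.
    by move=> x Sx; have [->|/eqP xp] := eqVneq x p; [right|left].
  - exact: measurableD.
  - by apply/seteqP; split=> x //= -[[_ /[swap] ->]].
rewrite -measureU//; last 2 first.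
- exact: measurableD.
- apply/seteqP; split=> x //= -[[[y Ay <-] yp] [z Bz zE]]; apply: yp => /=.
  have := mMax _ (mem_set Ay); have := kMin _ (mem_set Bz) => kz ym.
  by rewrite /p; nra.
apply: le_measure; rewrite ?inE//.
  by apply: measurableU => //; exact: measurableD.
move=> x [[[y Ay <-] _]|[y By <-]]; first exact: ABC.
by rewrite addrC; exact: ABC.
Qed.

Lemma brunn_minkowski lam A B C : 0 < lam < 1 ->
  measurable A -> measurable B -> A !=set0 -> B !=set0 -> measurable C ->
  (mu A < +oo)%E -> (mu B < +oo)%E ->
  (forall x y, A x -> B y -> C ((1 - lam) * x + lam * y)) ->
  ((1 - lam)%:E * mu A + lam%:E * mu B <= mu C)%E.
Proof.
move=> l01 mA mB [a Aa] [b Bb] mC Aoo Boo ABC; have /andP[l0 l1] := l01.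
have approx e D d : 0 < e -> measurable D -> D d -> (mu D < +oo)%E ->
    exists2 K, [/\ compact K, K `<=` D & K !=set0] & (mu D <= mu K + e%:E)%E.
  (* The point d keeps the compact approximation nonempty even when D is a null set. *)
  move=> e0 mD Dd Doo; have [V [cV VD Ve]] := lebesgue_regularity_inner mD Doo e0.
  exists (V `|` [set d]); first split.
  - by apply: compactU => //; exact: compact_set1.
  - by move=> x [/VD//|->].
  - by exists d; right.
  - have mV := compact_measurable cV.
    apply: (@le_trans _ _ (mu V + mu (D `\` V))%E).
      rewrite -measureU//; last 2 first.
      + exact: measurableD.
      + by apply/seteqP; split=> x //= -[Vx []].
      by rewrite setDUK// ?inE.
    apply: leeD; last exact: ltW.
    apply: le_measure; rewrite ?inE; [done|exact: measurableU|by move=> x; left].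
apply/lee_addgt0Pr => e e0.
have [K [cK KA K0] AK] := approx e A a e0 mA Aa Aoo.
have [L [cL LB L0] BL] := approx e B b e0 mB Bb Boo.
have := brunn_minkowski_compact l01 cK cL K0 L0 mC
  (fun x y Kx Ly => ABC x y (KA _ Kx) (LB _ Ly)).
move=> h; apply: le_trans (leeD2r e%:E h).
apply: (@le_trans _ _ ((1 - lam)%:E * (mu K + e%:E) + lam%:E * (mu L + e%:E))%E).
  by apply: leeD; apply: lee_wpmul2l => //; rewrite lee_fin; lra.
have e0' : (0 <= e%:E)%E by rewrite lee_fin ltW.
rewrite !ge0_muleDr// -!EFinM addeACA -EFinD -mulrDl subrK mul1r.
exact: lexx.
Qed.

End brunn_minkowski_line.

Section bbl_line.
Context {R : realType}.
Notation mu := (@lebesgue_measure R).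
Implicit Types (m : R -> R -> R) (f g h : R -> R) (lam r C : R).

Lemma measurable_superlevel g s : measurable_fun setT (g : measurableTypeR R -> R) ->
  measurable [set x | s <= g x].
Proof.
move=> mg; rewrite [X in measurable X](_ : _ = setT `&` g @^-1` `[s, +oo[%classic).
  exact: mg.
by apply/seteqP; split=> x /=; rewrite in_itv/= andbT; [split|case].
Qed.

(** Tonelli for the part of the subgraph of g below height 1. Only levels in (0, 1) are kept
    because, once suprema are normalised to 1, these are the levels at which superlevel sets are
    known to be nonempty. *)
Lemma layer_cake g : measurable_fun setT (g : measurableTypeR R -> R) ->
  (forall x, 0 <= g x) ->
  measurable_fun setT (fun s : measurableTypeR R =>
     mu [set x | (0 < s < 1)%R /\ (s <= g x)%R]) /\
  (\int[mu]_s mu [set x | (0 < s < 1)%R /\ (s <= g x)%R] =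
   \int[mu]_x (Num.min (g x) 1)%:E)%E.
Proof.
move=> mg g0; pose T := (measurableTypeR R * measurableTypeR R)%type.
pose E : set T := [set p | 0 < p.2 < 1 /\ p.2 <= g p.1].
have mE : measurable E.
  have m2 : measurable_fun setT (snd : T -> measurableTypeR R) by exact: measurable_snd.
  have m1 : measurable_fun setT (g \o fst : T -> measurableTypeR R).
    by apply: measurableT_comp => //; exact: measurable_fst.
  rewrite [E](_ : _ = (setT `&` snd @^-1` `]0, 1[%classic) `&`
     (setT `&` (fun p : T => g p.1 - p.2) @^-1` `[0, +oo[%classic)).
    apply: measurableI; first exact: m2.
    by apply: (measurable_funB m1 m2).
  apply/seteqP; split => p /=; rewrite !in_itv /= andbT subr_ge0.
    by move=> [p01 pg]; split; split.
  by move=> [[_ p01] [_ pg]]; split.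
pose F (p : T) : \bar R := (\1_E p)%:E.
have mF : measurable_fun setT F by apply/measurable_EFinP; exact: measurable_indic.
have F0 p : (0 <= F p)%E by rewrite lee_fin.
have secE s : (\int[mu]_x F (x, s) = mu [set x | (0 < s < 1)%R /\ (s <= g x)%R])%E.
  rewrite /F (_ : (fun x => _) =
    (fun x => (\1_[set x | 0 < s < 1 /\ s <= g x] x)%:E)).
    rewrite integral_indic ?setIT//.
    have [s01|s01] := boolP (0 < s < 1).
      rewrite [X in measurable X](_ : _ = [set x | s <= g x]).
        exact: measurable_superlevel.
      by apply/seteqP; split => x //= -[].
    rewrite [X in measurable X](_ : _ = set0)//.
    by apply/seteqP; split => x //= -[].
  by [].
have secG x : (\int[mu]_s F (x, s) = (Num.min (g x) 1)%:E)%E.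
  rewrite /F (_ : (fun s => _) =
      (fun s => (\1_(if g x < 1 then `]0, g x]%classic else `]0, 1[%classic : set R) s)%:E)).
    rewrite integral_indic ?setIT//; last by case: ifP.
    have [gx1|gx1] := ltP (g x) 1.
      rewrite [LHS]lebesgue_measure_itv/= lte_fin; case: ifPn => [_|].
        by rewrite -EFinB subr0.
      by rewrite -leNgt => gx0; congr EFin; apply/le_anti; rewrite g0.
    by rewrite [LHS]lebesgue_measure_itv/= lte_fin ltr01 -EFinB subr0.
  apply/funext => s; rewrite !indicE; congr (_%:R%:E).
  congr nat_of_bool; apply/asbool_equiv_eq.
  rewrite /E /=; case: ifPn => gx1 /=; rewrite in_itv/=; split.
  - by move=> [/andP[-> _] ->].
  - by move=> /andP[s0 sg]; rewrite s0 sg (le_lt_trans sg).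
  - by move=> [].
  - move=> /andP[s0 s1]; rewrite s0 s1; split => //.
    by rewrite (le_trans (ltW s1))// leNgt.
split.
  by under eq_fun do rewrite -secE; exact: measurable_fun_fubini_tonelli_G.
under eq_integral do rewrite -secE.
by rewrite -(fubini_tonelli F mF F0); apply: eq_integral => x _; rewrite secG.
Qed.

(* How the mean changes when one coordinate is integrated out. *)
Definition mean_step m m' lam := forall a b c d,
  0 <= a -> 0 <= b -> 0 <= c -> 0 <= d ->
  m' (a * c) (b * d) <= m a b * ((1 - lam) * c + lam * d).

(** All that the integration argument uses of a power mean; keeping it abstract lets the exponent
    vary with the dimension and take the value -oo. *)
Definition homogeneous_mean m :=
  [/\ forall s a b, 0 <= s -> 0 <= a -> 0 <= b -> m (s * a) (s * b) = s * m a b,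
      forall a b c d, 0 <= a -> 0 <= b -> a <= c -> b <= d -> m a b <= m c d,
      forall a b, a * b = 0 -> m a b = 0 &
      forall a b, 0 < a -> 0 < b -> 0 < m a b].

(** By homogeneity and monotonicity of m, points where f0 / a0 >= s and f1 / a1 >= s combine to a
    point where h / m(a0, a1) >= s. Since a0 and a1 are suprema, both superlevel sets are nonempty
    for s < 1, as Brunn-Minkowski demands; integrating over s gives the claim. *)
Lemma bbl_line_aux m lam f0 f1 h r a0 a1 : 0 < lam < 1 ->
  homogeneous_mean m ->
  measurable_fun setT (f0 : measurableTypeR R -> R) ->
  measurable_fun setT (f1 : measurableTypeR R -> R) ->
  measurable_fun setT (h : measurableTypeR R -> R) ->
  (forall x, 0 <= f0 x <= a0) -> (forall x, 0 <= f1 x <= a1) ->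
  (forall x, 0 <= h x) ->
  (forall x, r < `|x| -> f0 x = 0) -> (forall x, r < `|x| -> f1 x = 0) ->
  (forall x y, m (f0 x) (f1 y) <= h ((1 - lam) * x + lam * y)) ->
  0 < a0 -> 0 < a1 ->
  (forall s, s < a0 -> exists x, s < f0 x) ->
  (forall s, s < a1 -> exists x, s < f1 x) ->
  ((m a0 a1)%:E * ((1 - lam)%:E * \int[mu]_x (f0 x / a0)%:E
     + lam%:E * \int[mu]_x (f1 x / a1)%:E) <= \int[mu]_x (h x)%:E)%E.
Proof.
move=> /andP[l0 l1] [mZ mle m0 mgt0] mf0 mf1 mh f0b f1b h0 f0r f1r mh_le a0p a1p
  a0sup a1sup.
set M := m a0 a1; have M0 : 0 < M by exact: mgt0.
pose g0 x := f0 x / a0; pose g1 x := f1 x / a1; pose k x := h x / M.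
have mdiv g c : measurable_fun setT (g : measurableTypeR R -> R) ->
    measurable_fun setT (fun x : measurableTypeR R => g x / c).
  by move=> mg; apply: measurable_funM => //.
have mg0 : measurable_fun setT (g0 : measurableTypeR R -> R) by exact: mdiv.
have mg1 : measurable_fun setT (g1 : measurableTypeR R -> R) by exact: mdiv.
have mk : measurable_fun setT (k : measurableTypeR R -> R) by exact: mdiv.
have g0b x : 0 <= g0 x <= 1.
  by have /andP[? ?] := f0b x; rewrite divr_ge0 ?(ltW a0p)//= ler_pdivrMr// mul1r.
have g1b x : 0 <= g1 x <= 1.
  by have /andP[? ?] := f1b x; rewrite divr_ge0 ?(ltW a1p)//= ler_pdivrMr// mul1r.
have k0 x : 0 <= k x by rewrite divr_ge0// ltW.
have [mS0 I0] := layer_cake mg0 (fun x => (andP (g0b x)).1).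
have [mS1 I1] := layer_cake mg1 (fun x => (andP (g1b x)).1).
have [mSk Ik] := layer_cake mk k0.
have min1 g : (forall x, 0 <= g x <= 1) ->
    (\int[mu]_x (Num.min (g x) 1)%:E = \int[mu]_x (g x)%:E)%E.
  move=> gb; apply: eq_integral => x _; congr EFin.
  by apply/min_idPl; have /andP[] := gb x.
rewrite (min1 _ g0b) in I0; rewrite (min1 _ g1b) in I1.
have kint : (\int[mu]_x (h x)%:E = M%:E * \int[mu]_x (k x)%:E)%E.
  rewrite -ge0_integralZl_EFin//; first last.
  - exact: ltW.
  - exact/measurable_EFinP.
  - by move=> x _; rewrite lee_fin.
  apply: eq_integral => x _; rewrite -EFinM; congr EFin.
  by rewrite /k mulrCA divff ?mulr1// gt_eqF.
rewrite kint; apply: lee_wpmul2l; first by rewrite lee_fin ltW.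
(* [k] may exceed 1, but only levels below 1 are compared, so it is truncated first. *)
apply: (@le_trans _ _ (\int[mu]_x (Num.min (k x) 1)%:E)%E); last first.
  apply: ge0_le_integral => //.
  - by move=> x _; rewrite lee_fin le_min k0 ler01.
  - by apply/measurable_EFinP; apply: measurable_minr.
  - exact/measurable_EFinP.
  - by move=> x _; rewrite lee_fin ge_min lexx.
change ((1 - lam)%:E * \int[mu]_x (g0 x)%:E + lam%:E * \int[mu]_x (g1 x)%:E
  <= \int[mu]_x (Num.min (k x) 1)%:E)%E.
rewrite -I0 -I1 -Ik.
have l0' : 0 <= lam by exact: ltW.
have l1' : 0 <= 1 - lam by lra.
rewrite -!ge0_integralZl_EFin//.
rewrite -ge0_integralD//; first last.
- by apply: measurable_funeM.
- by move=> s _; apply: mule_ge0; rewrite ?lee_fin.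
- by apply: measurable_funeM.
- by move=> s _; apply: mule_ge0; rewrite ?lee_fin.
have bounded g s : (forall x, r < `|x| -> g x = 0) -> 0 < s ->
    (mu [set x | (s <= g x)%R] < +oo)%E.
  move=> gr s0; apply: (@le_lt_trans _ _ (mu `[- r, r]%classic)); last first.
    by rewrite lebesgue_measure_itv/=; case: ifP => // _; rewrite -EFinD ltry.
  apply: le_outer_measure => x /= sx; rewrite in_itv/= -ler_norml leNgt.
  by apply/negP => /gr gx0; move: sx; rewrite gx0 leNgt s0.
apply: ge0_le_integral => //.
- by move=> s _; apply: adde_ge0; apply: mule_ge0; rewrite ?lee_fin.
- by apply: emeasurable_funD; apply: measurable_funeM.
move=> s _; have [s01|s01] := boolP (0 < s < 1); last first.
  have nil g : [set x : R | (false : bool) /\ s <= g x] = set0.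
    by apply/seteqP; split=> x //= -[].
  by rewrite !nil !measure0 !mule0 adde0.
have all g : [set x : R | (true : bool) /\ s <= g x] = [set x | s <= g x].
  by apply/seteqP; split=> x //= -[].
rewrite !all; have /andP[s0 s1] := s01.
apply: brunn_minkowski => //.
- by rewrite l0.
- exact: measurable_superlevel.
- exact: measurable_superlevel.
- have [|x sx] := a0sup (s * a0); first by rewrite gtr_pMl.
  by exists x; rewrite /= /g0 ler_pdivlMr// ltW.
- have [|x sx] := a1sup (s * a1); first by rewrite gtr_pMl.
  by exists x; rewrite /= /g1 ler_pdivlMr// ltW.
- exact: measurable_superlevel.
- by apply: bounded => // x /f0r; rewrite /g0 => ->; rewrite mul0r.
- by apply: bounded => // x /f1r; rewrite /g1 => ->; rewrite mul0r.
move=> x y /=; rewrite /g0 /g1 /k !ler_pdivlMr// => sx sy.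
apply: le_trans (mh_le x y); rewrite /M -(mZ _ _ _ (ltW s0) (ltW a0p) (ltW a1p)).
by apply: mle => //; rewrite mulr_ge0 ?ltW.
Qed.

End bbl_line.

Section bbl_line_bump.
Context {R : realType}.
Notation mu := (@lebesgue_measure R).
Implicit Types (m : R -> R -> R) (f g h : R -> R) (lam r C : R).

Lemma integral_line_le f r C : measurable_fun setT (f : measurableTypeR R -> R) ->
  0 < r -> (forall x, 0 <= f x <= C) -> (forall x, r < `|x| -> f x = 0) ->
  (\int[mu]_x (f x)%:E <= (C * (2 * r))%:E)%E.
Proof.
move=> mf r0 fC fr; have C0 : 0 <= C by have /andP[h] := fC 0; exact: le_trans.
have mI : measurable (`[- r, r]%classic : set (measurableTypeR R)) by [].
have -> : (C * (2 * r))%:E = (C%:E * mu `[(- r)%R, r]%classic)%E.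
  rewrite lebesgue_measure_itv/= lte_fin gtrN// -EFinD -EFinM opprK.
  by congr EFin; ring.
have -> : mu `[(- r)%R, r]%classic = (\int[mu]_x (\1_`[- r, r] x)%:E)%E.
  by rewrite integral_indic// setIT.
rewrite -ge0_integralZl_EFin//; last by apply/measurable_EFinP; exact: measurable_indic.
apply: ge0_le_integral => //.
- by move=> x _; rewrite lee_fin; case/andP: (fC x).
- exact/measurable_EFinP.
- by apply: measurable_funeM; apply/measurable_EFinP; exact: measurable_indic.
move=> x _; rewrite -EFinM lee_fin indicE.
have [xr|xr] := ltP r `|x|; first by rewrite fr// mulr_ge0.
by rewrite mem_set ?mulr1/= ?in_itv/= -?ler_norml//; case/andP: (fC x).
Qed.

(** [mean_step] is applied to the suprema a0, a1 and to the integrals of f0 / a0 and f1 / a1, whose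
    products are the integrals of f0 and f1. If f0 or f1 vanishes identically there is no positive
    supremum, but then m' is 0. *)
Lemma bbl_line m m' lam f0 f1 h r0 C0 r1 C1 r2 C2 : 0 < lam < 1 ->
  homogeneous_mean m -> homogeneous_mean m' -> mean_step m m' lam ->
  measurable_fun setT (f0 : measurableTypeR R -> R) ->
  measurable_fun setT (f1 : measurableTypeR R -> R) ->
  measurable_fun setT (h : measurableTypeR R -> R) ->
  (forall x, 0 <= f0 x <= C0) -> (forall x, 0 <= f1 x <= C1) ->
  (forall x, 0 <= h x <= C2) ->
  (forall x, r0 < `|x| -> f0 x = 0) -> (forall x, r1 < `|x| -> f1 x = 0) ->
  (forall x, r2 < `|x| -> h x = 0) -> 0 < r0 -> 0 < r1 -> 0 < r2 ->
  (forall x y, m (f0 x) (f1 y) <= h ((1 - lam) * x + lam * y)) ->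
  m' (fine (\int[mu]_x (f0 x)%:E)) (fine (\int[mu]_x (f1 x)%:E)) <=
  fine (\int[mu]_x (h x)%:E).
Proof.
move=> l01 hm hm' step mf0 mf1 mh f0C f1C hC f0r f1r hr r0p r1p r2p mh_le.
have ge0 g C : (forall x, 0 <= g x <= C) -> (0 <= \int[mu]_x (g x)%:E)%E.
  by move=> gC; apply: integral_ge0 => x _; rewrite lee_fin; case/andP: (gC x).
have fin g r C : measurable_fun setT (g : measurableTypeR R -> R) -> 0 < r ->
    (forall x, 0 <= g x <= C) -> (forall x, r < `|x| -> g x = 0) ->
    (\int[mu]_x (g x)%:E)%E \is a fin_num.
  move=> mg rp gC gr; rewrite ge0_fin_numE ?(ge0 _ _ gC)//.
  exact: le_lt_trans (integral_line_le mg rp gC gr) (ltry _).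
have [_ _ m'0 _] := hm'.
have zero g C : (forall x, 0 <= g x <= C) -> ~ (exists x, 0 < g x) ->
    fine (\int[mu]_x (g x)%:E)%E = 0.
  move=> gC gn; rewrite integral0_eq// => x _; congr EFin; apply/eqP.
  rewrite eq_le (andP (gC x)).1 andbT leNgt; apply/negP => gx; apply: gn.
  by exists x.
have supP g C : (forall x, 0 <= g x <= C) -> (exists x, 0 < g x) ->
    exists a, [/\ 0 < a, forall x, 0 <= g x <= a &
      forall s, s < a -> exists x, s < g x].
  move=> gC [x gx]; have hs : has_sup (range g).
    by split; [exists (g x), x|exists C => _ [y _ <-]; case/andP: (gC y)].
  have ub y : g y <= sup (range g) by apply: (sup_upper_bound hs); exists y.
  exists (sup (range g)); split.
  - exact: lt_le_trans gx (ub x).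
  - by move=> y; rewrite ub andbT; case/andP: (gC y).
  move=> s sa; have [|_ [y _ <-] ys] := @sup_adherent _ _ (sup (range g) - s) _ hs.
    by rewrite subr_gt0.
  by exists y; rewrite (le_lt_trans _ ys)//; lra.
have hge : 0 <= fine (\int[mu]_x (h x)%:E)%E by apply: fine_ge0; exact: ge0 hC.
have [|/(zero _ _ f0C) ->] := pselect (exists x, 0 < f0 x); last first.
  by rewrite m'0 ?mul0r.
move=> /(supP _ _ f0C)[a0 [a0p f0a a0s]].
have [|/(zero _ _ f1C) ->] := pselect (exists x, 0 < f1 x); last first.
  by rewrite m'0 ?mulr0.
move=> /(supP _ _ f1C)[a1 [a1p f1a a1s]].
have h0 x : 0 <= h x by case/andP: (hC x).
have := @bbl_line_aux _ m lam f0 f1 h (Num.max r0 r1) a0 a1 l01 hm mf0 mf1 mh f0a f1a h0.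
have f0r' x : Num.max r0 r1 < `|x| -> f0 x = 0.
  by rewrite gt_max => /andP[+ _]; exact: f0r.
have f1r' x : Num.max r0 r1 < `|x| -> f1 x = 0.
  by rewrite gt_max => /andP[_]; exact: f1r.
move=> /(_ f0r' f1r' mh_le a0p a1p a0s a1s).
have scale g a r C : measurable_fun setT (g : measurableTypeR R -> R) -> 0 < a ->
    0 < r -> (forall x, 0 <= g x <= C) -> (forall x, r < `|x| -> g x = 0) ->
    (\int[mu]_x (g x / a)%:E = (fine (\int[mu]_x (g x)%:E) / a)%:E)%E.
  move=> mg ap rp gC gr; rewrite mulrC EFinM fineK ?(fin _ _ _ mg rp gC gr)//.
  rewrite -ge0_integralZl_EFin//; first last.
  - by rewrite invr_ge0 ltW.
  - exact/measurable_EFinP.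
  - by move=> x _; rewrite lee_fin; case/andP: (gC x).
  by apply: eq_integral => x _; rewrite mulrC.
rewrite (scale _ _ _ _ mf0 a0p r0p f0C f0r) (scale _ _ _ _ mf1 a1p r1p f1C f1r).
rewrite -[X in (_ <= X)%E -> _](fineK (fin _ _ _ mh r2p hC hr)).
have EE a b c d e : (a%:E * (b%:E * c%:E + d%:E * e%:E) =
    (a * (b * c + d * e))%:E :> \bar R)%E by [].
rewrite EE lee_fin.
apply: le_trans; have F0 := fine_ge0 (ge0 _ _ f0C); have F1 := fine_ge0 (ge0 _ _ f1C).
have := step a0 a1 _ _ (ltW a0p) (ltW a1p) (divr_ge0 F0 (ltW a0p))
  (divr_ge0 F1 (ltW a1p)).
by rewrite !(mulrC _ (_ / _)) !divfK ?gt_eqF.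
Qed.

End bbl_line_bump.

(** * Borel functions on R^n *)

Section bbl_borel.
Context {R : realType}.
Notation leb := (@lebesgue_measure R).
Notation mu := (@borel_lebesgue R).

Lemma join_rV0 n (x : 'rV[R]_n) t : join_rV (x, t) ord0 ord0 = t.
Proof.
have -> : ord0 = lshift n (ord0 : 'I_1) by exact/val_inj.
by rewrite (row_mxEl (t%:M : 'M[R]_1) x) mxE mulr1n.
Qed.

Lemma join_rVS n (x : 'rV[R]_n) t (i : 'I_n) :
  join_rV (x, t) ord0 (rshift 1 i) = x ord0 i.
Proof. by rewrite (row_mxEr (t%:M : 'M[R]_1) x). Qed.


Definition box n (Y : 'I_n -> set R) : set 'rV[R]_n :=
  [set x | forall i, Y i (x ord0 i)].

Lemma measurable_box n (Y : 'I_n -> set R) : (forall i, measurable (Y i)) ->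
  measurable (box Y : set (borel_rV R n)).
Proof.
move=> mY; rewrite [X in measurable X](_ : _ =
    \bigcap_(i in [set: 'I_n]) ([set x | Y i (x ord0 i)] : set (borel_rV R n))).
  apply: fin_bigcap_measurable; first exact: finite_finset.
  by move=> i _; apply: sub_sigma_algebra; exists i, (Y i).
by apply/seteqP; split => x /= Yx i; [move=> _; exact: Yx|exact: Yx].
Qed.

Lemma borel_lebesgue_box n (Y : 'I_n -> set R) : (forall i, measurable (Y i)) ->
  mu n (box Y) = (\big[*%E/1%E]_(i < n) leb (Y i))%E.
Proof.
elim: n Y => [|n IHn] Y mY.
  rewrite big_ord0 /= diracE mem_set//; by case.
have mY' i : measurable (Y (lift ord0 i)) by [].
rewrite big_ord_recl muleC -(IHn _ mY').
rewrite -(product_measure1E (mu n) leb (measurable_box mY') (mY ord0)).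
change (mu n.+1 (box Y)) with ((mu n \x leb)%E (@join_rV R n @^-1` (box Y))).
congr (_ _); apply/seteqP; split => -[x t] /=.
  move=> Yx; split => [i /=|/=]; last by rewrite -(join_rV0 x t); exact: Yx.
  by rewrite -(join_rVS x t i) (_ : rshift 1 i = lift ord0 i)//; exact/val_inj.
move=> [/= Yx Yt] i; case: (split_ordP (i : 'I_(1 + n))) => [j ->|j ->].
  by rewrite (ord1 j) (_ : lshift n 0 = ord0) ?join_rV0//; exact/val_inj.
rewrite join_rVS (_ : rshift 1 j = lift ord0 j) //; exact/val_inj.
Qed.

Lemma borel_lebesgue_box_lty n (Y : 'I_n -> set R) : (forall i, measurable (Y i)) ->
  (forall i, leb (Y i) < +oo)%E -> (mu n (box Y) < +oo)%E.
Proof.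
move=> mY Yoo; rewrite borel_lebesgue_box//.
elim: n Y {mY} Yoo => [|n IHn] Y Yoo; first by rewrite big_ord0 ltry.
rewrite big_ord_recl; apply: lte_mul_pinfty => //.
  by rewrite ge0_fin_numE.
exact: (IHn (fun i => Y (lift ord0 i))).
Qed.

Definition cube n r := box (fun _ : 'I_n => `[- r, r]%classic).

Lemma measurable_cube n r : measurable (cube r : set (borel_rV R n)).
Proof. exact: measurable_box. Qed.

Lemma cube_lty n r : (mu n (cube r) < +oo)%E.
Proof.
apply: borel_lebesgue_box_lty => // i.
by rewrite lebesgue_measure_itv/=; case: ifP => // _; rewrite -EFinD ltry.
Qed.

Lemma borel_lebesgue_sigma_finite n : sigma_finite setT (mu n).
Proof.
exists (fun k => cube k%:R); last first.
  by move=> k; split; [exact: measurable_cube|exact: cube_lty].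
apply/seteqP; split => // x _.
pose N := (\sum_(i < n) Num.bound `|x ord0 i|)%N.
exists N => // i /=; rewrite in_itv/= -ler_norml.
apply: (@le_trans _ _ (Num.bound `|x ord0 i|)%:R); first by rewrite ltW// archi_boundP.
by rewrite ler_nat /N (bigD1 i)//= leq_addr.
Qed.

(** An alias whose head constant can carry the sigma-finite structure that Tonelli asks for;
    [borel_lebesgue] is a fixpoint with values in bundled measures. *)
Definition sigma_finite_borel_lebesgue (n : nat) : set (borel_rV R n) -> \bar R := mu n.

HB.instance Definition _ n := Measure.on (@sigma_finite_borel_lebesgue n).

HB.instance Definition _ n := @Measure_isSigmaFinite.Build _ _ _
  (@sigma_finite_borel_lebesgue n) (@borel_lebesgue_sigma_finite n).

Lemma integral_add_coordinate n (f : borel_rV R n.+1 -> \bar R) :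
  measurable_fun setT f -> (forall x, 0 <= f x)%E ->
  (\int[mu n.+1]_w f w =
   \int[mu n]_x \int[leb]_t f (join_rV (x, t)))%E.
Proof.
move=> mf f0.
have -> : (\int[mu n.+1]_w f w =
    \int[pushforward (mu n \x leb)%E (@join_rV R n : borel_rV R n * measurableTypeR R
      -> borel_rV R n.+1)]_w f w)%E by [].
rewrite ge0_integral_pushforward//; last exact: measurable_join_rV.
rewrite preimage_setT.
have mfj : measurable_fun setT (f \o (@join_rV R n) :
    borel_rV R n * measurableTypeR R -> \bar R).
  by apply: measurableT_comp => //; exact: measurable_join_rV.
exact: (@fubini_tonelli1 _ _ _ _ _ (@sigma_finite_borel_lebesgue n) leb _ mfj
  (fun z => f0 (join_rV z))).
Qed.

(** A class that is stable under integrating out a coordinate and has finite integrals, so that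
    integrals can be handled as reals through [fine]. *)
Definition bump n (f : 'rV[R]_n -> R) := exists r C : R, [/\ 0 < r,
  measurable_fun setT (f : borel_rV R n -> R),
  forall x, 0 <= f x <= C &
  forall (x : 'rV[R]_n) i, r < `|x ord0 i| -> f x = 0].

Lemma join_rV_conv n (x y : 'rV[R]_n) s t a b :
  join_rV (a *: x + b *: y, a * s + b * t) =
  a *: join_rV (x, s) + b *: join_rV (y, t).
Proof.
have E k (A B : 'rV[R]_k) i : (a *: A + b *: B) ord0 i = a * A ord0 i + b * B ord0 i.
  by rewrite !mxE.
apply/rowP => i; rewrite E; case: (split_ordP (i : 'I_(1 + n))) => [j ->|j ->].
  have -> : lshift n j = ord0 by rewrite (ord1 j); exact/val_inj.
  by rewrite !join_rV0.
by rewrite !join_rVS E.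
Qed.

Section marginal.
Context n (f : 'rV[R]_n.+1 -> R) (r C : R) (r0 : 0 < r)
  (mf : measurable_fun setT (f : borel_rV R n.+1 -> R))
  (fC : forall x, 0 <= f x <= C)
  (fr : forall (x : 'rV[R]_n.+1) i, r < `|x ord0 i| -> f x = 0).

Lemma measurable_section (x : 'rV[R]_n) :
  measurable_fun setT (fun t : measurableTypeR R => f (join_rV (x, t))).
Proof.
have mj := measurableT_comp mf (@measurable_join_rV R n).
exact: (measurableT_comp mj (measurable_pair1 (x : borel_rV R n))).
Qed.

Lemma section_bound (x : 'rV[R]_n) t : 0 <= f (join_rV (x, t)) <= C.
Proof. exact: fC. Qed.

Lemma section_support (x : 'rV[R]_n) t : r < `|t| -> f (join_rV (x, t)) = 0.
Proof. by rewrite -{1}(join_rV0 x t); exact: fr. Qed.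

Let int_ge0 (x : 'rV[R]_n) : (0 <= \int[leb]_t (f (join_rV (x, t)))%:E)%E.
Proof. by apply: integral_ge0 => t _; rewrite lee_fin; case/andP: (fC (join_rV (x, t))). Qed.

Let int_le (x : 'rV[R]_n) :
  (\int[leb]_t (f (join_rV (x, t)))%:E <= (C * (2 * r))%:E)%E.
Proof.
exact: (integral_line_le (measurable_section x) r0 (section_bound x)
  (section_support x)).
Qed.

Lemma section_fin_num (x : 'rV[R]_n) :
  (\int[leb]_t (f (join_rV (x, t)))%:E)%E \is a fin_num.
Proof. by rewrite ge0_fin_numE// (le_lt_trans (int_le x))// ltry. Qed.

Definition marginal (x : 'rV[R]_n) := fine (\int[leb]_t (f (join_rV (x, t)))%:E).

Lemma marginalE (x : 'rV[R]_n) :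
  (marginal x)%:E = (\int[leb]_t (f (join_rV (x, t)))%:E)%E.
Proof. by rewrite /marginal fineK// section_fin_num. Qed.

Lemma marginal_bump : bump marginal.
Proof.
exists r, (C * (2 * r)); split => //.
- apply/measurable_EFinP; rewrite [X in measurable_fun _ X](_ : _ =
    fun x : borel_rV R n => (\int[leb]_t (f (join_rV (x, t)))%:E)%E).
    pose F (z : borel_rV R n * measurableTypeR R) := (f (join_rV z))%:E.
    apply: (@measurable_fun_fubini_tonelli_F _ _ _ _ _ _ F).
      apply/measurable_EFinP.
      exact: (measurableT_comp mf (@measurable_join_rV R n)).
    by move=> z; rewrite lee_fin; case/andP: (fC (join_rV z)).
  by apply/funext => x; rewrite -marginalE.
- by move=> x; rewrite -!lee_fin marginalE int_ge0 int_le.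
- move=> x i xi; rewrite /marginal integral0_eq// => t _.
  by rewrite (fr (i := rshift 1 i))// join_rVS.
Qed.

Lemma integral_marginal :
  (\int[mu n.+1]_w (f w)%:E = \int[mu n]_x (marginal x)%:E)%E.
Proof.
rewrite integral_add_coordinate//; first last.
- by move=> x; rewrite lee_fin; case/andP: (fC x).
- exact/measurable_EFinP.
by apply: eq_integral => x _; rewrite marginalE.
Qed.

End marginal.

Lemma bump_fin_num n (f : 'rV[R]_n -> R) : bump f ->
  (\int[mu n]_x (f x)%:E)%E \is a fin_num.
Proof.
elim: n f => [|n IHn] f [r [C [r0 mf fC fr]]].
  rewrite (_ : (\int[mu 0]_x (f x)%:E)%E = (f 0)%:E)//.
  rewrite /borel_lebesgue integral_dirac//; last exact/measurable_EFinP.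
  by rewrite diracT mul1e.
rewrite (integral_marginal r0 mf fC fr); apply: IHn.
exact: (marginal_bump r0 mf fC fr).
Qed.

(** For fixed x and y the line inequality on the fibres over them turns the hypothesis for [m 0]
    into the same hypothesis for [m 1] between the marginals; the induction continues with the
    shifted sequence [m k.+1]. *)
Lemma bbl_borel n (m : nat -> R -> R -> R) lam (f0 f1 h : 'rV[R]_n -> R) :
  0 < lam < 1 ->
  (forall k, (k <= n)%N -> homogeneous_mean (m k)) ->
  (forall k, (k < n)%N -> mean_step (m k) (m k.+1) lam) ->
  bump f0 -> bump f1 -> bump h ->
  (forall x y, m 0%N (f0 x) (f1 y) <= h ((1 - lam) *: x + lam *: y)) ->
  m n (fine (\int[mu n]_x (f0 x)%:E)) (fine (\int[mu n]_x (f1 x)%:E)) <=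
  fine (\int[mu n]_x (h x)%:E).
Proof.
move=> l01; elim: n m f0 f1 h => [|n IHn] m f0 f1 h hm step.
  have E (f : 'rV[R]_0 -> R) : bump f -> (\int[mu 0]_x (f x)%:E)%E = (f 0)%:E.
    move=> [r [C [_ mf _ _]]].
    rewrite /borel_lebesgue integral_dirac//; last exact/measurable_EFinP.
    by rewrite diracT mul1e.
  move=> b0 b1 bh /(_ 0 0); rewrite !E//= => /le_trans; apply.
  by rewrite (_ : (1 - lam) *: _ + _ = 0 :> 'rV[R]_0)//; apply/rowP => -[].
move=> [r0 [C0 [r0p mf0 f0C f0r]]] [r1 [C1 [r1p mf1 f1C f1r]]].
move=> [r2 [C2 [r2p mh hC hr]]] mh_le.
rewrite (integral_marginal r0p mf0 f0C f0r) (integral_marginal r1p mf1 f1C f1r).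
rewrite (integral_marginal r2p mh hC hr).
apply: (IHn (fun k => m k.+1)).
- by move=> k kn; apply: hm.
- by move=> k kn; apply: step.
- exact: (marginal_bump r0p mf0 f0C f0r).
- exact: (marginal_bump r1p mf1 f1C f1r).
- exact: (marginal_bump r2p mh hC hr).
move=> x y; apply: (@bbl_line _ (m 0%N) (m 1%N) lam _ _ _ r0 C0 r1 C1 r2 C2 l01).
- exact: hm.
- exact: hm.
- exact: step.
- exact: measurable_section.
- exact: measurable_section.
- exact: measurable_section.
- by move=> t; exact: f0C.
- by move=> t; exact: f1C.
- by move=> t; exact: hC.
- by move=> t; exact: (section_support f0r).
- by move=> t; exact: (section_support f1r).
- by move=> t; exact: (section_support hr).
- by [].
- by [].
- by [].
by move=> s t; rewrite join_rV_conv; exact: mh_le.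
Qed.

End bbl_borel.

(** * Lebesgue measurable functions on R^n *)

Section completion.
Context {R : realType}.
Notation mu := (@borel_lebesgue R).
Notation nu := (@lebesgue_measure_rV R).

Lemma borel_lebesgue_measurable n (A : set 'rV[R]_n) :
  measurable (A : set (borel_rV R n)) -> measurable (A : set (lebesgue_rV R n)).
Proof. exact: caratheodory_measurable_mu_ext. Qed.

Lemma lebesgue_measure_rVE n (A : set 'rV[R]_n) :
  measurable (A : set (borel_rV R n)) -> nu n A = mu n A.
Proof. by move=> mA; rewrite -[RHS]measurable_mu_extE. Qed.

Lemma borel_measurable_fun n (f : 'rV[R]_n -> R) :
  measurable_fun setT (f : borel_rV R n -> R) ->
  measurable_fun setT (f : lebesgue_rV R n -> R).
Proof.
move=> mf _ Y mY; apply: borel_lebesgue_measurable; exact: mf.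
Qed.

(** The identity from the completed space to the Borel space is measurable and pushes [nu] forward
    to [mu]. *)
Lemma integral_lebesgue_borel n (f : 'rV[R]_n -> R) :
  measurable_fun setT (f : borel_rV R n -> R) -> (forall x, 0 <= f x) ->
  (\int[nu n]_x (f x)%:E = \int[mu n]_x (f x)%:E)%E.
Proof.
move=> mf f0; pose i (x : lebesgue_rV R n) : borel_rV R n := x.
have mi : measurable_fun setT i.
  by move=> _ Y mY; rewrite setTI; exact: borel_lebesgue_measurable.
have mEf : measurable_fun setT (EFin \o f : borel_rV R n -> \bar R).
  exact/measurable_EFinP.
have := @ge0_integral_pushforward _ _ _ _ _ i mi (nu n) setT (EFin \o f)
  measurableT mEf.
rewrite preimage_setT => <-; last by move=> x _; rewrite /= lee_fin.
apply: eq_measure_integral => A mA _; rewrite -lebesgue_measure_rVE//.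
Qed.

Lemma lebesgue_cubeE n r : nu n (cube r) = mu n (cube r).
Proof. by rewrite lebesgue_measure_rVE//; exact: measurable_cube. Qed.

(** The value of [nu] is an infimum over countable Borel covers, and the union of a good cover is
    the Borel set sought. *)
Lemma borel_cover n (E : set 'rV[R]_n) (e : R) : 0 < e -> (nu n E < +oo)%E ->
  exists2 B : set 'rV[R]_n, measurable (B : set (borel_rV R n)) /\ E `<=` B &
    (nu n B <= nu n E + e%:E)%E.
Proof.
move=> e0 Eoo; have Efin : nu n E \is a fin_num by rewrite ge0_fin_numE.
have [_ [F [mF EF] <-] Fe] := lb_ereal_inf_adherent e0 Efin.
have mB : measurable (\bigcup_k F k : set (borel_rV R n)) by exact: bigcupT_measurable.
exists (\bigcup_k F k); first by split.
rewrite lebesgue_measure_rVE//; apply/ltW; apply: le_lt_trans Fe.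
exact: measure_sigma_subadditive.
Qed.

(** Dual to [borel_cover]: remove from the cube a Borel cover of the part of the cube outside E. The
    cube has finite measure, so the error carries over by subtraction. *)
Lemma borel_core n (E : set 'rV[R]_n) (r e : R) : 0 < e ->
  measurable (E : set (lebesgue_rV R n)) -> E `<=` cube r ->
  exists2 A : set 'rV[R]_n, measurable (A : set (borel_rV R n)) /\ A `<=` E &
    (nu n E <= nu n A + e%:E)%E.
Proof.
move=> e0 mE Er.
have mQ : measurable (cube r : set (borel_rV R n)) by exact: measurable_cube.
have mQ' := borel_lebesgue_measurable mQ.
have Qoo : (nu n (cube r) < +oo)%E by rewrite lebesgue_cubeE; exact: cube_lty.
have mD : measurable (cube r `\` E : set (lebesgue_rV R n)) by exact: measurableD.
have sub_fin (X : set (lebesgue_rV R n)) : measurable X -> X `<=` cube r ->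
    nu n X \is a fin_num.
  move=> mX Xr; rewrite ge0_fin_numE//; apply: le_lt_trans Qoo.
  by apply: le_measure; rewrite ?inE.
have Dfin : nu n (cube r `\` E) \is a fin_num by apply: sub_fin => // x [].
have Doo : (nu n (cube r `\` E) < +oo)%E by rewrite -ge0_fin_numE.
have [B [mB EB] Be] := borel_cover e0 Doo.
have mA : measurable (cube r `\` B : set (borel_rV R n)) by exact: measurableD.
have mA' := borel_lebesgue_measurable mA.
have mB' := borel_lebesgue_measurable mB.
exists (cube r `\` B).
  by split => // x [Qx Bx]; apply: contrapT => Ex; apply: Bx; exact: EB.
have Afin : nu n (cube r `\` B) \is a fin_num by apply: sub_fin => // x [].
have QE : nu n (cube r) = (nu n E + nu n (cube r `\` E))%E.
  by rewrite -measureU ?setDUK ?setIDK//; exact: setDIK.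
have QB : (nu n (cube r) <= nu n (cube r `\` B) + nu n B)%E.
  apply: (@le_trans _ _ (nu n ((cube r `\` B) `|` B))).
    apply: le_measure; rewrite ?inE//; first exact: measurableU.
    by move=> x Qx; have [Bx|nBx] := pselect (B x); [right|left].
  exact: measureU2.
rewrite -(leeD2rE _ _ Dfin) -QE (le_trans QB)// -addeA leeD2l//.
by rewrite addeC.
Qed.

Definition lbump n (f : 'rV[R]_n -> R) := exists r C : R, [/\ 0 < r,
  measurable_fun setT (f : lebesgue_rV R n -> R),
  forall x, 0 <= f x <= C &
  forall (x : 'rV[R]_n) i, r < `|x ord0 i| -> f x = 0].

End completion.

Section bbl_lebesgue.
Context {R : realType}.
Notation mu := (@borel_lebesgue R).
Notation nu := (@lebesgue_measure_rV R).

(** The sum rounds y down to a multiple of d, capped at N d. The induction also needs that the cap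
    is attained once N d <= y. *)
Lemma staircase (N : nat) (d y : R) : 0 <= d -> 0 <= y ->
  \sum_(k < N) d * ((k.+1%:R * d <= y)%R : nat)%:R <= y /\
  (y <= N%:R * d ->
   y <= \sum_(k < N) d * ((k.+1%:R * d <= y)%R : nat)%:R + d).
Proof.
move=> d0 y0; suff [h1 h2 h3] : [/\
    \sum_(k < N) d * ((k.+1%:R * d <= y)%R : nat)%:R <= y,
    (y <= N%:R * d ->
      y <= \sum_(k < N) d * ((k.+1%:R * d <= y)%R : nat)%:R + d) &
    (N%:R * d <= y ->
      \sum_(k < N) d * ((k.+1%:R * d <= y)%R : nat)%:R = N%:R * d)] by [].
elim: N => [|N [IH1 IH2 IH3]].
  by rewrite !big_ord0 !mul0r add0r; split => // /le_trans; apply.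
rewrite !big_ord_recr /=; have NS : N.+1%:R * d = N%:R * d + d.
  by rewrite -natr1 mulrDl mul1r.
have [Ny|Ny] := leP (N.+1%:R * d) y.
  rewrite mulr1 IH3; last by apply: le_trans Ny; rewrite NS lerDl.
  rewrite -NS; split => // yN; apply: le_trans yN _.
  by rewrite lerDl.
rewrite mulr0 addr0; split => //.
move=> _; have [yN|Ny'] := leP y (N%:R * d); first exact: IH2.
by rewrite (IH3 (ltW Ny')) -NS; exact: ltW.
Qed.

Lemma lbump_ge0 n (f : 'rV[R]_n -> R) x : lbump f -> 0 <= f x.
Proof. by move=> [r [C [_ _ fC _]]]; case/andP: (fC x). Qed.

Lemma lbump_mfun n (f : 'rV[R]_n -> R) : lbump f ->
  measurable_fun setT (f : lebesgue_rV R n -> R).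
Proof. by move=> [r [C []]]. Qed.

Lemma bump_lbump n (f : 'rV[R]_n -> R) : bump f -> lbump f.
Proof.
move=> [r [C [r0 mf fC fr]]]; exists r, C; split => //.
exact: borel_measurable_fun.
Qed.

Lemma support_cube n (f : 'rV[R]_n -> R) (r : R) x :
  (forall (x : 'rV[R]_n) i, r < `|x ord0 i| -> f x = 0) -> f x != 0 -> cube r x.
Proof.
move=> fr fx i /=; rewrite in_itv/= -ler_norml leNgt; apply/negP => /fr fx0.
by rewrite fx0 eqxx in fx.
Qed.

Lemma lebesgue_cube_lty n r : (nu n (cube r) < +oo)%E.
Proof. by rewrite lebesgue_cubeE; exact: cube_lty. Qed.

Lemma measurable_lebesgue_cube n r : measurable (cube r : set (lebesgue_rV R n)).
Proof. exact: borel_lebesgue_measurable (measurable_cube r). Qed.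

Lemma integral_scaled_indic n (A : set 'rV[R]_n) (c : R) : 0 <= c ->
  measurable (A : set (lebesgue_rV R n)) ->
  (\int[nu n]_x (c * \1_A x)%:E = c%:E * nu n A)%E.
Proof.
move=> c0 mA.
have mI : measurable_fun setT (fun x : lebesgue_rV R n => (\1_A x)%:E : \bar R).
  by apply/measurable_EFinP; exact: measurable_indic.
have I0 x : (0 <= (\1_A x)%:E :> \bar R)%E by rewrite lee_fin.
have E := ge0_integralZl_EFin (nu n) measurableT (fun x _ => I0 x) mI c0.
transitivity (\int[nu n]_x (c%:E * (\1_A x)%:E))%E.
  by apply: eq_integral => x _; rewrite EFinM.
by rewrite E integral_indic// setIT.
Qed.

Lemma integral_cube_le n (f : 'rV[R]_n -> R) (r C : R) :
  measurable_fun setT (f : lebesgue_rV R n -> R) ->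
  (forall x, 0 <= f x <= C) ->
  (forall (x : 'rV[R]_n) i, r < `|x ord0 i| -> f x = 0) ->
  (\int[nu n]_x (f x)%:E <= C%:E * nu n (cube r))%E.
Proof.
move=> mf fC fr; have C0 : 0 <= C by have /andP[h] := fC 0; exact: le_trans.
have mQ := @measurable_lebesgue_cube n r.
have -> : nu n (cube r) = (\int[nu n]_x (\1_(cube r) x)%:E)%E.
  by rewrite integral_indic// setIT.
have mI : measurable_fun setT (fun x : lebesgue_rV R n => (\1_(cube r) x)%:E : \bar R).
  by apply/measurable_EFinP; exact: measurable_indic.
rewrite -ge0_integralZl_EFin//.
apply: ge0_le_integral; first exact: measurableT.
- by move=> x _; rewrite lee_fin; case/andP: (fC x).
- exact/measurable_EFinP.
- exact: measurable_funeM.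
move=> x _; rewrite -EFinM lee_fin indicE.
have [->|fx] := eqVneq (f x) 0; first by rewrite mulr_ge0.
by rewrite mem_set ?mulr1; [case/andP: (fC x)|exact: support_cube fx].
Qed.

Lemma lbump_fin_num n (f : 'rV[R]_n -> R) : lbump f ->
  (\int[nu n]_x (f x)%:E)%E \is a fin_num.
Proof.
move=> [r [C [r0 mf fC fr]]]; rewrite ge0_fin_numE; last first.
  by apply: integral_ge0 => x _; rewrite lee_fin; case/andP: (fC x).
apply: le_lt_trans (integral_cube_le mf fC fr) _.
apply: lte_mul_pinfty; rewrite ?lebesgue_cube_lty//.
by rewrite lee_fin; have /andP[h] := fC 0; exact: le_trans.
Qed.

(** The minorant is the staircase of f in which each superlevel set is replaced by a Borel core. *)
Lemma lbump_minorant n (f : 'rV[R]_n -> R) (e : R) : lbump f -> 0 < e ->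
  exists g : 'rV[R]_n -> R, [/\ bump g, forall x, g x <= f x &
   (\int[nu n]_x (f x)%:E <= \int[mu n]_x (g x)%:E + e%:E)%E].
Proof.
move=> [r [C [r0 mf fC fr]]] e0.
have C0 : 0 <= C by have /andP[h] := fC 0; exact: le_trans.
pose V := fine (nu n (cube r)).
have VE : nu n (cube r) = V%:E.
  by rewrite /V fineK// ge0_fin_numE// lebesgue_cube_lty.
have V0 : 0 <= V by rewrite -lee_fin -VE.
(* The step d costs d V for the discretisation and at most C d for the cores. *)
pose K := C * (V + C + 1) / e; pose N := (Num.bound K).+1.
pose d := C / N%:R.
have N0 : 0 < N%:R :> R by rewrite ltr0n.
have d0 : 0 <= d by rewrite divr_ge0// ltW.
have dN : N%:R * d = C by rewrite /d mulrC divfK// gt_eqF.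
have de : d * (V + C + 1) <= e.
  rewrite /d mulrAC ler_pdivrMr// [leRHS]mulrC -ler_pdivrMr// -/K.
  have K0 : 0 <= K by rewrite divr_ge0 ?(ltW e0)// mulr_ge0//; lra.
  by apply: ltW; apply: (lt_le_trans (archi_boundP K0)); rewrite ler_nat.
(* If d = 0 then C = 0 and f vanishes; the sets [E k] below would be the whole space and not lie in
   the cube. *)
have [d_eq0|dpos] : d = 0 \/ 0 < d.
  by move: d0; rewrite le_eqVlt => /predU1P[<-|]; [left|right].
  exists (fun=> 0); split.
  - by exists 1, 0; split => // x; rewrite lexx.
  - by move=> x; case/andP: (fC x).
  have C_eq0 : C = 0 by rewrite -dN d_eq0 mulr0.
  rewrite integral0_eq; last first.
    by move=> x _; congr EFin; apply/le_anti; rewrite -{1}C_eq0 andbC; exact: fC.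
  by rewrite integral0_eq// add0e lee_fin ltW.
pose E k : set 'rV[R]_n := [set x | k.+1%:R * d <= f x].
have mE k : measurable (E k : set (lebesgue_rV R n)).
  rewrite [X in measurable X](_ : _ = setT `&` f @^-1` `[k.+1%:R * d, +oo[%classic).
    exact: mf.
  by apply/seteqP; split=> x /=; rewrite in_itv/= andbT; [split|case].
have Ecube k : E k `<=` cube r.
  move=> x Ex; apply: (support_cube fr); rewrite gt_eqF//.
  by apply: lt_le_trans Ex; rewrite mulr_gt0// ltr0n.
have core k := borel_core dpos (mE k) (Ecube k).
pose A k := projT1 (cid2 (core k)).
have mA k : measurable (A k : set (borel_rV R n)).
  by rewrite /A; case: cid2 => B [].
have AE k : A k `<=` E k by rewrite /A; case: cid2 => B [].
have EA k : (nu n (E k) <= nu n (A k) + d%:E)%E by rewrite /A; case: cid2.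
pose g x := \sum_(k < N) d * \1_(A k) x.
pose s x := \sum_(k < N) d * \1_(E k) x.
have gs x : g x <= s x.
  apply: ler_sum => k _; rewrite ler_wpM2l// !indicE ler_nat.
  by case: (boolP (x \in A k)) => // /[!inE] /AE Ex; rewrite mem_set.
have sE x : s x = \sum_(k < N) d * ((k.+1%:R * d <= f x)%R : nat)%:R.
  apply: eq_bigr => k _; rewrite indicE; congr (_ * (nat_of_bool _)%:R).
  by apply/idP/idP; rewrite inE.
have sf x : s x <= f x.
  by rewrite sE; apply: (staircase N d0 _).1; case/andP: (fC x).
have fs x : f x <= s x + d.
  by rewrite sE; apply: (staircase N d0 _).2; rewrite ?dN; case/andP: (fC x).
have g0 x : 0 <= g x by apply: sumr_ge0 => k _; rewrite mulr_ge0.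
have mg : measurable_fun setT (g : borel_rV R n -> R).
  by apply: measurable_sum => k; apply: measurable_funM.
have bg : bump g.
  exists r, C; split => //.
    by move=> x; rewrite g0 (le_trans (gs x))// (le_trans (sf x))//; case/andP: (fC x).
  move=> x i xi; apply/le_anti; rewrite g0 andbT.
  by rewrite (le_trans (gs x))// -(fr x i xi).
exists g; split => //; first by move=> x; exact: le_trans (sf x).
have sum_int (B : nat -> set 'rV[R]_n) :
    (forall k, measurable (B k : set (lebesgue_rV R n))) ->
    (\int[nu n]_x (\sum_(k < N) d * \1_(B k) x)%:E = \sum_(k < N) d%:E * nu n (B k))%E.
  move=> mB; have mI k : measurable_fun setT
      (fun x : lebesgue_rV R n => (d * \1_(B k) x)%:E : \bar R).
    by apply/measurable_EFinP; apply: measurable_funM; last exact: measurable_indic.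
  have I0 k (x : lebesgue_rV R n) : setT x -> (0 <= (d * \1_(B k) x)%:E :> \bar R)%E.
    by rewrite lee_fin mulr_ge0.
  under eq_integral do rewrite -sumEFin.
  have -> := ge0_integral_sum (nu n) measurableT (fun k : 'I_N => mI k)
    (fun k : 'I_N => I0 k) (index_enum 'I_N).
  by apply: eq_bigr => k _; rewrite integral_scaled_indic.
rewrite -(integral_lebesgue_borel mg g0) sum_int; last first.
  by move=> k; exact: borel_lebesgue_measurable.
have ms : measurable_fun setT (s : lebesgue_rV R n -> R).
  by apply: measurable_sum => k; apply: measurable_funM.
have mQ := @measurable_lebesgue_cube n r.
have mI : measurable_fun setT (fun x : lebesgue_rV R n => (d * \1_(cube r) x)%:E : \bar R).
  by apply/measurable_EFinP; apply: measurable_funM.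
have s0 x : 0 <= s x by exact: le_trans (gs x).
have ms' : measurable_fun setT (fun x : lebesgue_rV R n => (s x)%:E).
  exact/measurable_EFinP.
apply: (@le_trans _ _ (\int[nu n]_x ((s x)%:E + (d * \1_(cube r) x)%:E))%E).
  apply: ge0_le_integral; first exact: measurableT.
  - by move=> x _; rewrite lee_fin; case/andP: (fC x).
  - exact/measurable_EFinP.
  - exact: emeasurable_funD.
  move=> x _; rewrite -EFinD lee_fin indicE.
  have [->|fx] := eqVneq (f x) 0; first by rewrite addr_ge0// mulr_ge0.
  by rewrite mem_set ?mulr1; [exact: fs|exact: support_cube fx].
have I0 x : [set: lebesgue_rV R n] x -> (0 <= (d * \1_(cube r) x)%:E :> \bar R)%E.
  by rewrite lee_fin mulr_ge0.
have s0' x : [set: lebesgue_rV R n] x -> (0 <= (s x)%:E)%E by rewrite lee_fin.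
have := ge0_integralD (nu n) measurableT s0' ms' I0 mI.
rewrite (sum_int _ mE) => ->.
have -> : (\int[nu n]_x (d * \1_(cube r) x)%:E = (d * V)%:E)%E.
  by rewrite integral_scaled_indic// VE -EFinM.
apply: (@le_trans _ _ (\sum_(k < N) d%:E * (nu n (A k) + d%:E) + (d * V)%:E)%E).
  by apply: leeD2r; apply: lee_sum => k _; apply: lee_wpmul2l.
have -> : (\sum_(k < N) d%:E * (nu n (A k) + d%:E) =
   \sum_(k < N) d%:E * nu n (A k) + (C * d)%:E)%E.
  under eq_bigr do rewrite ge0_muleDr// -EFinM.
  rewrite big_split/=; congr (_ + _)%E.
  by rewrite sumEFin sumr_const card_ord -mulr_natl mulrA dN.
rewrite -addeA leeD2l// -EFinD lee_fin (le_trans _ de)//.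
by nra.
Qed.

End bbl_lebesgue.

Section bbl_lebesgue_bump.
Context {R : realType}.
Notation mu := (@borel_lebesgue R).
Notation nu := (@lebesgue_measure_rV R).

Definition mass n (f : 'rV[R]_n -> R) := fine (\int[nu n]_x (f x)%:E)%E.

Lemma massE n (f : 'rV[R]_n -> R) : lbump f ->
  (\int[nu n]_x (f x)%:E)%E = (mass f)%:E.
Proof. by move=> bf; rewrite /mass fineK// lbump_fin_num. Qed.

Lemma mass_bump n (f : 'rV[R]_n -> R) : bump f ->
  fine (\int[mu n]_x (f x)%:E)%E = mass f.
Proof.
move=> [r [C [_ mf fC _]]]; rewrite /mass integral_lebesgue_borel// => x.
by case/andP: (fC x).
Qed.

Lemma mass_ge0 n (f : 'rV[R]_n -> R) : lbump f -> 0 <= mass f.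
Proof.
move=> bf; apply: fine_ge0; apply: integral_ge0 => x _.
by rewrite lee_fin lbump_ge0.
Qed.

Lemma le_mass n (f g : 'rV[R]_n -> R) : lbump f -> lbump g ->
  (forall x, f x <= g x) -> mass f <= mass g.
Proof.
move=> bf bg fg; rewrite -lee_fin -!massE//.
apply: ge0_le_integral; first exact: measurableT.
- by move=> x _; rewrite lee_fin lbump_ge0.
- by apply/measurable_EFinP; exact: lbump_mfun.
- by apply/measurable_EFinP; exact: lbump_mfun.
- by move=> x _; rewrite lee_fin.
Qed.

Lemma lbumpD n (f g : 'rV[R]_n -> R) : lbump f -> lbump g ->
  lbump (fun x => f x + g x).
Proof.
move=> [r [C [r0 mf fC fr]]] [s [D [s0 mg gD gs]]].
exists (Num.max r s), (C + D); split.
- by rewrite lt_max r0.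
- exact: measurable_funD.
- by move=> x; have /andP[? ?] := fC x; have /andP[? ?] := gD x;
    rewrite addr_ge0// lerD.
- by move=> x i; rewrite gt_max => /andP[/fr -> /gs ->]; rewrite addr0.
Qed.

Lemma massD n (f g : 'rV[R]_n -> R) : lbump f -> lbump g ->
  mass (fun x => f x + g x) = mass f + mass g.
Proof.
move=> bf bg; apply: EFin_inj; rewrite -massE; last exact: lbumpD.
rewrite EFinD -!massE//.
have f0 (x : lebesgue_rV R n) : setT x -> (0 <= (f x)%:E)%E.
  by rewrite lee_fin lbump_ge0.
have g0 (x : lebesgue_rV R n) : setT x -> (0 <= (g x)%:E)%E.
  by rewrite lee_fin lbump_ge0.
have mf : measurable_fun setT (fun x : lebesgue_rV R n => (f x)%:E).
  by apply/measurable_EFinP; exact: lbump_mfun.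
have mg : measurable_fun setT (fun x : lebesgue_rV R n => (g x)%:E).
  by apply/measurable_EFinP; exact: lbump_mfun.
have <- := ge0_integralD (nu n) measurableT f0 mf g0 mg.
by apply: eq_integral => x _; rewrite EFinD.
Qed.

Lemma lbump_le n (f g : 'rV[R]_n -> R) :
  measurable_fun setT (f : lebesgue_rV R n -> R) -> lbump g ->
  (forall x, 0 <= f x <= g x) -> lbump f.
Proof.
move=> mf [r [C [r0 mg gC gr]]] fg; exists r, C; split => //.
  by move=> x; have /andP[-> /le_trans] := fg x; apply; case/andP: (gC x).
by move=> x i /gr g0; apply/le_anti; rewrite andbC -{2}g0.
Qed.

Lemma lbumpZ n (f : 'rV[R]_n -> R) (c : R) : 0 <= c -> lbump f ->
  lbump (fun x => c * f x).
Proof.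
move=> c0 [r [C [r0 mf fC fr]]]; exists r, (c * C); split; first exact: r0.
- exact: measurable_funM.
- by move=> x; have /andP[? ?] := fC x; rewrite mulr_ge0// ler_wpM2l.
- by move=> x i /fr ->; rewrite mulr0.
Qed.

Lemma massZ n (f : 'rV[R]_n -> R) (c : R) : 0 <= c -> lbump f ->
  mass (fun x => c * f x) = c * mass f.
Proof.
move=> c0 bf; apply: EFin_inj; rewrite -massE; last exact: lbumpZ.
rewrite EFinM -massE//.
have f0 (x : lebesgue_rV R n) : setT x -> (0 <= (f x)%:E)%E.
  by rewrite lee_fin lbump_ge0.
have mf : measurable_fun setT (fun x : lebesgue_rV R n => (f x)%:E).
  by apply/measurable_EFinP; exact: lbump_mfun.
have <- := ge0_integralZl_EFin (nu n) measurableT f0 mf c0.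
by apply: eq_integral => x _; rewrite EFinM.
Qed.

Lemma lbump_indic n (f : 'rV[R]_n -> R) (A : set 'rV[R]_n) : lbump f ->
  measurable (A : set (lebesgue_rV R n)) -> lbump (fun x => f x * \1_A x).
Proof.
move=> bf mA; apply: (lbump_le _ bf).
  by apply: measurable_funM; [exact: lbump_mfun|exact: measurable_indic].
move=> x; rewrite indicE; case: (_ \in _); rewrite ?mulr1 ?mulr0 lexx ?andbT;
exact: lbump_ge0.
Qed.

Lemma mass_minorant n (f : 'rV[R]_n -> R) (e : R) : lbump f -> 0 < e ->
  exists g : 'rV[R]_n -> R, [/\ bump g, forall x, g x <= f x &
   mass f <= mass g + e].
Proof.
move=> bf e0; have [g [bg gf fge]] := lbump_minorant bf e0.
exists g; split => //; move: fge; rewrite massE//.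
by rewrite -(fineK (bump_fin_num bg)) mass_bump// -EFinD lee_fin.
Qed.

(** Subtract a Borel minorant of c - h from c, where c is the Borel function equal to the bound of h
    on a cube that carries it. *)
Lemma mass_majorant n (h : 'rV[R]_n -> R) (e : R) : lbump h -> 0 < e ->
  exists g : 'rV[R]_n -> R, [/\ bump g, forall x, h x <= g x &
   mass g <= mass h + e].
Proof.
move=> bh e0; have [r [C [r0 mh hC hr]]] := bh.
have C0 : 0 <= C by have /andP[h0] := hC 0; exact: le_trans.
have mQ := @measurable_cube R n r; have mQ' := @measurable_lebesgue_cube R n r.
pose c (x : 'rV[R]_n) : R := C * \1_(cube r) x.
have cb x : 0 <= c x <= C.
  by rewrite /c indicE; case: (_ \in _); rewrite ?mulr1 ?mulr0 lexx C0.
have cr (x : 'rV[R]_n) i : r < `|x ord0 i| -> c x = 0.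
  move=> xi; rewrite /c indicE memNset ?mulr0// => /(_ i) /=.
  by rewrite in_itv/= -ler_norml leNgt xi.
have mc : measurable_fun setT (c : borel_rV R n -> R).
  by apply: measurable_funM; last exact: measurable_indic.
have bc : lbump c.
  exists r, C; split; [exact: r0|exact: borel_measurable_fun|exact: cb|exact: cr].
have hc x : h x <= c x.
  have [->|hx] := eqVneq (h x) 0; first by case/andP: (cb x).
  by rewrite /c indicE mem_set ?mulr1; [case/andP: (hC x)|exact: support_cube hx].
have bch : lbump (fun x => c x - h x).
  apply: (lbump_le _ bc); first by apply: measurable_funB; exact: lbump_mfun.
  by move=> x; rewrite subr_ge0 hc/= gerBl lbump_ge0.
have [k [bgk kle kint]] := mass_minorant bch e0.
have [rk [Ck [rk0 mk kC kr]]] := bgk.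
have k0 x : 0 <= k x by case/andP: (kC x).
have g0 x : 0 <= c x - k x.
  by rewrite subr_ge0 (le_trans (kle x))// gerBl lbump_ge0.
have bg : bump (fun x => c x - k x).
  exists r, C; split => //.
  - exact: measurable_funB.
  - move=> x; rewrite g0/= lerBlDr.
    by have /andP[_ /le_trans] := cb x; apply; rewrite lerDl.
  - move=> x i xi; apply/eqP; rewrite eq_le g0 andbT (cr _ _ xi) sub0r oppr_le0.
    exact: k0.
exists (fun x => c x - k x); split => //.
  by move=> x; rewrite lerBrDr -lerBrDl; exact: kle.
have Eh : mass c = mass h + mass (fun x => c x - h x).
  by rewrite -massD//; congr mass; apply/funext => x; rewrite addrC subrK.
have Ek : mass c = mass k + mass (fun x => c x - k x).
  rewrite -massD//; [|exact: bump_lbump..].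
  by congr mass; apply/funext => x; rewrite addrC subrK.
lra.
Qed.

(** Minorants of f0, f1 and a majorant of h keep the pointwise inequality, since [m 0] is monotone.
    For [m n] no continuity is available, only monotonicity and homogeneity; hence the additive
    errors are turned into a common factor 1 - t. *)
Lemma bbl_lebesgue n (m : nat -> R -> R -> R) lam (f0 f1 h : 'rV[R]_n -> R) :
  0 < lam < 1 ->
  (forall k, (k <= n)%N -> homogeneous_mean (m k)) ->
  (forall k, (k < n)%N -> mean_step (m k) (m k.+1) lam) ->
  lbump f0 -> lbump f1 -> lbump h ->
  (forall x y, m 0%N (f0 x) (f1 y) <= h ((1 - lam) *: x + lam *: y)) ->
  m n (mass f0) (mass f1) <= mass h.
Proof.
move=> l01 hm step b0 b1 bh mh.
have [mZ mle m0 mgt0] := hm _ (leqnn n).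
have [_ m0le _ _] := hm _ (leq0n n).
have F0 := mass_ge0 b0; have F1 := mass_ge0 b1; have H0 := mass_ge0 bh.
have [E|F0p] : mass f0 = 0 \/ 0 < mass f0.
  by move: F0; rewrite le_eqVlt => /predU1P[<-|]; [left|right].
  by rewrite E m0 ?mul0r.
have [E|F1p] : mass f1 = 0 \/ 0 < mass f1.
  by move: F1; rewrite le_eqVlt => /predU1P[<-|]; [left|right].
  by rewrite E m0 ?mulr0.
set M := m n _ _; have M0 : 0 < M by exact: mgt0.
apply/ler_addgt0Pr => e e0.
(* Lose a factor 1 - t, with t M + t c at most e. *)
pose c := Num.min (mass f0) (mass f1).
have c0 : 0 < c by rewrite lt_min F0p.
pose t := Num.min (2^-1) (e / (M + c)).
have Mc : 0 < M + c by rewrite addr_gt0.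
have t0 : 0 < t by rewrite lt_min invr_gt0 ltr0n divr_gt0.
have t1 : t < 1 by rewrite gt_min invf_lt1 ?ltr0n// ltr1n.
have te : t * (M + c) <= e by rewrite -ler_pdivlMr// ge_min lexx orbT.
have tc : 0 < t * c by rewrite mulr_gt0.
have [g0 [bg0 g0f g0e]] := mass_minorant b0 tc.
have [g1 [bg1 g1f g1e]] := mass_minorant b1 tc.
have [k [bk hk ke]] := mass_majorant bh tc.
have pos g x : bump g -> 0 <= g x by move=> /bump_lbump; exact: lbump_ge0.
have := bbl_borel l01 hm step bg0 bg1 bk.
rewrite !mass_bump// => key.
have {}key : m n (mass g0) (mass g1) <= mass k.
  apply: key => x y; apply: le_trans (hk _); apply: le_trans (mh x y).
  by apply: m0le => //; exact: pos.
have lb F G : c <= F -> F <= G + t * c -> (1 - t) * F <= G.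
  move=> cF FG; rewrite mulrBl mul1r lerBlDr (le_trans FG)// lerD2l.
  by rewrite ler_wpM2l// ltW.
have kM : (1 - t) * M <= mass k.
  have t1' : 0 <= 1 - t by rewrite subr_ge0 ltW.
  apply: le_trans key; rewrite /M -(mZ _ _ _ t1' F0 F1).
  apply: mle; rewrite ?mulr_ge0//; apply: lb => //.
  - by rewrite ge_min lexx.
  - by rewrite ge_min lexx orbT.
by move: te kM ke; rewrite mulrDr mulrBl mul1r; lra.
Qed.

End bbl_lebesgue_bump.

(** * Convex and power concave functions *)

Section convex_functions.
Context {R : realType}.

Definition convex_on n (A : set 'rV[R]_n) (u : 'rV[R]_n -> R) :=
  forall x y lam, A x -> A y -> 0 <= lam <= 1 ->
    A (segment_point x y lam) /\
    u (segment_point x y lam) <= (1 - lam) * u x + lam * u y.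

Lemma rV_entry_le n (x : 'rV[R]_n) i : `|x ord0 i| <= `|x|.
Proof.
have /mapP[j Hj ->] : `|x ord0 i| \in [seq `|x k.1 k.2| | k : 'I_1 * 'I_n].
  by apply/mapP; exists (ord0, i) => //=; rewrite mem_enum.
by rewrite [leRHS]/Num.Def.normr /= mx_normrE; apply/bigmax_geP; right => /=; exists j.
Qed.

Lemma convex_average n (A : set 'rV[R]_n) u N (a : 'I_N.+1 -> 'rV[R]_n) :
  convex_on A u -> (forall i, A (a i)) ->
  A (N.+1%:R^-1 *: \sum_i a i) /\
  u (N.+1%:R^-1 *: \sum_i a i) <= N.+1%:R^-1 * \sum_i u (a i).
Proof.
move=> cA; elim: N a => [|N IHN] a Aa.
  by rewrite !big_ord1 invr1 scale1r mul1r.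
rewrite [\sum_i a i]big_ord_recr [\sum_i u (a i)]big_ord_recr /=.
have [A' u'] := IHN (fun i => a (widen_ord (leqnSn _) i)) (fun i => Aa _).
set S := \sum_(i < N.+1) a _ in A' u' *; set T := \sum_(i < N.+1) u _ in u' *.
pose lam : R := N.+2%:R^-1.
have N2 : N.+2%:R != 0 :> R by rewrite pnatr_eq0.
have N1 : N.+1%:R != 0 :> R by rewrite pnatr_eq0.
have lamE : (1 - lam) * N.+1%:R^-1 = lam.
  have E (x : R) : x != 0 -> x + 1 != 0 -> (1 - (x + 1)^-1) * x^-1 = (x + 1)^-1.
    by move=> x0 x1; field; rewrite x0 x1.
  by rewrite /lam -[N.+2%:R]natr1 E// natr1.
have l01 : 0 <= lam <= 1.
  by rewrite invr_ge0 ler0n/= invf_le1 ?ltr0n// ler1n.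
have [] := cA _ _ _ A' (Aa ord_max) l01.
have -> : segment_point (N.+1%:R^-1 *: S) (a ord_max) lam =
    N.+2%:R^-1 *: (S + a ord_max).
  by rewrite /segment_point scalerA lamE scalerDr.
move=> A2 u2; split => //; apply: le_trans u2 _.
rewrite mulrDr lerD2r -/lam -[X in _ <= X * _]lamE -mulrA ler_wpM2l//.
by rewrite subr_ge0; case/andP: l01.
Qed.

(** On each side of x the graph lies below its chord. Adding the absolute increments at both ends
    gives one slope that serves for either sign of s. *)
Lemma convex_line n (A : set 'rV[R]_n) u x e rho s : convex_on A u ->
  0 < rho -> A x -> A (x + rho *: e) -> A (x - rho *: e) -> `|s| <= rho ->
  A (x + s *: e) /\
  u (x + s *: e) <= u x + `|s| *
    ((`|u (x + rho *: e) - u x| + `|u (x - rho *: e) - u x|) / rho).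
Proof.
move=> cA rho0 Ax Ap Am srho.
have dir d t : A (x + rho *: d) -> 0 <= t <= rho ->
    A (x + t *: d) /\ u (x + t *: d) <= u x + t * (`|u (x + rho *: d) - u x| / rho).
  move=> Ad /andP[t0 tr].
  have l01 : 0 <= t / rho <= 1 by rewrite divr_ge0 ?(ltW rho0)//= ler_pdivrMr// mul1r.
  have [] := cA _ _ _ Ax Ad l01.
  have -> : segment_point x (x + rho *: d) (t / rho) = x + t *: d.
    rewrite /segment_point scalerDr scalerA divfK ?gt_eqF//.
    by rewrite addrA -scalerDl subrK scale1r.
  move=> Ax2 ux2; split => //; apply: le_trans ux2 _.
  have -> : (1 - t / rho) * u x + t / rho * u (x + rho *: d) =
    u x + t / rho * (u (x + rho *: d) - u x) by ring.
  rewrite lerD2l -mulrA [X in _ <= _ * X]mulrC mulrA mulrA ler_wpM2l ?ler_norm//.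
  by case/andP: l01.
have [s0|s0] := leP 0 s.
  have st : 0 <= s <= rho by rewrite s0 -(ger0_norm s0).
  have [h1 h2] := dir e s Ap st; split => //; apply: le_trans h2 _.
  rewrite lerD2l (ger0_norm s0) ler_wpM2l// ler_pM2r ?invr_gt0//.
  by rewrite lerDl.
have st : 0 <= - s <= rho by rewrite oppr_ge0 (ltW s0) -(ltr0_norm s0).
have Am' : A (x + rho *: - e) by rewrite scalerN.
have [] := dir (- e) (- s) Am' st; rewrite !scalerN scaleNr opprK => h1 h2.
split => //; apply: le_trans h2 _.
rewrite lerD2l (ltr0_norm s0) ler_wpM2l ?oppr_ge0 ?(ltW s0)//.
by rewrite ler_pM2r ?invr_gt0// lerDr.
Qed.

(* x + y is the average over i of the points x + n y_i e_i, so convexity along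
   the coordinate lines gives the upper estimate; the reflection x - y gives
   the lower one. *)
Lemma convex_locally_lipschitz n (A : set 'rV[R]_n) u (x : 'rV[R]_n) :
  convex_on A u -> nbhs x A ->
  exists d K : R, [/\ 0 < d, 0 <= K & forall y : 'rV[R]_n, `|y| <= d ->
    A (x + y) /\ `|u (x + y) - u x| <= K * `|y|].
Proof.
case: n A u x => [|n] A u x cA xA.
  exists 1, 0; split => // y _; have -> : y = 0 by apply/rowP => -[].
  by rewrite addr0 subrr normr0 mul0r; split => //; exact: nbhs_singleton.
have [r /= r0 rA] := (nbhs_ballP _ _).1 xA.
pose rho := r / 2; have rho0 : 0 < rho by rewrite divr_gt0.
have Ax : A x by exact: nbhs_singleton.
pose e (i : 'I_n.+1) : 'rV[R]_n.+1 := delta_mx ord0 i.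
have inA (i : 'I_n.+1) s : `|s| <= rho -> A (x + s *: e i).
  move=> srho; apply: rA; split => // k j; rewrite /ball /= !mxE opprD addNKr normrN normrM.
  have : `|((k == ord0) && (j == i))%:R : R| <= 1.
    by case: (_ && _); rewrite ?normr1 ?normr0.
  move=> h; apply: (@le_lt_trans _ _ (rho * 1)); first exact: ler_pM.
  by rewrite mulr1 /rho ltr_pdivrMr//; lra.
pose K i := (`|u (x + rho *: e i) - u x| + `|u (x - rho *: e i) - u x|) / rho.
have K0 i : 0 <= K i by rewrite divr_ge0 ?(ltW rho0)// addr_ge0.
pose d := rho / n.+1%:R.
have d0 : 0 < d by rewrite divr_gt0// ltr0n.
have nN0 : n.+1%:R != 0 :> R by rewrite pnatr_eq0.
have upper y : `|y| <= d ->
    A (x + y) /\ u (x + y) <= u x + (\sum_i K i) * `|y|.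
  move=> yd; pose a i := x + (n.+1%:R * y ord0 i) *: e i.
  have small i : `|n.+1%:R * y ord0 i| <= rho.
    rewrite normrM normr_nat mulrC -ler_pdivlMr ?ltr0n//.
    exact: le_trans (rV_entry_le y i) yd.
  have Ap i : A (x + rho *: e i) by apply: inA; rewrite gtr0_norm.
  have Am i : A (x - rho *: e i).
    by rewrite -scaleNr; apply: inA; rewrite normrN gtr0_norm.
  have line i := convex_line cA rho0 Ax (Ap i) (Am i) (small i).
  have xyE : x + y = n.+1%:R^-1 *: \sum_i a i.
    rewrite big_split/= sumr_const card_ord scalerDr -[x *+ _]scaler_nat scalerA.
    rewrite mulVf// scale1r; congr (_ + _); rewrite {1}(row_sum_delta y).
    rewrite scaler_sumr; apply: eq_bigr => i _.
    by rewrite scalerA mulrA mulVf// mul1r.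
  have [Aa ua] := convex_average cA (fun i => (line i).1).
  rewrite xyE; split => //; apply: le_trans ua _.
  apply: (@le_trans _ _ (n.+1%:R^-1 *
      \sum_i (u x + `|n.+1%:R * y ord0 i| * K i))).
    rewrite ler_wpM2l ?invr_ge0//; apply: ler_sum => i _; exact: (line i).2.
  rewrite big_split/= sumr_const card_ord mulrDr -[u x *+ _]mulr_natl mulrA.
  rewrite mulVf// mul1r lerD2l.
  rewrite mulr_sumr mulr_suml; apply: ler_sum => i _.
  rewrite normrM normr_nat mulrA [X in X * _]mulrA mulVf// mul1r [leLHS]mulrC ler_wpM2l//.
  exact: rV_entry_le.
exists d, (\sum_i K i); split => //; first exact: sumr_ge0.
move=> y yd; have [Ay uy] := upper y yd; split => //.
have Nyd : `|- y| <= d by rewrite normrN.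
have [Ny uNy] := upper (- y) Nyd.
rewrite normrN in uNy.
rewrite ler_norml lerBlDl uy andbT.
have half : 0 <= (2^-1 : R) <= 1 by apply/andP; split; lra.
have [_] := cA _ _ _ Ay Ny half.
have -> : segment_point (x + y) (x - y) 2^-1 = x.
  have h : 1 - 2^-1 = 2^-1 :> R by field.
  rewrite /segment_point h -scalerDr addrACA subrr addr0 -mulr2n -[x *+ _]scaler_nat.
  by rewrite scalerA mulVf ?scale1r.
have -> : 1 - 2^-1 = 2^-1 :> R by field.
by lra.
Qed.

Lemma convex_continuous_at n (A : set 'rV[R]_n) u (x : 'rV[R]_n) :
  convex_on A u -> nbhs x A -> {for x, continuous u}.
Proof.
move=> cA xA; have [d [K [d0 K0 dK]]] := convex_locally_lipschitz cA xA.
apply/(@cvgrPdist_le _ _ _ (nbhs x)) => e e0; apply/nbhs_ballP.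
have K1 : 0 < K + 1 by lra.
exists (Num.min d (e / (K + 1))); first by rewrite /= lt_min d0 divr_gt0.
move=> y; rewrite -ball_normE /= lt_min => /andP[yd ye].
have yxd : `|y - x| <= d by rewrite distrC ltW.
have [_] := dK (y - x) yxd.
rewrite subrKC distrC => /le_trans; apply.
rewrite distrC; apply: (@le_trans _ _ ((K + 1) * (e / (K + 1)))).
  by apply: ler_pM => //; [rewrite lerDl|exact: ltW].
by rewrite mulrCA divff ?mulr1// gt_eqF.
Qed.

(** The centre c is a convex combination of x and of a point near c opposite to x, where u is
    bounded above; convexity then bounds u x from below. *)
Lemma convex_bounded_below n (A : set 'rV[R]_n) u (c : 'rV[R]_n) (D : R) :
  convex_on A u -> nbhs c A -> (forall x, A x -> `|x| <= D) -> exists B, forall x, A x -> B <= u x.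
Proof.
move=> cA nA AD; have [d [K [d0 K0 dK]]] := convex_locally_lipschitz cA nA.
have D0 : 0 <= D by exact: le_trans (AD _ (nbhs_singleton nA)).
(* As |x - c| <= 2 D, this s brings the opposite point c - s (x - c) within distance d of c; [lam]
   solves (1 - lam) s = lam. *)
pose s := d / (2 * D + 1).
have D1 : 0 < 2 * D + 1 by lra.
have s0 : 0 < s by rewrite divr_gt0.
pose lam := s / (1 + s).
have s1 : 0 < 1 + s by lra.
have lam0 : 0 < lam by rewrite divr_gt0.
have lam1 : lam < 1 by rewrite ltr_pdivrMr//; lra.
have lamE : (1 - lam) * s = lam by rewrite /lam; field; rewrite gt_eqF.
exists ((u c - (1 - lam) * (u c + K * d)) / lam) => x Ax.
pose y := - (s *: (x - c)).
have yd : `|y| <= d.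
  rewrite normrN normrZ gtr0_norm// /s mulrAC ler_pdivrMr// ler_wpM2l ?(ltW d0)//.
  have := ler_normB x c; have := AD _ Ax; have := AD _ (nbhs_singleton nA).
  by move: (`|x|) (`|c|) (`|x - c|) => *; lra.
have [Ay uy] := dK y yd.
have l01 : 0 <= lam <= 1 by rewrite !ltW.
have [_] := cA _ _ _ Ay Ax l01.
have -> : segment_point (c + y) x lam = c.
  apply/rowP => i; rewrite /segment_point /y !mxE mulrDr mulrN mulrA lamE.
  by ring.
move=> h; rewrite ler_pdivrMr// lerBlDl (le_trans h)// [u x * _]mulrC lerD2r.
rewrite ler_wpM2l ?subr_ge0 ?(ltW lam1)// -lerBlDl.
apply: le_trans (ler_norm _) (le_trans uy _).
by rewrite ler_wpM2l.
Qed.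

End convex_functions.

(** * Open sets and continuous functions are Borel *)

Section borel_open.
Context {R : realType}.

(** Balls of the sup norm are cubes, so U is the union of the countably many cubes with rational
    centre and radius 1 / (k + 1) that it contains. *)
Lemma open_borel_rV n (U : set 'rV[R]_n) : open U ->
  measurable (U : set (borel_rV R n)).
Proof.
move=> oU; pose B (q : 'rV[rat]_n) (k : nat) : set 'rV[R]_n :=
  [set x | forall i, `|x ord0 i - ratr (q ord0 i)| < k.+1%:R^-1].
pose F (z : 'rV[rat]_n * nat) : set 'rV[R]_n :=
  if pselect (B z.1 z.2 `<=` U) then B z.1 z.2 else set0.
have mF z : measurable (F z : set (borel_rV R n)).
  rewrite /F; case: pselect => [BU|nBU]; last exact: measurable0.
  rewrite [X in measurable X](_ : _ = box (fun i =>
      `]ratr (z.1 ord0 i) - z.2.+1%:R^-1, ratr (z.1 ord0 i) + z.2.+1%:R^-1[%classic)).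
    exact: measurable_box.
  by apply/seteqP; split => x /= h i; move: (h i) => /=;
    rewrite in_itv/= ltr_distl.
rewrite (_ : U = \bigcup_z F z); first exact: countable_bigcupT_measurable.
apply/seteqP; split => x; last first.
  by move=> [z _]; rewrite /F; case: pselect => [BU /BU|nBU []].
move=> Ux; have [e /= e0 eU] := (nbhs_ballP _ _).1 (open_nbhs_nbhs (conj oU Ux)).
pose k := Num.bound (2 / e).
have k0 : 0 < (k.+1%:R^-1 : R) by rewrite invr_gt0 ltr0n.
have ke : 2 * k.+1%:R^-1 < e.
  rewrite ltr_pdivrMr ?ltr0n// mulrC -ltr_pdivrMr//.
  apply: lt_le_trans (archi_boundP _) _; first by rewrite divr_ge0// ltW.
  by rewrite ler_nat.
have ratP i : exists q : rat, `|x ord0 i - ratr q| < k.+1%:R^-1.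
  have lt : x ord0 i - k.+1%:R^-1 < x ord0 i + k.+1%:R^-1.
    by rewrite ltrD2l gtrN.
  have [q] := rat_in_itvoo lt.
  by rewrite in_itv/= => qi; exists q; rewrite distrC ltr_distl.
pose q := \row_i projT1 (cid (ratP i)).
have qP i : `|x ord0 i - ratr (q ord0 i)| < k.+1%:R^-1.
  by rewrite mxE; case: cid.
exists (q, k) => //; rewrite /F; case: pselect => [BU|nBU]; first exact: qP.
case: nBU => y By; apply: eU; split => // i j; rewrite (ord1 i) /ball /=.
have := By j; have := qP j => /= h1 h2.
rewrite -(subrK (ratr (q ord0 j)) (x ord0 j)) -addrA.
apply: (le_lt_trans (ler_normD _ _)); apply: lt_trans ke.
by rewrite mulr_natl mulr2n ltrD// distrC.
Qed.

Lemma continuous_borel n (f : 'rV[R]_n -> R) : continuous f ->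
  measurable_fun setT (f : borel_rV R n -> R).
Proof.
move=> cf; apply: (measurability _ (RGenOInfty.measurableE R)) => //.
move=> _ [_ [a ->] <-]; rewrite setTI; apply: open_borel_rV.
by apply: open_comp => // x _; exact: cf.
Qed.

End borel_open.

Section power_concave_functions.
Context {R : realType}.

Lemma power_concave_convex n (A : set 'rV[R]_n) (p : R) (f : 'rV[R]_n -> R) :
  p < 0 -> (forall x, A x -> 0 < f x) ->
  (forall x y lam, A x -> A y -> 0 <= lam <= 1 -> A (segment_point x y lam)) ->
  power_concave p%:E A f -> convex_on A (fun x => f x `^ p).
Proof.
move=> p0 f0 cA cf x y lam Ax Ay l01; split; first exact: cA.
have pN0 : p != 0 by rewrite lt_eqF.
have fx := f0 _ Ax; have fy := f0 _ Ay.
have := cf _ _ _ Ax Ay l01; rewrite (power_mean_fin _ pN0 fx fy) => h.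
have c0 : 0 < (1 - lam) * f x `^ p + lam * f y `^ p.
  exact/conv_gt0/powR_gt0/fy/powR_gt0/fx.
have := powR_neg_le (ltW p0) (powR_gt0 p^-1 c0) h.
by rewrite (powRKV pN0 (ltW c0)).
Qed.

Lemma log_concave_convex n (A : set 'rV[R]_n) (f : 'rV[R]_n -> R) :
  (forall x, A x -> 0 < f x) ->
  (forall x y lam, A x -> A y -> 0 <= lam <= 1 -> A (segment_point x y lam)) ->
  power_concave 0%:E A f -> convex_on A (fun x => - ln (f x)).
Proof.
move=> f0 cA cf x y lam Ax Ay l01; split; first exact: cA.
have fx := f0 _ Ax; have fy := f0 _ Ay.
have := cf _ _ _ Ax Ay l01; rewrite (power_mean0 _ fx fy) => h.
have fz := f0 _ (cA _ _ _ Ax Ay l01).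
have m0 : 0 < f x `^ (1 - lam) * f y `^ lam by rewrite mulr_gt0// powR_gt0.
have : ln (f x `^ (1 - lam) * f y `^ lam) <= ln (f (segment_point x y lam)).
  by rewrite ler_ln.
rewrite lnM ?posrE ?powR_gt0// !ln_powR.
by rewrite !mulrN -opprD lerN2.
Qed.

(** f is a continuous function of a convex one: of f^p if p < 0, of - ln f if p = 0. *)
Lemma power_concave_continuous n (p : R) (f : 'rV[R]_n -> R) :
  p <= 0 -> (forall x, 0 < f x) -> power_concave p%:E setT f -> continuous f.
Proof.
move=> p0 f0 cf; suff H (x : 'rV[R]_n) : {for x, continuous f} by move=> x; exact: H.
have xT : nbhs x setT by exact: filterT.
have [u [v [hu hv fE]]] : exists (u : 'rV[R]_n -> R) (v : R -> R), [/\ {for x, continuous u},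
    {for u x, continuous v} & f = v \o u].
  move: p0; rewrite le_eqVlt => /predU1P[pE|p0].
    exists (fun y => - ln (f y)), (fun r => expR (- r)); split.
    - apply: convex_continuous_at xT.
      have cf0 : power_concave 0%:E setT f by rewrite -pE.
      exact: (log_concave_convex (fun y _ => f0 y) (fun _ _ _ _ _ _ => I) cf0).
    - apply: continuous_comp; last exact: continuous_expR.
      exact: oppr_continuous.
    - by apply/funext => y /=; rewrite opprK lnK// posrE.
  have pN0 : p != 0 by rewrite lt_eqF.
  exists (fun y => f y `^ p), (fun r => expR (p^-1 * ln r)); split.
  - by apply: convex_continuous_at xT; exact: power_concave_convex.
  - apply: continuous_comp; last exact: continuous_expR.
    apply: continuousM; first exact: cst_continuous.
    by apply: continuous_ln; exact: powR_gt0.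
  - by apply/funext => y /=; rewrite ln_powR mulrA mulVf// mul1r lnK// posrE.
by rewrite fE; exact: continuous_comp.
Qed.

(** f^p is a positive concave function on the whole space, hence constant: a decrease from y to x,
    continued beyond x, would make it negative. *)
Lemma power_concave_pos_cst n (p : R) (f : 'rV[R]_n -> R) :
  0 < p -> (forall x, 0 < f x) -> power_concave p%:E setT f ->
  forall x y, f y <= f x.
Proof.
move=> p0 f0 cf x y; have pN0 : p != 0 by rewrite gt_eqF.
rewrite leNgt; apply/negP => fxy.
pose a := f x `^ p; pose b := f y `^ p.
have ab : a < b by rewrite /a /b gt0_ltr_powR ?nnegrE ?(ltW (f0 _)).
have a0 : 0 < a by exact: powR_gt0.
have b0 : 0 < b by exact: powR_gt0.
(* Chosen so that (1 - lam) b is the midpoint of a and b, hence above a; the point [z] below has x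
   as its combination with y. *)
pose lam := (b - a) / (2 * b).
have lam0 : 0 < lam by rewrite divr_gt0 ?subr_gt0// mulr_gt0.
have lam1 : lam < 1 by rewrite ltr_pdivrMr ?mulr_gt0//; lra.
have l01 : 0 <= lam <= 1 by rewrite !ltW.
pose z := y + lam^-1 *: (x - y).
have := cf y z lam I I l01; have fz := f0 z; have fy := f0 y.
rewrite (power_mean_fin _ pN0 fy fz).
have -> : segment_point y z lam = x.
  rewrite /segment_point /z scalerDr scalerA mulfV ?gt_eqF// scale1r addrA.
  by rewrite -scalerDl subrK scale1r addrC subrK.
set c := (1 - lam) * _ + _; have c0 : 0 < c.
  exact/conv_gt0/powR_gt0/fz/powR_gt0/fy.
move=> h.
have : c <= a.
  rewrite /a -(powRKV pN0 (ltW c0)).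
  by apply: ge0_ler_powR; rewrite ?nnegrE ?(ltW p0) ?powR_ge0 ?(ltW (f0 _)).
apply/negP; rewrite -ltNge; apply: (@lt_trans _ _ ((1 - lam) * b)); last first.
  by rewrite /c -/b ltrDl mulr_gt0// powR_gt0.
have E : lam * b = (b - a) / 2 by rewrite /lam; field; rewrite gt_eqF.
by rewrite mulrBl mul1r E; lra.
Qed.

(* Every mean with nonnegative exponent dominates the geometric mean. *)
Lemma power_concave_log n (e : \bar R) (A : set 'rV[R]_n) (f : 'rV[R]_n -> R) :
  (0 <= e)%E -> (forall x, 0 <= f x) -> power_concave e A f ->
  power_concave 0%:E A f.
Proof.
move=> e0 f0 cf x y lam Ax Ay l01; apply: le_trans (cf _ _ _ Ax Ay l01).
(* Hölder with p = 0 and both first entries 1, where [ell 0 e] is 0 for every e >= 0. *)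
have := @power_mean_holder R lam 0 e 1 1 (f x) (f y) l01 (lexx 0) e0.
rewrite add0e => /(_ e0 ler01 ler01 (f0 x) (f0 y)).
rewrite !mul1r power_meanxx// mul1r; congr (power_mean _ _ _ _ <= _).
case: e e0 {cf} => [r| |] //= r0.
by case: ifPn => [_|]; rewrite ?mul0r// eqxx negbK add0r => ->.
Qed.

Lemma power_concave_support_convex n (e : \bar R) (f : 'rV[R]_n -> R) :
  (forall x, 0 <= f x) -> power_concave e setT f ->
  forall x y lam, 0 < f x -> 0 < f y -> 0 <= lam <= 1 ->
  0 < f (segment_point x y lam).
Proof.
move=> f0 cf x y lam fx fy l01.
exact: lt_le_trans (power_mean_gt0 e l01 fx fy) (cf x y lam I I l01).
Qed.

End power_concave_functions.

(** * Weights with bounded support *)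

Section compactly_supported.
Context {R : realType}.
Notation mu := (@borel_lebesgue R).
Notation nu := (@lebesgue_measure_rV R).

Lemma rV_norm_le n (x : 'rV[R]_n) (d : R) : 0 <= d ->
  (forall i, `|x ord0 i| <= d) -> `|x| <= d.
Proof.
move=> d0 xd; rewrite [leLHS]/Num.Def.normr /= mx_normrE.
by apply: bigmax_le => // -[i j] _ /=; rewrite (ord1 i).
Qed.

Lemma compact_box n (a b : 'I_n -> R) : compact (box (fun i => `[a i, b i]%classic)).
Proof. by apply: rV_compact => i; exact: segment_compact. Qed.

Lemma continuous_bounded_cube n (g : 'rV[R]_n -> R) (r : R) : continuous g ->
  0 < r -> exists C, forall x, cube r x -> g x <= C.
Proof.
move=> cg r0; have c0 : (cube r : set 'rV[R]_n) !=set0.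
  by exists (0 : 'rV[R]_n) => i /=; rewrite mxE in_itv/=; apply/andP; split; lra.
have [c _ cmax] := compact_EVT_max c0 (@compact_box n (fun=> - r) (fun=> r))
  (continuous_subspaceT cg).
by exists (g c) => x Qx; apply: cmax; rewrite inE.
Qed.

Lemma borel_lebesgue_box_gt0 n (Y : 'I_n -> set R) :
  (forall i, measurable (Y i)) -> (forall i, 0 < lebesgue_measure (Y i))%E ->
  (0 < mu n (box Y))%E.
Proof.
move=> mY Y0; rewrite borel_lebesgue_box//.
elim: n Y {mY} Y0 => [|n IHn] Y Y0; first by rewrite big_ord0 lte_fin.
rewrite big_ord_recl; apply: mule_gt0 => //.
exact: (IHn (fun i => Y (lift ord0 i))).
Qed.

Section weight.
Context n (psi : 'rV[R]_n -> R) (e : \bar R).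
Context (e_ge0 : (0 <= e)%E).
Context (psi_ge0 : forall y, 0 <= psi y).
Context (psi_meas : measurable_fun setT (psi : lebesgue_rV R n -> R)).
Context (psi_concave : power_concave e setT psi).
Context (supp_bounded : bounded_set (~` (psi @^-1` [set 0]))).
Context (supp_interior : interior (~` (psi @^-1` [set 0])) !=set0).

Let A : set 'rV[R]_n := [set y | 0 < psi y].

Let AE : ~` (psi @^-1` [set 0]) = A.
Proof.
apply/seteqP; split => y /=; rewrite /A /=; last by move=> + y0; rewrite y0 ltxx.
by move=> /eqP y0; rewrite lt0r y0 psi_ge0.
Qed.

Let cA : convex_on A (fun y => - ln (psi y)).
Proof.
apply: log_concave_convex => //.
  by move=> x y lam Ax Ay l01; exact: (power_concave_support_convex psi_ge0 psi_concave).
move=> x y lam Ax Ay l01.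
exact: (power_concave_log e_ge0 psi_ge0 psi_concave).
Qed.

Let A_bounded : exists D, forall y, A y -> `|y| <= D.
Proof.
move: supp_bounded; rewrite AE => /ex_strict_bound_gt0[D D0 AD].
by exists D => y Ay; exact: ltW (AD _ Ay).
Qed.

(** Only the upper bound is at stake: - ln psi is convex on a bounded set with an interior point,
    hence bounded below there. *)
Lemma weight_lbump : lbump psi.
Proof.
have [D AD] := A_bounded; have [c Ac] := supp_interior; rewrite AE in Ac.
have [B AB] := convex_bounded_below cA Ac AD.
exists (Num.max D 1), (expR (- B)); split => //.
- by rewrite lt_max ltr01 orbT.
- move=> y; rewrite psi_ge0/=.
  have [y0|y0] := leP (psi y) 0; first exact: le_trans y0 (expR_ge0 _).
  by rewrite -[leLHS]lnK ?posrE// ler_expR lerNr; exact: AB.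
- move=> y i; rewrite gt_max => /andP[yi _]; apply/eqP; rewrite -[_ == _]negbK.
  apply/negP => y0; have Ay : A y by rewrite /A /= lt0r y0 psi_ge0.
  have yD := AD _ Ay.
  by have := lt_le_trans yi (le_trans (rV_entry_le y i) yD); rewrite ltxx.
Qed.

(** Near an interior point of the support, - ln psi is finite and Lipschitz at that point, so psi
    stays away from 0. *)
Lemma weight_lower_bound : exists (c : 'rV[R]_n) (d m : R),
  [/\ 0 < d, 0 < m & forall y, `|y - c| <= d -> m <= psi y].
Proof.
have [c Ac] := supp_interior; rewrite AE in Ac.
have [d [K [d0 K0 dK]]] := convex_locally_lipschitz cA Ac.
exists c, d, (expR (ln (psi c) - K * d)); split => //; first exact: expR_gt0.
move=> y yd; have [+ uy] := dK (y - c) yd; rewrite subrKC => Ay.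
rewrite -[leRHS]lnK ?posrE// ler_expR.
move: uy; rewrite subrKC ler_norml => /andP[_].
have : K * `|y - c| <= K * d by rewrite ler_wpM2l.
by lra.
Qed.

Lemma weighted_lbump (g : 'rV[R]_n -> R) : continuous g -> (forall y, 0 < g y) ->
  lbump (fun y => g y * psi y).
Proof.
move=> cg g0; have [r [C [r0 mp pC pr]]] := weight_lbump.
have C0 : 0 <= C by have /andP[h] := pC 0; exact: le_trans.
have [B gB] := continuous_bounded_cube cg r0.
have mg := borel_measurable_fun (continuous_borel cg).
exists r, (Num.max 0 B * C); split; first exact: r0.
- exact: measurable_funM.
- move=> y; have /andP[p0 pyC] := pC y; rewrite mulr_ge0 ?(ltW (g0 y))//=.
  have [->|py] := eqVneq (psi y) 0.
    by rewrite mulr0 mulr_ge0// le_max lexx.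
  apply: ler_pM => //; first exact: ltW.
  by rewrite le_max gB ?orbT//; exact: support_cube py.
- by move=> y i /pr ->; rewrite mulr0.
Qed.

Lemma weighted_mass_gt0 (g : 'rV[R]_n -> R) : continuous g -> (forall y, 0 < g y) ->
  0 < mass (fun y => g y * psi y).
Proof.
move=> cg g0; have [c [d [m [d0 m0 dm]]]] := weight_lower_bound.
have bf := weighted_lbump cg g0.
pose B : set 'rV[R]_n := box (fun i => `[c ord0 i - d, c ord0 i + d]%classic).
have B0 : B !=set0.
  by exists c => i /=; rewrite in_itv/=; apply/andP; split; lra.
have [z _ zmin] := compact_EVT_min B0
  (@compact_box n (fun i => c ord0 i - d) (fun i => c ord0 i + d))
  (continuous_subspaceT cg).
pose k := g z * m; have k0 : 0 < k by rewrite mulr_gt0.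
have mB : measurable (B : set (borel_rV R n)) by exact: measurable_box.
have mB' := borel_lebesgue_measurable mB.
have kf x : 0 <= k * \1_B x <= g x * psi x.
  rewrite indicE; case: (boolP (x \in B)) => xB; last first.
    by rewrite mulr0 lexx mulr_ge0// ltW.
  rewrite mulr1 (ltW k0)/=; apply: ler_pM; rewrite ?(ltW (g0 _)) ?(ltW m0)//.
    exact: zmin.
  apply: dm; apply: rV_norm_le => [|i]; first exact: ltW.
  by move: xB; rewrite inE => /(_ i) /=; rewrite in_itv/= !mxE ler_distl.
have bk : lbump (fun x => k * \1_B x).
  apply: (lbump_le _ bf kf); apply: measurable_funM; first exact: measurable_cst.
  exact: measurable_indic.
apply: lt_le_trans (le_mass bk bf _); last by move=> x; case/andP: (kf x).
rewrite -lte_fin -massE// integral_scaled_indic ?(ltW k0)//.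
rewrite lebesgue_measure_rVE//; apply: mule_gt0; first by rewrite lte_fin.
apply: borel_lebesgue_box_gt0 => // i.
rewrite lebesgue_measure_itv/= lte_fin ifT; last by rewrite ltrD2l gtrN.
by rewrite -EFinD lte_fin opprB addrC addrA subrK addr_gt0.
Qed.

End weight.
End compactly_supported.

(** * Slabs and strictness *)

Section slabs.
Context {R : realType}.
Notation mu := (@borel_lebesgue R).
Notation nu := (@lebesgue_measure_rV R).
Context n (i : 'I_n).
Implicit Types (f : 'rV[R]_n -> R) (J : set R) (u v : R).

Definition slab J : set 'rV[R]_n := [set y | J (y ord0 i)].

Definition slab_mass f J := mass (fun y => f y * \1_(slab J) y).

(** The distribution function of the i-th marginal of f, not normalised: it increases from 0 to
    [mass f]. *)
Definition cdf f u := slab_mass f `]-oo, u]%classic.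

Lemma measurable_slab J : measurable J -> measurable (slab J : set (lebesgue_rV R n)).
Proof.
move=> mJ; apply: borel_lebesgue_measurable; apply: sub_sigma_algebra.
by exists i, J.
Qed.

Lemma lbump_slab f J : lbump f -> measurable J -> lbump (fun y => f y * \1_(slab J) y).
Proof. by move=> bf mJ; apply: lbump_indic => //; exact: measurable_slab. Qed.

Lemma slab_mass_ge0 f J : lbump f -> measurable J -> 0 <= slab_mass f J.
Proof. by move=> bf mJ; apply: mass_ge0; exact: lbump_slab. Qed.

Lemma slab_massU f J K : lbump f -> measurable J -> measurable K ->
  J `&` K = set0 -> slab_mass f (J `|` K) = slab_mass f J + slab_mass f K.
Proof.
move=> bf mJ mK JK; rewrite /slab_mass -massD; [|exact: lbump_slab..].
congr mass; apply/funext => y; rewrite -mulrDr; congr (_ * _).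
have nJK : ~ (J (y ord0 i) /\ K (y ord0 i)).
  by move=> h; suff : set0 (y ord0 i) by []; rewrite -JK.
have E L : \1_(slab L) y = (`[< L (y ord0 i) >])%:R :> R by rewrite indicE.
rewrite !E; have [Jy|Jy] := pselect (J (y ord0 i)).
  have Ky : ~ K (y ord0 i) by move=> Ky; apply: nJK.
  by rewrite (asboolT Jy) (asboolF Ky) (asboolT (_ : (J `|` K) _)) ?addr0//; left.
rewrite (asboolF Jy) add0r; have [Ky|Ky] := pselect (K (y ord0 i)).
  by rewrite (asboolT Ky) (asboolT (_ : (J `|` K) _))//; right.
by rewrite (asboolF Ky) (asboolF (_ : ~ (J `|` K) _))// => -[].
Qed.

Lemma slab_mass_le f g c J : lbump f -> lbump g -> 0 <= c -> measurable J ->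
  (forall y, f y <= c * g y) -> slab_mass f J <= c * slab_mass g J.
Proof.
move=> bf bg c0 mJ fg; rewrite /slab_mass -massZ//; last exact: lbump_slab.
apply: le_mass; [exact: lbump_slab|apply: lbumpZ => //; exact: lbump_slab|].
by move=> y; rewrite mulrA ler_wpM2r.
Qed.

Lemma slab_massT f : slab_mass f setT = mass f.
Proof.
by congr mass; apply/funext => y; rewrite indicE mem_set ?mulr1.
Qed.

Lemma cdfB f u v : lbump f -> u <= v ->
  slab_mass f `]u, v]%classic = cdf f v - cdf f u.
Proof.
move=> bf uv.
have dis : `]-oo, u]%classic `&` `]u, v]%classic = set0.
  apply/seteqP; split=> t //=; rewrite !in_itv/= => -[tu /andP[ut _]].
  by have := lt_le_trans ut tu; rewrite ltxx.
have E : `]-oo, v]%classic = `]-oo, u]%classic `|` `]u, v]%classic.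
  apply/seteqP; split => t /=; rewrite !in_itv/=.
    by have [|] := leP t u; [left|right].
  by move=> [tu|/andP[]//]; exact: le_trans uv.
have := slab_massU bf (measurable_itv _) (measurable_itv _) dis.
by rewrite -E /cdf => ->; rewrite addrC addKr.
Qed.

Lemma cdfC f u : lbump f -> slab_mass f `]u, +oo[%classic = mass f - cdf f u.
Proof.
move=> bf.
have dis : `]-oo, u]%classic `&` `]u, +oo[%classic = set0.
  apply/seteqP; split=> t //=; rewrite !in_itv/= andbT => -[tu ut].
  by have := lt_le_trans ut tu; rewrite ltxx.
have E : [set: R] = `]-oo, u]%classic `|` `]u, +oo[%classic.
  apply/seteqP; split => t //= _; rewrite !in_itv/= andbT.
  by have [|] := leP t u; [left|right].
have := slab_massU bf (measurable_itv _) (measurable_itv _) dis.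
by rewrite -E slab_massT /cdf => ->; rewrite addrC addKr.
Qed.

Lemma cdf_homo f u v : lbump f -> u <= v -> cdf f u <= cdf f v.
Proof. by move=> bf uv; rewrite -subr_ge0 -cdfB// slab_mass_ge0. Qed.

Lemma cdf_ge0 f u : lbump f -> 0 <= cdf f u.
Proof. by move=> bf; exact: slab_mass_ge0. Qed.

Lemma cdf_le_mass f u : lbump f -> cdf f u <= mass f.
Proof. by move=> bf; rewrite -subr_ge0 -cdfC// slab_mass_ge0. Qed.

Lemma borel_lebesgue_box_fin k (Y : 'I_k -> set R) (l : 'I_k -> R) :
  (forall j, measurable (Y j)) -> (forall j, lebesgue_measure (Y j) = (l j)%:E) ->
  mu k (box Y) = (\prod_j l j)%:E.
Proof.
move=> mY Yl; rewrite borel_lebesgue_box//.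
rewrite (@big_morph _ _ EFin 1%E *%E)//.
by apply: eq_bigr => j _.
Qed.

Lemma cdf_lipschitz f : lbump f ->
  exists2 L, 0 <= L & forall u v, u <= v -> cdf f v - cdf f u <= L * (v - u).
Proof.
move=> bf; have [r [C [r0 mf fC fr]]] := bf.
have C0 : 0 <= C by have /andP[h] := fC 0; exact: le_trans.
(* C times the volume per unit thickness of the part of the slab inside the cube that carries f. *)
exists (C * \prod_(j < n | j != i) (2 * r)).
  by apply: mulr_ge0 => //; apply: prodr_ge0 => j _; rewrite mulr_ge0// ltW.
move=> u v uv; rewrite -cdfB//.
pose Y (j : 'I_n) := (if j == i then `]u, v] else `[- r, r])%classic : set R.
pose l (j : 'I_n) := if j == i then v - u else 2 * r.
have mY j : measurable (Y j) by rewrite /Y; case: ifP.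
have Yl j : lebesgue_measure (Y j) = (l j)%:E.
  rewrite /Y /l; case: ifP => _; rewrite lebesgue_measure_itv/= lte_fin.
    have [uv'|vu] := ltP u v; first by rewrite -EFinD.
    by congr EFin; apply/esym/eqP; rewrite subr_eq0 eq_le vu.
  by rewrite gtrN// -EFinD opprK; congr EFin; ring.
have mB : measurable (box Y : set (borel_rV R n)) by exact: measurable_box.
have mB' := borel_lebesgue_measurable mB.
have sub y : y \in slab `]u, v]%classic -> f y != 0 -> y \in box Y.
  rewrite !inE => uvy fy j; rewrite /Y; case: ifPn => [/eqP ->|_]; first exact: uvy.
  exact: (support_cube fr fy).
have bB : lbump (fun y => C * \1_(box Y) y).
  exists (Num.max r (Num.max `|u| `|v|)), C; split.
  - by rewrite lt_max r0.
  - by apply: measurable_funM; [exact: measurable_cst|exact: measurable_indic].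
  - by move=> y; rewrite indicE; case: (_ \in _); rewrite ?mulr1 ?mulr0 lexx ?C0.
  move=> y j; rewrite !gt_max => /andP[yr /andP[yu yv]].
  rewrite indicE memNset ?mulr0// => /(_ j); rewrite /Y; case: ifP => _ /=.
    rewrite in_itv/= => /andP[h1 h2].
    have vn := ler_norm v; have un := ler_norm (- u); rewrite normrN in un.
    have [y0|y0] := leP 0 (y ord0 j).
      by rewrite (ger0_norm y0) in yv; have := lt_le_trans yv (le_trans h2 vn); rewrite ltxx.
    rewrite (ltr0_norm y0) in yu; rewrite -ltrN2 in h1.
    by have := lt_trans (lt_le_trans h1 un) yu; rewrite ltxx.
  by rewrite in_itv/= -ler_norml leNgt yr.
apply: (@le_trans _ _ (mass (fun y => C * \1_(box Y) y))).
  apply: le_mass => //; first exact: lbump_slab.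
  move=> y; have [->|fy] := eqVneq (f y) 0; first by rewrite mul0r mulr_ge0.
  rewrite !indicE; case: (boolP (y \in slab _)) => ys; last by rewrite mulr0 mulr_ge0.
  by rewrite (sub _ ys fy) !mulr1; case/andP: (fC y).
rewrite -lee_fin -massE// integral_scaled_indic// lebesgue_measure_rVE//.
rewrite (borel_lebesgue_box_fin mY Yl) -EFinM lee_fin -mulrA.
rewrite ler_wpM2l// (bigD1 i)//= /l eqxx mulrC ler_wpM2r ?subr_ge0//.
by rewrite le_eqVlt; apply/orP; left; apply/eqP; apply: eq_bigr => j /negPf ->.
Qed.

Lemma cdf_continuous f : lbump f -> continuous (cdf f).
Proof.
move=> bf x; have [L L0 fL] := cdf_lipschitz bf.
apply/cvgrPdist_le => e e0; apply/nbhs_ballP.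
have L1 : 0 < L + 1 by lra.
exists (e / (L + 1)); first by rewrite /= divr_gt0.
move=> y; rewrite /ball /= => xy.
suff : `|cdf f x - cdf f y| <= L * `|x - y|.
  move=> /le_trans; apply; apply: (@le_trans _ _ ((L + 1) * (e / (L + 1)))).
    by apply: ler_pM => //; [rewrite lerDl|exact: ltW].
  by rewrite mulrCA divff ?mulr1// gt_eqF.
have [xy'|yx] := leP x y.
  rewrite distrC [`|x - y|]distrC !ger0_norm ?subr_ge0//; first exact: fL.
  exact: cdf_homo.
have yx' := ltW yx; rewrite !ger0_norm ?subr_ge0//; first exact: fL.
exact: cdf_homo.
Qed.

Lemma cdf_bounds f : lbump f -> exists2 r, 0 < r &
  cdf f (- r) = 0 /\ cdf f r = mass f.
Proof.
(* The function is known to vanish only where a coordinate exceeds r strictly, hence the extra 1. *)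
move=> bf; have [r [C [r0 mf fC fr]]] := bf; exists (r + 1); first lra.
split.
  rewrite /cdf /slab_mass /mass integral0_eq// => y _; congr EFin.
  rewrite indicE; case: (boolP (y \in _)); rewrite ?mulr0// inE /slab /= in_itv/= => yi.
  rewrite (fr y i) ?mul0r// ler0_norm; lra.
congr mass; apply/funext => y; rewrite indicE.
case: (boolP (y \in _)); rewrite ?mulr1// notin_setE /slab /= in_itv/= => /negP.
by rewrite -ltNge => yi; rewrite (fr y i) ?mul0r// ger0_norm; lra.
Qed.

Lemma cdf_level f c : lbump f -> 0 <= c <= mass f -> exists u, cdf f u = c.
Proof.
move=> bf cf; have [r r0 [fl fr]] := cdf_bounds bf.
have rr : - r <= r by lra.
have [||u _ <-] := @IVT R (cdf f) (- r) r c rr; last by exists u.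
  by apply: continuous_subspaceT; exact: cdf_continuous.
by rewrite fl fr ge_min le_max; have /andP[-> ->] := cf; rewrite orbT.
Qed.

End slabs.

Section separated_slabs.
Context {R : realType} {n : nat} (i : 'I_n).
Implicit Types (f : 'rV[R]_n -> R).

(** A is the left end of the i-th projection of f, up to null sets; the supremum is attained because
    the cdf is Lipschitz. *)
Lemma cdf_last_zero f : lbump f -> 0 < mass f ->
  exists2 A, cdf i f A = 0 & forall v, cdf i f v = 0 -> v <= A.
Proof.
move=> bf f0; have [r r0 [fl fr]] := cdf_bounds i bf.
pose Z := [set v | cdf i f v = 0].
have Zr v : Z v -> v <= r.
  move=> Zv; rewrite leNgt; apply/negP => rv.
  by have := cdf_homo i bf (ltW rv); rewrite Zv fr leNgt f0.
have hs : has_sup Z by split; [exists (- r)|exists r => v; exact: Zr].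
exists (sup Z); last by move=> v Zv; exact: sup_upper_bound.
have [L L0 fL] := cdf_lipschitz i bf.
apply/le_anti; rewrite cdf_ge0// andbT; apply/ler_addgt0Pr => e e0; rewrite add0r.
have L1 : 0 < L + 1 by lra.
have [v Zv vs] := sup_adherent (divr_gt0 e0 L1) hs.
have vS : v <= sup Z by exact: sup_upper_bound.
have := fL v (sup Z) vS; rewrite Zv subr0 => /le_trans; apply.
apply: (@le_trans _ _ ((L + 1) * (e / (L + 1)))).
  by apply: ler_pM; rewrite ?subr_ge0 ?lerDl//; lra.
by rewrite mulrCA divff ?mulr1// gt_eqF.
Qed.

Lemma cdf_first_full f : lbump f -> 0 < mass f ->
  exists2 B, cdf i f B = mass f & forall v, cdf i f v = mass f -> B <= v.
Proof.
move=> bf f0; have [r r0 [fl fr]] := cdf_bounds i bf.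
pose Z := [set v | cdf i f v = mass f].
have Zr v : Z v -> - r <= v.
  move=> Zv; rewrite leNgt; apply/negP => rv.
  by have := cdf_homo i bf (ltW rv); rewrite Zv fl leNgt f0.
have hs : has_inf Z by split; [exists r|exists (- r) => v; exact: Zr].
exists (inf Z); last by move=> v Zv; exact: ge_inf hs.2 _ Zv.
have [L L0 fL] := cdf_lipschitz i bf.
apply/le_anti; rewrite cdf_le_mass//=; apply/ler_addgt0Pr => e e0.
have L1 : 0 < L + 1 by lra.
have [v Zv vs] := inf_adherent (divr_gt0 e0 L1) hs.
have vS : inf Z <= v by exact: ge_inf hs.2 _ Zv.
have := fL (inf Z) v vS; rewrite Zv lerBlDl => /le_trans; apply; rewrite lerD2l.
apply: (@le_trans _ _ ((L + 1) * (e / (L + 1)))).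
  by apply: ler_pM; rewrite ?subr_ge0 ?lerDl//; lra.
by rewrite mulrCA divff ?mulr1// gt_eqF.
Qed.

(* If x |-> a x + b maps the cdf of f0 to that of f1, it fixes both ends of
   the common support, hence is the identity; otherwise two levels between
   two values that it separates cut out slabs that it does not match. *)
Lemma separated_slabs f0 f1 (k0 k1 a b : R) : lbump f0 -> lbump f1 ->
  0 < mass f0 -> 0 < mass f1 -> 0 <= k0 -> 0 <= k1 ->
  (forall y, f0 y <= k0 * f1 y) -> (forall y, f1 y <= k1 * f0 y) -> 0 < a ->
  (a = 1 /\ b = 0) \/
  exists u1 u2 v1 v2 th1 th2 : R, [/\ u1 <= u2, v1 <= v2, 0 <= th1,
    th1 < th2 & th2 <= 1] /\
    [/\ cdf i f0 u1 = th1 * mass f0, cdf i f0 u2 = th2 * mass f0,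
       cdf i f1 v1 = th1 * mass f1, cdf i f1 v2 = th2 * mass f1 &
     forall x y, u1 <= x <= u2 -> v1 <= y <= v2 -> a * x + b != y].
Proof.
move=> bf0 bf1 F0 F1 k0p k1p f01 f10 a0.
pose M0 u := cdf i f0 u / mass f0; pose M1 u := cdf i f1 u / mass f1.
pose s u := a * u + b.
have M0E u : cdf i f0 u = M0 u * mass f0 by rewrite /M0 divfK// gt_eqF.
have M1E u : cdf i f1 u = M1 u * mass f1 by rewrite /M1 divfK// gt_eqF.
have M0b u : 0 <= M0 u <= 1.
  by rewrite divr_ge0 ?cdf_ge0 ?(ltW F0)//= ler_pdivrMr// mul1r cdf_le_mass.
have M1b u : 0 <= M1 u <= 1.
  by rewrite divr_ge0 ?cdf_ge0 ?(ltW F1)//= ler_pdivrMr// mul1r cdf_le_mass.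
have lt_of_level f u c : lbump f -> cdf i f u < c -> forall w, cdf i f w = c -> u < w.
  move=> bf uc w wc; rewrite ltNge; apply/negP => wu.
  by have := cdf_homo i bf wu; rewrite wc leNgt uc.
have gt_of_level f u c : lbump f -> c < cdf i f u -> forall w, cdf i f w = c -> w < u.
  move=> bf uc w wc; rewrite ltNge; apply/negP => wu.
  by have := cdf_homo i bf wu; rewrite wc leNgt uc.
have [eqM|/existsNP[u /eqP neM]] := pselect (forall u, M0 u = M1 (s u)).
  left.
  have le0 u : cdf i f0 u <= k0 * cdf i f1 u by exact: slab_mass_le.
  have le1 u : cdf i f1 u <= k1 * cdf i f0 u by exact: slab_mass_le.
  (* Comparability of f0 and f1 makes their marginals start and end at the same places. *)
  have Z01 u : cdf i f0 u = 0 <-> cdf i f1 u = 0.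
    split=> h; apply/le_anti; rewrite cdf_ge0// andbT.
      by rewrite (le_trans (le1 u))// h mulr0.
    by rewrite (le_trans (le0 u))// h mulr0.
  have lec0 u : mass f0 - cdf i f0 u <= k0 * (mass f1 - cdf i f1 u).
    by rewrite -!cdfC//; exact: slab_mass_le.
  have lec1 u : mass f1 - cdf i f1 u <= k1 * (mass f0 - cdf i f0 u).
    by rewrite -!cdfC//; exact: slab_mass_le.
  have W01 u : cdf i f0 u = mass f0 <-> cdf i f1 u = mass f1.
    split=> h; apply/le_anti; rewrite cdf_le_mass//= -subr_le0.
      by rewrite (le_trans (lec1 u))// h subrr mulr0.
    by rewrite (le_trans (lec0 u))// h subrr mulr0.
  (* Transport by s relates the zeros of the cdf of f0 to those of f1, which are again those of f0;
     so the bijection s maps this zero set onto itself. *)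
  have Zs u : cdf i f0 u = 0 <-> cdf i f0 (s u) = 0.
    rewrite (Z01 (s u)) M0E M1E eqM; split=> /eqP; rewrite mulf_eq0.
      by rewrite (gt_eqF F0) orbF => /eqP ->; rewrite mul0r.
    by rewrite (gt_eqF F1) orbF => /eqP ->; rewrite mul0r.
  have Ws u : cdf i f0 u = mass f0 <-> cdf i f0 (s u) = mass f0.
    rewrite (W01 (s u)) M0E M1E eqM; split.
      by rewrite -[RHS]mul1r => /(mulIf (lt0r_neq0 F0)) ->; rewrite mul1r.
    by rewrite -[RHS]mul1r => /(mulIf (lt0r_neq0 F1)) ->; rewrite mul1r.
  have sinv y : s ((y - b) / a) = y by rewrite /s mulrC divfK ?gt_eqF// subrK.
  have [A ZA Amax] := cdf_last_zero bf0 F0.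
  have [B WB Bmin] := cdf_first_full bf0 F0.
  (* An increasing bijection that preserves a set fixes its largest element: s A <= A, and the
     preimage of A is also at most A. *)
  have sA : s A = A.
    apply/le_anti; rewrite (Amax _ ((Zs A).1 ZA))/= -{1}(sinv A) /s.
    by rewrite lerD2r ler_pM2l// Amax//; apply/Zs; rewrite sinv.
  have sB : s B = B.
    apply/le_anti; rewrite (Bmin _ ((Ws B).1 WB)) andbT -{2}(sinv B) /s.
    by rewrite lerD2r ler_pM2l// Bmin//; apply/Ws; rewrite sinv.
  have AB : B - A != 0.
    rewrite subr_eq0; apply/eqP => AB; move: F0; rewrite -WB AB ZA.
    by rewrite ltxx.
  have a1 : a = 1.
    apply: (mulIf AB); rewrite mul1r -[in RHS]sA -[in RHS]sB /s; ring.
  by split => //; move: sA; rewrite /s a1 mul1r => /eqP; rewrite -subr_eq0 addrC addKr => /eqP.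
right.
(* The two levels are the points at one and two thirds between the separated values. *)
have pick (lo hi : R) : 0 <= lo -> lo < hi -> hi <= 1 -> exists th1 th2 : R,
    [/\ lo < th1, th1 < th2, th2 < hi, 0 <= th1 & th2 <= 1].
  by move=> l0 lh h1; exists (lo + (hi - lo) / 3), (lo + (hi - lo) * 2 / 3); split; lra.
have level f th : lbump f -> 0 <= th <= 1 -> exists w, cdf i f w = th * mass f.
  move=> bf /andP[t0 t1]; apply: cdf_level => //.
  by rewrite mulr_ge0 ?mass_ge0//= ler_piMl// mass_ge0.
have mono f (c d w w' : R) : lbump f -> 0 < mass f -> c < d ->
    cdf i f w = c * mass f -> cdf i f w' = d * mass f -> w <= w'.
  move=> bf mf cd wc wd; apply: ltW; apply: (lt_of_level f w (d * mass f)) => //.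
  by rewrite wc ltr_pM2r.
have /orP[lt01|lt10] : (M0 u < M1 (s u)) || (M1 (s u) < M0 u).
  by rewrite -neq_lt.
- have /andP[l0 _] := M0b u; have /andP[_ l1] := M1b (s u).
  have [th1 [th2 [h1 h2 h3 h4 h5]]] := pick _ _ l0 lt01 l1.
  have t1b : 0 <= th1 <= 1 by apply/andP; split; lra.
  have t2b : 0 <= th2 <= 1 by apply/andP; split; lra.
  have [u1 u1E] := level _ _ bf0 t1b; have [u2 u2E] := level _ _ bf0 t2b.
  have [v1 v1E] := level _ _ bf1 t1b; have [v2 v2E] := level _ _ bf1 t2b.
  exists u1, u2, v1, v2, th1, th2; split; split => //; first exact: (mono f0 th1 th2).
    exact: (mono f1 th1 th2).
  (* Both levels exceed M0 u and lie below M1 (s u), so the slab of f0 is to the right of u and that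
     of f1 to the left of s u, whereas s increases. *)
  move=> x y /andP[u1x _] /andP[_ yv2]; rewrite gt_eqF//.
  have uu1 : u < u1.
    by apply: (lt_of_level f0 u (th1 * mass f0)) => //; rewrite M0E ltr_pM2r.
  have v2s : v2 < s u.
    by apply: (gt_of_level f1 (s u) (th2 * mass f1)) => //; rewrite M1E ltr_pM2r.
  apply: le_lt_trans yv2 (lt_le_trans v2s _); rewrite /s lerD2r ler_pM2l//.
  exact: le_trans (ltW uu1) u1x.
- have /andP[_ l1] := M0b u; have /andP[l0 _] := M1b (s u).
  have [th1 [th2 [h1 h2 h3 h4 h5]]] := pick _ _ l0 lt10 l1.
  have t1b : 0 <= th1 <= 1 by apply/andP; split; lra.
  have t2b : 0 <= th2 <= 1 by apply/andP; split; lra.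
  have [u1 u1E] := level _ _ bf0 t1b; have [u2 u2E] := level _ _ bf0 t2b.
  have [v1 v1E] := level _ _ bf1 t1b; have [v2 v2E] := level _ _ bf1 t2b.
  exists u1, u2, v1, v2, th1, th2; split; split => //; first exact: (mono f0 th1 th2).
    exact: (mono f1 th1 th2).
  move=> x y /andP[_ xu2] /andP[v1y _]; rewrite lt_eqF//.
  have u2u : u2 < u.
    by apply: (gt_of_level f0 u (th2 * mass f0)) => //; rewrite M0E ltr_pM2r.
  have sv1 : s u < v1.
    by apply: (lt_of_level f1 (s u) (th1 * mass f1)) => //; rewrite M1E ltr_pM2r.
  apply: lt_le_trans (le_lt_trans _ sv1) v1y; rewrite /s lerD2r ler_pM2l//.
  exact: le_trans xu2 (ltW u2u).
Qed.

End separated_slabs.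

(** * The strict inequality from three slabs *)

Section strict_bbl.
Context {R : realType}.

(** Cut f0, f1 and h off by indicators: outside the slabs the mean is 0, so the pointwise inequality
    survives. Homogeneity lets the factor c be absorbed into f0 and f1. *)
Lemma bbl_slab n (i : 'I_n) (m : nat -> R -> R -> R) lam c (J0 J1 J : set R)
    (f0 f1 h : 'rV[R]_n -> R) :
  0 < lam < 1 -> 0 <= c ->
  (forall k, (k <= n)%N -> homogeneous_mean (m k)) ->
  (forall k, (k < n)%N -> mean_step (m k) (m k.+1) lam) ->
  lbump f0 -> lbump f1 -> lbump h ->
  measurable J0 -> measurable J1 -> measurable J ->
  (forall s t, J0 s -> J1 t -> J ((1 - lam) * s + lam * t)) ->
  (forall x y : 'rV[R]_n, J0 (x ord0 i) -> J1 (y ord0 i) ->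
    c * m 0%N (f0 x) (f1 y) <= h ((1 - lam) *: x + lam *: y)) ->
  c * m n (slab_mass i f0 J0) (slab_mass i f1 J1) <= slab_mass i h J.
Proof.
move=> l01 c0 hm step b0 b1 bh mJ0 mJ1 mJ J01 mh.
have [mZ _ _ _] := hm _ (leqnn n); have [m0Z _ m00 _] := hm _ (leq0n n).
rewrite -mZ ?slab_mass_ge0// /slab_mass -!massZ//; [|exact: lbump_slab..].
apply: (bbl_lebesgue l01 hm step).
- by apply: lbumpZ => //; exact: lbump_slab.
- by apply: lbumpZ => //; exact: lbump_slab.
- exact: lbump_slab.
move=> x y; have z0 := lbump_ge0 ((1 - lam) *: x + lam *: y) bh.
have [Jx|Jx] := pselect (J0 (x ord0 i)); last first.
  by rewrite [\1__ x]indicE memNset ?mulr0 ?m00 ?mul0r ?mulr0 ?mulr_ge0.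
have [Jy|Jy] := pselect (J1 (y ord0 i)); last first.
  by rewrite [\1__ y]indicE memNset ?mulr0 ?m00 ?mul0r ?mulr0 ?mulr_ge0.
rewrite m0Z ?mulr_ge0 ?(lbump_ge0 _ b0) ?(lbump_ge0 _ b1)//.
rewrite !indicE !mem_set ?mulr1//; first exact: mh.
by rewrite /slab /= !mxE; exact: J01.
Qed.

(** The combined slabs are separated by [w u1 v1] and [w u2 v2], so their h-masses add up to the
    mass of h. With M the mean of the masses, homogeneity bounds the parts below by th1 M, c (th2 -
    th1) M and (1 - th2) M, whose sum exceeds M. *)
Lemma bbl_strict n (i : 'I_n) (m : nat -> R -> R -> R) lam
    (f0 f1 h : 'rV[R]_n -> R) (u1 u2 v1 v2 th1 th2 c : R) :
  0 < lam < 1 -> 1 < c ->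
  (forall k, (k <= n)%N -> homogeneous_mean (m k)) ->
  (forall k, (k < n)%N -> mean_step (m k) (m k.+1) lam) ->
  lbump f0 -> lbump f1 -> lbump h -> 0 < mass f0 -> 0 < mass f1 ->
  u1 <= u2 -> v1 <= v2 -> 0 <= th1 -> th1 < th2 -> th2 <= 1 ->
  cdf i f0 u1 = th1 * mass f0 -> cdf i f0 u2 = th2 * mass f0 ->
  cdf i f1 v1 = th1 * mass f1 -> cdf i f1 v2 = th2 * mass f1 ->
  (forall x y, m 0%N (f0 x) (f1 y) <= h ((1 - lam) *: x + lam *: y)) ->
  (forall x y : 'rV[R]_n, u1 <= x ord0 i <= u2 -> v1 <= y ord0 i <= v2 ->
    c * m 0%N (f0 x) (f1 y) <= h ((1 - lam) *: x + lam *: y)) ->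
  m n (mass f0) (mass f1) < mass h.
Proof.
move=> l01 c1 hm step b0 b1 bh F0 F1 u12 v12 t1 t12 t2 u1E u2E v1E v2E mh mhc.
have /andP[l0 l1] := l01; have l1' : 0 < 1 - lam by rewrite subr_gt0.
have [mZ _ _ mpos] := hm _ (leqnn n).
pose w u v := (1 - lam) * u + lam * v.
have w12 : w u1 v1 <= w u2 v2 by apply: lerD; rewrite ler_pM2l.
have M0 := mpos _ _ F0 F1; set M := m n (mass f0) (mass f1) in M0 *.
have conv_le s t u v : s <= u -> t <= v -> w s t <= w u v.
  by move=> su tv; apply: lerD; rewrite ler_pM2l.
have conv_lt s t u v : s < u -> t < v -> w s t < w u v.
  by move=> su tv; apply: ltrD; rewrite ltr_pM2l.
have part1 : th1 * M <= cdf i h (w u1 v1).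
  have := @bbl_slab _ i m lam 1 `]-oo, u1]%classic `]-oo, v1]%classic
    `]-oo, w u1 v1]%classic f0 f1 h l01 ler01 hm step b0 b1 bh.
  rewrite mul1r -/(cdf _ _ _) -/(cdf i f1 v1) u1E v1E mZ ?(ltW F0) ?(ltW F1)//.
  apply => //; first by move=> s t; rewrite /= !in_itv/=; exact: conv_le.
  by move=> x y _ _; rewrite mul1r; exact: mh.
have part2 : c * ((th2 - th1) * M) <= cdf i h (w u2 v2) - cdf i h (w u1 v1).
  have := @bbl_slab _ i m lam c `]u1, u2]%classic `]v1, v2]%classic
    `]w u1 v1, w u2 v2]%classic f0 f1 h l01 (ltW (lt_trans ltr01 c1)) hm step b0 b1 bh.
  have t21 : 0 <= th2 - th1 by rewrite subr_ge0 ltW.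
  rewrite !cdfB// u1E v1E u2E v2E -!mulrBl mZ ?(ltW F0) ?(ltW F1)//.
  apply => //.
    move=> s t; rewrite /= !in_itv/= => /andP[? ?] /andP[? ?].
    by rewrite conv_lt// conv_le.
  move=> x y; rewrite /= !in_itv/= => /andP[x1 x2] /andP[y1 y2].
  by apply: mhc; rewrite ?(ltW x1) ?(ltW y1).
have part3 : (1 - th2) * M <= mass h - cdf i h (w u2 v2).
  have := @bbl_slab _ i m lam 1 `]u2, +oo[%classic `]v2, +oo[%classic
    `]w u2 v2, +oo[%classic f0 f1 h l01 ler01 hm step b0 b1 bh.
  have t2' : 0 <= 1 - th2 by rewrite subr_ge0.
  rewrite mul1r !cdfC// u2E v2E -{1}[mass f0]mul1r -{1}[mass f1]mul1r.
  rewrite -!mulrBl mZ ?(ltW F0) ?(ltW F1)//; apply => //.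
    by move=> s t; rewrite /= !in_itv/= !andbT; exact: conv_lt.
  by move=> x y _ _; rewrite mul1r; exact: mh.
have gain : (th2 - th1) * M < c * ((th2 - th1) * M).
  by rewrite ltr_pMl// mulr_gt0// subr_gt0.
by move: part1 part2 part3 gain; rewrite !mulrBl mul1r; lra.
Qed.

(* The exponent reached after integrating out k coordinates. *)
Definition chain_exponent (g : R) (k : nat) : \bar R :=
  if 1 + k%:R * g == 0 then -oo%E else (g / (1 + k%:R * g))%:E.

Definition mean_chain (g lam : R) (k : nat) (a b : R) :=
  power_mean (chain_exponent g k) a b lam.

Lemma mean_chain_homogeneous g lam k : 0 <= lam <= 1 ->
  homogeneous_mean (mean_chain g lam k).
Proof.
move=> l01; split.
- by move=> s a b s0 a0 b0; exact: power_meanZ.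
- by move=> a b c d a0 b0 ac bd; exact: le_power_mean.
- by move=> a b ab; exact: power_mean_eq0.
- by move=> a b a0 b0; exact: power_mean_gt0.
Qed.

(** Hölder with q = 1: for p = g / (1 + k g), the exponent [ell p 1] is the next one in the chain.
    The condition p + 1 >= 0 amounts to 1 + (k + 1) g >= 0, with equality exactly when the next
    exponent is -oo. *)
Lemma mean_chain_step n g lam k : 0 <= lam <= 1 -> g <= 0 -> 0 <= 1 + n%:R * g ->
  (k < n)%N -> mean_step (mean_chain g lam k) (mean_chain g lam k.+1) lam.
Proof.
move=> l01 g0 ng kn a b c d a0 b0 c0 d0.
have /andP[l0 l1] := l01; have l1' : 0 <= 1 - lam by rewrite subr_ge0.
have kg1 : 0 <= 1 + k.+1%:R * g.
  by apply: le_trans ng _; rewrite lerD2l ler_wnM2r// ler_nat.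
have kg : 0 < 1 + k%:R * g.
  have [->|gN0] := eqVneq g 0; first by rewrite mulr0 addr0.
  apply: le_lt_trans kg1 _; rewrite ltrD2l -natr1 mulrDl mul1r gtrDl.
  by rewrite lt_neqAle gN0.
have kgN := lt0r_neq0 kg.
have S : 1 + k.+1%:R * g = 1 + k%:R * g + g by rewrite -natr1 mulrDl mul1r addrA.
pose p := g / (1 + k%:R * g).
have p0 : p <= 0 by rewrite /p pmulr_lle0 ?invr_gt0.
have p1E : p + 1 = (1 + k.+1%:R * g) / (1 + k%:R * g).
  by rewrite S /p; field.
have p1 : 0 <= p + 1 by rewrite p1E divr_ge0// ltW.
have eE : chain_exponent g k.+1 = ell p 1%:E.
  rewrite /chain_exponent /ell p1E mulf_eq0 invr_eq0 (negPf kgN) orbF.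
  have [E|N] := eqVneq (1 + k.+1%:R * g) 0.
    by rewrite oner_eq0 andbF.
  have F (x y z : R) : y != 0 -> z != 0 -> x / y / (z / y) = x / z.
    by move=> y0 z0; field; rewrite y0 z0.
  by congr EFin; rewrite /p mulr1 F.
have := power_mean_holder l01 p0 (_ : (0 <= 1%:E)%E) (_ : (0 <= p%:E + 1%:E)%E) a0 b0 c0 d0.
rewrite lee_fin ler01 -EFinD lee_fin p1 => /(_ isT isT).
rewrite /mean_chain eE /chain_exponent (negPf kgN) -/p => /le_trans; apply.
apply: ler_wpM2l; first exact: power_mean_ge0.
(* The mean of exponent 1 is set to 0 when c d = 0, so there it is only bounded by the arithmetic
   mean. *)
have [cd0|cd0] := eqVneq (c * d) 0.
  by rewrite power_mean_eq0// addr_ge0// mulr_ge0.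
have cp : 0 < c by rewrite lt0r c0 andbT; apply: contraNneq cd0 => ->; rewrite mul0r.
have dp : 0 < d by rewrite lt0r d0 andbT; apply: contraNneq cd0 => ->; rewrite mulr0.
by rewrite (power_mean_1 l01 cp dp).
Qed.

Lemma chain_exponent0 g : chain_exponent g 0 = g%:E.
Proof. by rewrite /chain_exponent mul0r addr0 oner_eq0 divr1. Qed.

Lemma chain_exponent_convolution n g : (0 < n)%N ->
  chain_exponent g n = convolution_exponent n g%:E.
Proof.
move=> n0; have nN0 : n%:R != 0 :> R by rewrite pnatr_eq0 -lt0n.
rewrite /chain_exponent /convolution_exponent.
rewrite (_ : (1 + n%:R * g == 0) = (g == - n%:R^-1))//.
apply/eqP/eqP => [|->]; last by rewrite mulrN divff// subrr.
move/eqP; rewrite addrC addr_eq0 => /eqP h.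
by apply: (mulfI nN0); rewrite h mulrN divff.
Qed.

Lemma power_mean_continuous (T : topologicalType) (p lam : R) (F G : T -> R) :
  0 <= lam <= 1 -> continuous F -> continuous G -> (forall z, 0 < F z) ->
  (forall z, 0 < G z) ->
  continuous (fun z => power_mean p%:E (F z) (G z) lam).
Proof.
move=> l01 cF cG F0 G0.
have cpow r (H : T -> R) : continuous H -> (forall z, 0 < H z) ->
    continuous (fun z => H z `^ r).
  move=> cH H0 z; rewrite (_ : (fun z => H z `^ r) = (fun z => expR (r * ln (H z)))).
    apply: (@continuous_comp _ _ _ H (fun t => expR (r * ln t))); first exact: cH.
    apply: continuous_comp; last exact: continuous_expR.
    apply: continuousM; first exact: cst_continuous.
    exact: continuous_ln.
  by apply/funext => y; rewrite /powR gt_eqF.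
have cmul (H K : T -> R) : continuous H -> continuous K ->
    continuous (fun z => H z * K z).
  by move=> cH cK z; apply: (@continuousM _ _ H K z); [exact: cH|exact: cK].
have cadd (H K : T -> R) : continuous H -> continuous K ->
    continuous (fun z => H z + K z).
  by move=> cH cK z; apply: (@continuousD _ _ _ H K z); [exact: cH|exact: cK].
have ccst (c : R) : continuous (fun _ : T => c) by move=> z; exact: cst_continuous.
have [->|p0] := eqVneq p 0.
  rewrite (_ : (fun z => _) = (fun z => F z `^ (1 - lam) * G z `^ lam)).
    by apply: cmul; exact: cpow.
  by apply/funext => z; rewrite power_mean0.
rewrite (_ : (fun z => _) =
    (fun z => ((1 - lam) * F z `^ p + lam * G z `^ p) `^ p^-1)).
  apply: (cpow); last by move=> z; apply: conv_gt0; rewrite // powR_gt0.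
  by apply: cadd; apply: cmul; [exact: ccst|exact: cpow|exact: ccst|exact: cpow].
by apply/funext => z; rewrite (power_mean_fin _ p0 (F0 z) (G0 z)).
Qed.

(** The factor is the minimum of G / F over K, or any constant above 1 if K is empty. *)
Lemma compact_uniform_factor (T : topologicalType) (K : set T) (F G : T -> R) :
  compact K -> continuous F -> continuous G -> (forall z, 0 < F z) ->
  (forall z, K z -> F z < G z) ->
  exists2 c, 1 < c & forall z, K z -> c * F z <= G z.
Proof.
move=> cK cF cG F0 FG; have [K0|/set0P/negP/negPn/eqP K0] := pselect (K !=set0); last first.
  by exists 2; rewrite ?ltr1n// => z; rewrite K0.
have cq : continuous (fun z => G z / F z).
  move=> z; apply: (@continuousM _ _ G (fun z => (F z)^-1) z); first exact: cG.
  by apply: (@continuousV _ _ F z); [rewrite gt_eqF|exact: cF].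
have [z Kz zmin] := compact_EVT_min K0 cK (continuous_subspaceT cq).
rewrite inE in Kz; exists (G z / F z); first by rewrite ltr_pdivlMr// mul1r FG.
by move=> y Ky; rewrite -ler_pdivlMr//; apply: zmin; rewrite inE.
Qed.

End strict_bbl.

(** * Parabolic concavity *)

Section parabolic_rays.
Context {R : realType}.
Implicit Types (alpha t lam : R).

(** The denominator in the ray condition; it lets alpha = 0 and alpha != 0 be treated together. *)
Definition ray_scale alpha t := if alpha == 0 then ln t else t `^ alpha.

Lemma same_parabolic_rayE n alpha (z0 z1 : 'rV[R]_n * R) :
  same_parabolic_ray alpha z0 z1 <->
  (ray_scale alpha z0.2)^-1 *: z0.1 = (ray_scale alpha z1.2)^-1 *: z1.1.
Proof. by rewrite /same_parabolic_ray /ray_scale; case: ifP. Qed.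

Lemma ray_scale_gt0 alpha t : 0 < t -> (alpha = 0 -> 1 < t) -> 0 < ray_scale alpha t.
Proof.
by move=> t0 t1; rewrite /ray_scale; case: eqP => [/t1/ln_gt0//|_]; exact: powR_gt0.
Qed.

Lemma ray_scale_inj alpha s t : 0 < s -> 0 < t ->
  ray_scale alpha s = ray_scale alpha t -> s = t.
Proof.
move=> s0 t0; rewrite /ray_scale; case: (eqVneq alpha 0) => [_|a0].
  by apply: ln_inj; rewrite posrE.
move=> /(congr1 (fun x => x `^ alpha^-1)).
by rewrite (powRVK a0 (ltW s0)) (powRVK a0 (ltW t0)).
Qed.

Lemma segment_pointB n (x0 x1 y0 y1 : 'rV[R]_n) lam :
  segment_point (x0 - y0) (x1 - y1) lam =
  segment_point x0 x1 lam - segment_point y0 y1 lam.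
Proof. by rewrite /segment_point !scalerBr opprD addrACA. Qed.

Lemma segment_pointxx n (x : 'rV[R]_n) lam : segment_point x x lam = x.
Proof. by rewrite /segment_point -scalerDl subrK scale1r. Qed.

Lemma segment_point_continuous n lam :
  continuous (fun y : 'rV[R]_n * 'rV[R]_n => segment_point y.1 y.2 lam).
Proof.
move=> y; apply: (@continuousD _ _ _ (fun y : 'rV[R]_n * 'rV[R]_n => (1 - lam) *: y.1)
  (fun y => lam *: y.2)).
  apply: (@continuous_comp _ _ _ fst (fun x : 'rV[R]_n => (1 - lam) *: x)).
    exact: cvg_fst.
  exact: scaler_continuous.
apply: (@continuous_comp _ _ _ snd (fun x : 'rV[R]_n => lam *: x)).
  exact: cvg_snd.
exact: scaler_continuous.
Qed.

End parabolic_rays.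

(** * What strictness at a fixed time says about the kernel *)

Section kernel.
Context {R : realType} {n : nat} (I : set R) (phi : 'rV[R]_n * R -> R) (alpha p : R).
Context (n_gt0 : (0 < n)%N) (I_gt0 : I `<=` [set t | 0 < t])
  (I_gt1 : alpha = 0 -> I `<=` [set t | 1 < t])
  (phi_ge0 : forall z, ([set: 'rV[R]_n] `*` I) z -> 0 <= phi z)
  (phi_concave : almost_strictly_parabolically_concave alpha p%:E
       ([set: 'rV[R]_n] `*` I) phi).

Let E := [set: 'rV[R]_n] `*` I.

Lemma time_scale_gt0 t : I t -> 0 < ray_scale alpha t.
Proof. by move=> It; apply: ray_scale_gt0 => [|/I_gt1]; [exact: I_gt0|exact]. Qed.

Lemma kernel_le z0 z1 lam : E z0 -> E z1 -> 0 <= lam <= 1 ->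
  power_mean p%:E (phi z0) (phi z1) lam <= phi (parabolic_point alpha z0 z1 lam).
Proof. by case: phi_concave => -[_ h] _; exact: h. Qed.

Lemma kernel_lt z0 z1 lam : E z0 -> E z1 -> 0 < lam < 1 ->
  ~ same_parabolic_ray alpha z0 z1 ->
  power_mean p%:E (phi z0) (phi z1) lam < phi (parabolic_point alpha z0 z1 lam).
Proof.
move=> E0 E1 /andP[l0 l1] nsame; have l01 : 0 <= lam <= 1 by rewrite !ltW.
rewrite lt_neqAle kernel_le// andbT; apply/eqP => /esym eqn.
case: phi_concave => _ /(_ z0 z1 lam E0 E1 l01 (or_introl isT)) [/(_ eqn) + _].
by case=> [//|le|le]; [rewrite le ltxx in l0|rewrite le ltxx in l1].
Qed.

Lemma parabolic_point_time (x0 x1 : 'rV[R]_n) t lam : I t ->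
  parabolic_point alpha (x0, t) (x1, t) lam = (segment_point x0 x1 lam, t).
Proof.
by move=> It; rewrite /parabolic_point /= power_meanxx// ltW//; exact: I_gt0.
Qed.

Lemma distinct_rays (x0 x1 : 'rV[R]_n) t : I t -> x0 != x1 ->
  ~ same_parabolic_ray alpha (x0, t) (x1, t).
Proof.
move=> It /eqP x01; rewrite same_parabolic_rayE /= => h; apply: x01.
have s0 := lt0r_neq0 (time_scale_gt0 It).
by move: h => /(congr1 ( *:%R (ray_scale alpha t))); rewrite !scalerA mulfV// !scale1r.
Qed.

Let e : 'rV[R]_n := const_mx 1.

Let e_neq0 : e != 0.
Proof.
apply/eqP => /rowP /(_ (Ordinal n_gt0)); rewrite !mxE => /eqP.
by rewrite oner_eq0.
Qed.

(** At a fixed time x is the midpoint of two points on different rays, so [phi] strictly exceeds a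
    nonnegative mean there. *)
Lemma kernel_gt0 z : E z -> 0 < phi z.
Proof.
case: z => x t [_ /= It].
have l01 : 0 < (2^-1 : R) < 1 by apply/andP; split; lra.
have dis : x - e != x + e.
  rewrite -subr_eq0 opprD addrACA subrr add0r -opprD oppr_eq0 -mulr2n.
  by rewrite -scaler_nat scaler_eq0 pnatr_eq0.
have E0 : E (x - e, t) by split.
have E1 : E (x + e, t) by split.
have := kernel_lt E0 E1 l01 (distinct_rays It dis).
rewrite parabolic_point_time// (_ : segment_point _ _ _ = x).
  by apply: le_lt_trans; apply: power_mean_ge0; exact: phi_ge0.
by apply/rowP => i; rewrite !mxE; field.
Qed.

Lemma kernel_power_concave t : I t -> power_concave p%:E setT (fun x => phi (x, t)).
Proof.
move=> It x0 x1 lam _ _ l01.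
have E0 : E (x0, t) by split.
have E1 : E (x1, t) by split.
by have := kernel_le E0 E1 l01; rewrite parabolic_point_time.
Qed.

(** For p > 0 the positive function phi (., t) would be constant by [power_concave_pos_cst], giving
    equality between points on different rays. *)
Lemma kernel_exponent_le0 t : I t -> p <= 0.
Proof.
move=> It; rewrite leNgt; apply/negP => p0.
have pos x : 0 < phi (x, t) by apply: kernel_gt0.
have cst x y : phi (x, t) = phi (y, t).
  apply/le_anti; rewrite (power_concave_pos_cst p0 pos (kernel_power_concave It) x y).
  by rewrite (power_concave_pos_cst p0 pos (kernel_power_concave It) y x).
have l01 : 0 < (2^-1 : R) < 1 by apply/andP; split; lra.
have E0 : E (0, t) by split.
have E1 : E (e, t) by split.
have e0 : 0 != e by rewrite eq_sym.
have := kernel_lt E0 E1 l01 (distinct_rays It e0).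
rewrite parabolic_point_time//.
by rewrite (cst 0 e) power_meanxx ?(ltW (pos _))// (cst _ e) ltxx.
Qed.

Lemma kernel_section_continuous x t : I t ->
  continuous (fun y : 'rV[R]_n => phi (x - y, t)).
Proof.
move=> It; apply: (power_concave_continuous (kernel_exponent_le0 It)).
  by move=> y; exact: kernel_gt0.
move=> y0 y1 lam _ _ l01.
have h := kernel_power_concave It.
have := h (x - y0) (x - y1) lam Logic.I Logic.I l01.
by rewrite segment_pointB segment_pointxx.
Qed.

End kernel.

Theorem theorem3p6 (R : realType) (n : nat) (n_gt0 : (0 < n)%N)
    (I : set R) (I_itv : is_interval I) (I_gt0 : I `<=` [set t | 0 < t])
    (phi : 'rV[R]_n * R -> R) (psi : 'rV[R]_n -> R)
    (alpha p : R) (q : \bar R) (q_neqNy : q != -oo%E)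
    (I_gt1 : alpha = 0 -> I `<=` [set t | 1 < t])
    (phi_ge0 : forall z, ([set: 'rV[R]_n] `*` I) z -> 0 <= phi z)
    (phi_meas : measurable_fun
       (@split_rV R n @^-1` ([set: 'rV[R]_n] `*` I) : set (lebesgue_rV R n.+1))
       (phi \o @split_rV R n : lebesgue_rV R n.+1 -> R))
    (psi_ge0 : forall y, 0 <= psi y)
    (psi_meas : measurable_fun setT (psi : lebesgue_rV R n -> R))
    (phi_concave : almost_strictly_parabolically_concave alpha p%:E
       ([set: 'rV[R]_n] `*` I) phi)
    (psi_concave : power_concave q [set: 'rV[R]_n] psi)
    (supp_bounded : bounded_set (~` (psi @^-1` [set 0])))
    (supp_interior : interior (~` (psi @^-1` [set 0])) !=set0)
    (pq_ge0 : (0 <= p%:E + q)%E)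
    (ell_ge : ((- n%:R^-1)%:E <= ell p q)%E) :
  (forall z, ([set: 'rV[R]_n] `*` I) z -> convolution phi psi z \is a fin_num)
  /\ strictly_parabolically_concave alpha (convolution_exponent n (ell p q))
       ([set: 'rV[R]_n] `*` I) (fun z => fine (convolution phi psi z)).
Proof.
set E := [set: 'rV[R]_n] `*` I.
have Ept (x : 'rV[R]_n) t : I t -> E (x, t) by move=> It; split.
have [[E_conv _] _] := phi_concave.
(* The sign of p is read off at a time of I, so an empty I is dealt with apart. *)
have [noI|[t It]] : (forall t, ~ I t) \/ exists t, I t.
  by have [h|h] := pselect (exists t, I t); [right|left => t It; apply: h; exists t].
  split; first by move=> z [_ /noI].
  split; last by move=> z0 z1 lam [_ /noI].
  by split => // z0 z1 lam [_ /noI].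
have p_le0 : p <= 0 by exact: (kernel_exponent_le0 n_gt0 I_gt0 I_gt1 phi_ge0 phi_concave It).
have q_ge0 : (0 <= q)%E.
  case: q pq_ge0 q_neqNy {psi_concave ell_ge} => [r| |] //; rewrite !lee_fin => h _.
  by lra.
(* The lower bound -1/n excludes the value -oo of the exponent, and p <= 0 <= q gives its sign. *)
have [g [g_le0 ng ellE]] : exists g : R, [/\ g <= 0, 0 <= 1 + n%:R * g & ell p q = g%:E].
  have nR : 0 < (n%:R : R) by rewrite ltr0n.
  have ngE (g : R) : - n%:R^-1 <= g -> 0 <= 1 + n%:R * g.
    move=> h; have := ler_wpM2l (ltW nR) h; rewrite mulrN divff ?gt_eqF//.
    by rewrite -lerBlDl sub0r.
  move: ell_ge q_ge0 pq_ge0; rewrite /ell.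
  case: q {psi_concave q_neqNy} => [r| |] //; last first.
    by rewrite lee_fin => h _ _; exists p; split => //; exact: ngE.
  case: ifPn => [prN0|_]; last first.
    case: ifPn => _ // _ _ _; exists 0; split => //; by rewrite mulr0 addr0.
  rewrite -EFinD !lee_fin => h r0 pr; exists (p * r / (p + r)); split => //; last exact: ngE.
  by rewrite mulr_le0_ge0 ?invr_ge0// mulr_le0_ge0.
have eE : convolution_exponent n (ell p q) = chain_exponent g n.
  by rewrite ellE chain_exponent_convolution.
pose f (z : 'rV[R]_n * R) (y : 'rV[R]_n) := phi (z.1 - y, z.2) * psi y.
pose G z := mass (f z).
have phi_pos z : E z -> 0 < phi z by exact: (kernel_gt0 n_gt0 I_gt0 I_gt1 phi_ge0 phi_concave).
have phi_pos' z y : E z -> 0 < phi (z.1 - y, z.2).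
  by move=> [_ Iz]; apply: phi_pos; exact: Ept.
have phi_cont z : E z -> continuous (fun y : 'rV[R]_n => phi (z.1 - y, z.2)).
  by move=> [_ Iz]; exact: (kernel_section_continuous n_gt0 I_gt0 I_gt1 phi_ge0 phi_concave).
have f_bump z : E z -> lbump (f z).
  move=> Ez; apply: (weighted_lbump q_ge0 psi_ge0 psi_meas psi_concave) => //.
    exact: phi_cont.
  by move=> y; exact: phi_pos'.
have G_pos z : E z -> 0 < G z.
  move=> Ez; apply: (weighted_mass_gt0 q_ge0 psi_ge0 psi_meas psi_concave) => //.
    exact: phi_cont.
  by move=> y; exact: phi_pos'.
have GE z : fine (convolution phi psi z) = G z by [].
split; first by move=> z Ez; exact: (lbump_fin_num (f_bump z Ez)).
have E_mid z0 z1 lam : E z0 -> E z1 -> 0 <= lam <= 1 -> E (parabolic_point alpha z0 z1 lam).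
  by move=> E0 E1 l01; exact: E_conv.
have pt_sub z0 z1 lam y0 y1 :
    ((parabolic_point alpha z0 z1 lam).1 - segment_point y0 y1 lam,
     (parabolic_point alpha z0 z1 lam).2) =
    parabolic_point alpha (z0.1 - y0, z0.2) (z1.1 - y1, z1.2) lam.
  by rewrite /parabolic_point /= segment_pointB.
have f_le z0 z1 lam : E z0 -> E z1 -> 0 <= lam <= 1 -> forall y0 y1,
    mean_chain g lam 0 (f z0 y0) (f z1 y1) <=
    f (parabolic_point alpha z0 z1 lam) (segment_point y0 y1 lam).
  move=> E0 E1 l01 y0 y1; rewrite /mean_chain chain_exponent0 -ellE.
  apply: (@le_trans _ _ (power_mean p%:E (phi (z0.1 - y0, z0.2)) (phi (z1.1 - y1, z1.2)) lam
     * power_mean q (psi y0) (psi y1) lam)).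
    by apply: power_mean_holder => //; apply: ltW; exact: phi_pos'.
  rewrite /f pt_sub; apply: ler_pM; rewrite ?power_mean_ge0 ?(ltW (phi_pos' _ _ _))//.
    by apply: (kernel_le phi_concave).
  exact: psi_concave.
have hm lam : 0 <= lam <= 1 -> forall k, (k <= n)%N -> homogeneous_mean (mean_chain g lam k).
  by move=> l01 k _; exact: mean_chain_homogeneous.
have hs lam : 0 <= lam <= 1 ->
    forall k, (k < n)%N -> mean_step (mean_chain g lam k) (mean_chain g lam k.+1) lam.
  by move=> l01 k; exact: mean_chain_step.
(* The integral inequality requires 0 < lam < 1; at the endpoints the parabolic point is z0 or z1
   itself. *)
have G_end0 z0 z1 : E z0 -> E z1 -> G (parabolic_point alpha z0 z1 0) = G z0.
  move=> [_ I0] [_ I1]; congr G; case: z0 z1 I0 I1 => [x0 t0] [x1 t1] /= I0 I1.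
  rewrite /parabolic_point /segment_point /= subr0 scale1r scale0r addr0.
  by rewrite power_mean_lam0//; exact: I_gt0.
have G_end1 z0 z1 : E z0 -> E z1 -> G (parabolic_point alpha z0 z1 1) = G z1.
  move=> [_ I0] [_ I1]; congr G; case: z0 z1 I0 I1 => [x0 t0] [x1 t1] /= I0 I1.
  rewrite /parabolic_point /segment_point /= subrr scale1r scale0r add0r.
  by rewrite power_mean_lam1//; exact: I_gt0.
have G_le z0 z1 lam : E z0 -> E z1 -> 0 < lam < 1 ->
    mean_chain g lam n (G z0) (G z1) <= G (parabolic_point alpha z0 z1 lam).
  move=> E0 E1 l01; have /andP[l0 l1] := l01.
  have l01' : 0 <= lam <= 1 by rewrite !ltW.
  apply: (bbl_lebesgue l01 (hm _ l01') (hs _ l01')).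
  - exact: f_bump.
  - exact: f_bump.
  - by apply: f_bump; exact: E_mid.
  - exact: f_le.
rewrite eE; split.
  split => // z0 z1 lam E0 E1 l01; rewrite !GE.
  have [->|lN0] := eqVneq lam 0.
    rewrite G_end0//; have := G_pos _ E0; have := G_pos _ E1.
    rewrite /chain_exponent; case: ifP => _ G1 G0.
      by rewrite power_mean_ninfty// ge_min lexx.
    by rewrite power_mean_lam0.
  have [->|lN1] := eqVneq lam 1.
    rewrite G_end1//; have := G_pos _ E0; have := G_pos _ E1.
    rewrite /chain_exponent; case: ifP => _ G1 G0.
      by rewrite power_mean_ninfty// ge_min lexx orbT.
    by rewrite power_mean_lam1.
  apply: G_le => //; have /andP[l0 l1] := l01.
  by rewrite lt0r lN0 l0 lt_neqAle lN1 l1.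
move=> z0 z1 lam E0 E1 l01 guard; rewrite !GE.
have G0 := G_pos _ E0; have G1 := G_pos _ E1.
split; last first.
  case=> [E01|lE|lE].
  - rewrite -E01 power_meanxx ?(ltW G0)//; congr G.
    case: z0 E0 {E01 G0} => x0 t0 [_ /= I0].
    by rewrite (parabolic_point_time alpha I_gt0)// segment_pointxx.
  (* At an endpoint the guard leaves only a finite exponent, for which the mean is the value at that
     end. *)
  - move: guard; rewrite lE ltxx /= G_end0// => -[|//].
    by rewrite /chain_exponent; case: ifP => // _ _; rewrite power_mean_lam0.
  - move: guard; rewrite lE ltxx andbF G_end1// => -[|//].
    by rewrite /chain_exponent; case: ifP => // _ _; rewrite power_mean_lam1.
move=> eqG.
have [->|lN0] := eqVneq lam 0; first by constructor 2.
have [->|lN1] := eqVneq lam 1; first by constructor 3.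
constructor 1; have /andP[l0' l1'] := l01.
have l0 : 0 < lam by rewrite lt0r lN0.
have l1 : lam < 1 by rewrite lt_neqAle lN1.
have l01s : 0 < lam < 1 by rewrite l0.
have [_ I0] := E0; have [_ I1] := E1.
have s0 := time_scale_gt0 I_gt0 I_gt1 I0; have s1 := time_scale_gt0 I_gt0 I_gt1 I1.
(* The ray condition for (x0 - y0, t0) and (x1 - y1, t1) says y1 = a y0 + (x1 - a x0). *)
pose a := ray_scale alpha z1.2 / ray_scale alpha z0.2.
have a0 : 0 < a by rewrite divr_gt0.
have [r [r0 f_out]] : exists r : R, 0 < r /\ forall y, psi y != 0 -> cube r y.
  have [r [C [r0 _ _ pr]]] := weight_lbump q_ge0 psi_ge0 psi_meas psi_concave
    supp_bounded supp_interior.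
  by exists r; split => // y; exact: support_cube.
pose phi0 y := phi (z0.1 - y, z0.2); pose phi1 y := phi (z1.1 - y, z1.2).
(* A quotient of positive continuous functions is bounded on the cube that contains the support of
   psi; this makes f0 and f1 comparable. *)
have ratio (u v : 'rV[R]_n -> R) : continuous u -> continuous v ->
    (forall y, 0 < u y) -> (forall y, 0 < v y) ->
    exists2 k, 0 <= k & forall y, u y * psi y <= k * (v y * psi y).
  move=> cu cv u0 v0.
  have cq : continuous (fun y => u y / v y).
    move=> y; apply: (@continuousM _ _ u (fun y => (v y)^-1) y); first exact: cu.
    by apply: (@continuousV _ _ v y); [rewrite gt_eqF|exact: cv].
  have [k kq] := continuous_bounded_cube cq r0.
  exists (Num.max 0 k) => [|y]; first by rewrite le_max lexx.
  have [->|py] := eqVneq (psi y) 0; first by rewrite !mulr0.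
  rewrite mulrA ler_wpM2r// -ler_pdivrMr//.
  by rewrite (le_trans (kq _ (f_out _ py)))// le_max lexx orbT.
have pos0 y : 0 < phi0 y by exact: phi_pos'.
have pos1 y : 0 < phi1 y by exact: phi_pos'.
have [k0 k0p f01] := ratio _ _ (phi_cont _ E0) (phi_cont _ E1) pos0 pos1.
have [k1 k1p f10] := ratio _ _ (phi_cont _ E1) (phi_cont _ E0) pos1 pos0.
have rigid i : a = 1 /\ z1.1 ord0 i - a * z0.1 ord0 i = 0.
  have [//|[u1 [u2 [v1 [v2 [th1 [th2 [[u12 v12 t1 t12 t2] [u1E u2E v1E v2E sep]]]]]]]]] :=
    separated_slabs i (z1.1 ord0 i - a * z0.1 ord0 i) (f_bump _ E0) (f_bump _ E1) G0 G1
      k0p k1p f01 f10 a0.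
  exfalso.
  (* A slab is unbounded in the other directions; cutting it by the cube makes it compact and loses
     only points where psi vanishes. *)
  pose Y (u v : R) := box (fun j : 'I_n =>
    `[(if j == i then u else - r), (if j == i then v else r)]%classic).
  have cK : compact (Y u1 u2 `*` Y v1 v2) by apply: compact_setX; exact: compact_box.
  pose F (y : 'rV[R]_n * 'rV[R]_n) := power_mean p%:E (phi0 y.1) (phi1 y.2) lam.
  pose zl := parabolic_point alpha z0 z1 lam.
  have El : E zl by exact: E_mid.
  pose H (y : 'rV[R]_n * 'rV[R]_n) := phi (zl.1 - segment_point y.1 y.2 lam, zl.2).
  have cF : continuous F.
    apply: power_mean_continuous => //.
    - move=> y; apply: (@continuous_comp _ _ _ fst phi0); first exact: cvg_fst.
      exact: phi_cont.
    - move=> y; apply: (@continuous_comp _ _ _ snd phi1); first exact: cvg_snd.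
      exact: phi_cont.
  have cH : continuous H.
    move=> y; apply: (@continuous_comp _ _ _
      (fun y : 'rV[R]_n * 'rV[R]_n => segment_point y.1 y.2 lam)
      (fun y => phi (zl.1 - y, zl.2))); first exact: segment_point_continuous.
    exact: phi_cont.
  have F0 y : 0 < F y by apply: power_mean_gt0.
  (* On the ray condition, the i-th coordinates would be matched by the affine map that the slabs
     avoid. *)
  have FH y : (Y u1 u2 `*` Y v1 v2) y -> F y < H y.
    case: y => y0 y1 [/= Yy0 Yy1]; rewrite /F /H pt_sub.
    apply: (kernel_lt phi_concave) => //.
    rewrite same_parabolic_rayE /= => /rowP/(_ i); rewrite !mxE => h.
    have := sep (y0 ord0 i) (y1 ord0 i); have := Yy0 i; have := Yy1 i.
    rewrite /= eqxx !in_itv/= => -> -> /(_ isT isT) /eqP; apply.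
    have s0N := lt0r_neq0 s0; have s1N := lt0r_neq0 s1.
    have {}h : z1.1 ord0 i - y1 ord0 i = a * (z0.1 ord0 i - y0 ord0 i).
      by rewrite /a -mulrA h mulrA mulfV// mul1r.
    by move: h; rewrite mulrBr; lra.
  have [c c1 cFH] := compact_uniform_factor cK cF cH F0 FH.
  have := bbl_strict l01s c1 (hm _ l01) (hs _ l01) (f_bump _ E0) (f_bump _ E1)
    (f_bump _ El) G0 G1 u12 v12 t1 t12 t2 u1E u2E v1E v2E (f_le _ _ _ E0 E1 l01).
  move=> /(_ _)/lt_eqF; rewrite -/(G z0) -/(G z1) -/(G zl).
  move=> /(_ _)/negP; apply; last by apply/eqP; rewrite /zl eqG.
  move=> y0 y1 y0i y1i.
  (* Where psi vanishes at y0 or y1 the mean is 0; otherwise both points lie in the compact boxes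
     and the uniform factor applies. *)
  have [y0z|y0N] := eqVneq (psi y0) 0.
    rewrite /mean_chain power_mean_eq0 ?mulr0; first exact: lbump_ge0 (f_bump _ El).
    by rewrite /f y0z mulr0 mul0r.
  have [y1z|y1N] := eqVneq (psi y1) 0.
    rewrite /mean_chain power_mean_eq0 ?mulr0; first exact: lbump_ge0 (f_bump _ El).
    by rewrite /f y1z !mulr0.
  have inY (u v : R) (y : 'rV[R]_n) : u <= y ord0 i <= v -> psi y != 0 -> Y u v y.
    move=> yi py j /=; case: eqP => [->|_]; first by rewrite in_itv.
    exact: (f_out _ py j).
  rewrite /mean_chain chain_exponent0 -ellE.
  apply: (@le_trans _ _ (c * F (y0, y1) * power_mean q (psi y0) (psi y1) lam)).
    rewrite -mulrA ler_wpM2l ?(le_trans ler01 (ltW c1))//.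
    by apply: power_mean_holder => //; apply: ltW; [exact: pos0|exact: pos1].
  rewrite /f; apply: ler_pM.
  - by rewrite mulr_ge0 ?(ltW (F0 _))// (le_trans ler01)// ltW.
  - exact: power_mean_ge0.
  - by apply: cFH; split; exact: inY.
  - exact: psi_concave.
(* One coordinate suffices for a = 1, which gives t0 = t1; the translation parts of all coordinates
   then give x0 = x1. *)
have [a1 _] := rigid (Ordinal n_gt0).
have t01 : z0.2 = z1.2.
  apply: (ray_scale_inj (alpha := alpha)); [exact: I_gt0|exact: I_gt0|].
  by move: a1 => /(congr1 (fun x => x * ray_scale alpha z0.2)); rewrite /a divfK ?gt_eqF// mul1r.
have x01 : z0.1 = z1.1.
  apply/rowP => i; have [_] := rigid i; rewrite a1 mul1r => /eqP.
  by rewrite subr_eq0 eq_sym => /eqP.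
by rewrite (surjective_pairing z0) (surjective_pairing z1) t01 x01.
Qed.
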